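(* Fix an irrational $\alpha$ and let $\mathcal{D}_\alpha(\Sigma_2,\sigma)$ denote the set of Denjoy minimal sets in the full two-shift $(\Sigma_2,\sigma)$ with intrinsic rotation number $\alpha$. (a) When given the weak topology, the space $\mathcal{D}_\alpha(\Sigma_2,\sigma)$ contains topological balls of dimension $n$ for all natural numbers $n$. (b) The set of points that are members of Denjoy minimal sets with intrinsic rotation number $\alpha$ is dense in $\Sigma_2$. (c) If $(D,\sigma)$, $D\subset\Sigma_2$, is a Denjoy minimal set with intrinsic rotation number $\alpha$, then $D=\Lambda(U,\alpha)$ for some regular open set $U\subset S^1$ with $m(Fr(U))=0$. Consequently, identifying each Denjoy minimal set with its unique invariant probability measure, $\mathcal{D}_\alpha(\Sigma_2,\sigma)\subset\lambda(\mathcal{RO}_0,\alpha)=\{\lambda(U,\alpha):U\in\mathcal{RO}_0\}$.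
   Context: Shift: $\Sigma_2=\{0,1\}^{\mathbb{Z}}$ with the product topology, $\sigma$ the shift, $(\sigma(s))_i=s_{i+1}$. $\mathcal{M}(\Sigma_2,\sigma)$ is the set of $\sigma$-invariant Borel probability measures with the weak topology ($\mu_n\to\mu_0$ iff $\int f\,d\mu_n\to\int f\,d\mu_0$ for all continuous $f:\Sigma_2\to\mathbb{R}$). A Denjoy example is an (orientation-preserving) circle homeomorphism with irrational rotation number that is not minimal (not every orbit is dense); it has a unique minimal set. A Denjoy minimal set is a dynamical system (homeomorphism of a compact metric space) topologically conjugate to the restriction of a Denjoy example $g$ to its minimal set; its intrinsic rotation number is the rotation number of $g$, which is well defined up to replacing $g$ by $g^{-1}$ (i.e. up to sign, modulo $1$). A Denjoy minimal set has exactly one invariant Borel probability measure. A Denjoy minimal set in $(\Sigma_2,\sigma)$ is a compact $\sigma$-invariant $D\subset\Sigma_2$ such that $(D,\sigma|_D)$ is a Denjoy minimal set. The weak topology on $\mathcal{D}_\alpha(\Sigma_2,\sigma)$ is induced by the injection into $\mathcal{M}(\Sigma_2,\sigma)$ sending each set to its unique invariant probability measure. Circle: $S^1=\mathbb{R}/\mathbb{Z}$, $R_\eta(\theta)=\theta+\eta\bmod 1$, $m$ is Haar (probability) measure, $Fr$ denotes frontier. A nonempty proper subset $U\subset S^1$ is regular open if it equals the interior of its closure. $\mathcal{RO}_0$ is the set of regular open $U\subset S^1$ with $m(Fr(U))=0$. Construction: for a regular open set $U$ and $r\in S^1$ let $B=\{x\in S^1: R_r^i(x)\notin Fr(U)\text{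 for all }i\in\mathbb{Z}\}$ and define $\phi:B\to\Sigma_2$ by $(\phi(x))_i=1$ if $R_r^i(x)\in U$ and $(\phi(x))_i=0$ otherwise. Set $\Lambda(U,r)$ equal to the closure of $\phi(B)$ in $\Sigma_2$. If $U\in\mathcal{RO}_0$, then $m(B)=1$ and $\lambda(U,r)\in\mathcal{M}(\Sigma_2,\sigma)$ is the measure $\phi_\ast(m)$, i.e. $\lambda(U,r)(X)=m(\phi^{-1}(X))$ for Borel $X$. *)

(* Defs.v *)
From HB Require Import structures.
From mathcomp Require Import all_boot all_order all_algebra.
From mathcomp Require Import generic_quotient ring_quotient archimedean.
From mathcomp Require Import all_classical all_reals all_analysis.

Set Implicit Arguments.
Unset Strict Implicit.
Unset Printing Implicit Defensive.
Import Order.TTheory GRing.Theory Num.Theory.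
Import numFieldTopology.Exports numFieldNormedType.Exports.
Local Open Scope classical_set_scope.
Local Open Scope ring_scope.

Definition homeomorphism (X Y : topologicalType) (h : X -> Y) : Prop :=
  exists k : Y -> X,
    [/\ cancel h k, cancel k h, continuous h & continuous k].

(* [h] and [k] are total functions, but only their restrictions to [A] and [B]
   matter: these are mutually inverse homeomorphisms for the subspace
   topologies. *)
Definition homeomorphism_between (X Y : topologicalType) (A : set X)
    (B : set Y) (h : X -> Y) (k : Y -> X) : Prop :=
  [/\ h @` A = B, forall x, A x -> k (h x) = x,
      {within A, continuous h} & {within B, continuous k}].

(* The system [f] restricted to [A] is topologically conjugate to [g]
   restricted to [B]. *)
Definition conjugate_on (X Y : topologicalType) (f : X -> X) (A : set X)
    (g : Y -> Y) (B : set Y) : Prop :=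
  exists (h : X -> Y) (k : Y -> X), homeomorphism_between A B h k /\
    forall x, A x -> h (f x) = g (h x).

(* The two-sided orbit of [x] when [f] is bijective. *)
Definition full_orbit (X : Type) (f : X -> X) (x : X) : set X :=
  [set y | exists n, y = iter n f x \/ x = iter n f y].

Definition minimal_set (X : topologicalType) (f : X -> X) (M : set X) : Prop :=
  [/\ M !=set0, closed M, f @` M = M &
      forall N : set X, N !=set0 -> closed N -> f @` N = N ->
        N `<=` M -> N = M].

Definition frontier (X : topologicalType) (A : set X) : set X :=
  closure A `\` A°.

Definition closed_unit_ball (R : realType) (n : nat) : set 'rV[R]_n :=
  [set x | \sum_i x ord0 i ^+ 2 <= 1].

Definition topological_ball (R : realType) (X : topologicalType) (n : nat)
    (B : set X) : Prop :=
  exists (h : 'rV[R]_n -> X) (k : X -> 'rV[R]_n),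
    homeomorphism_between (@closed_unit_ball R n) B h k.

Definition integers (R : realType) : zmodClosed R :=
  GRing.ZmodClosed.clone R (@Num.int_num_subdef R) _.

Definition circle (R : realType) : Type :=
  quotient_topology (Quotient.quot (integers R)).

HB.instance Definition _ (R : realType) := Topological.on (circle R).
HB.instance Definition _ (R : realType) := Quotient.on (circle R).
HB.instance Definition _ (R : realType) :=
  GRing.Zmodule.copy (circle R) (Quotient.quot (integers R)).

Definition to_circle (R : realType) : R -> circle R := \pi_(circle R)%qT.

(* Haar probability measure of a subset of the circle: Lebesgue measure of the
   corresponding subset of the fundamental domain [0, 1[. *)
Definition haar (R : realType) (A : set (circle R)) : \bar R :=
  lebesgue_measure (`[0, 1[%classic `&` @to_circle R @^-1` A).

Definition lift_of (R : realType) (g : circle R -> circle R) (F : R -> R) :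
    Prop :=
  [/\ continuous F, {homo F : x y / x < y}, forall x, F (x + 1) = F x + 1 &
      forall x, to_circle (F x) = g (to_circle x)].

Definition orientation_preserving (R : realType) (g : circle R -> circle R) :
  Prop := exists F, lift_of g F.

Definition is_rotation_number (R : realType) (g : circle R -> circle R)
    (rho : circle R) : Prop :=
  exists (F : R -> R) (a : R),
    [/\ lift_of g F,
        forall x, (fun n => iter n F x / n%:R) @ \oo --> a &
        rho = to_circle a].

Definition denjoy_example (R : realType) (g : circle R -> circle R) : Prop :=
  [/\ homeomorphism g, orientation_preserving g,
      exists2 a : R, irrational a & is_rotation_number g (to_circle a) &
      ~ (forall x, dense (full_orbit g x))].

(* Conjugating by [x |-> - x] turns a Denjoy example with rotation number [rho]
   into one with rotation number [- rho], so that [D] satisfies this predicate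
   for [rho] iff it does for [- rho]. *)
Definition denjoy_minimal_set (R : realType) (X : topologicalType)
    (f : X -> X) (rho : circle R) (D : set X) : Prop :=
  [/\ compact D, f @` D = D &
      exists (g : circle R -> circle R) (M : set (circle R)),
        [/\ denjoy_example g, is_rotation_number g rho, minimal_set g M &
            conjugate_on f D g M]].

Definition Sigma2 : Type := {ptws int -> bool}.
HB.instance Definition _ := Pointed.on Sigma2.
HB.instance Definition _ := Topological.on Sigma2.

Definition shift (s : Sigma2) : Sigma2 := fun i => s (i + 1).

Definition borel_Sigma2 := g_sigma_algebraType (@open Sigma2).

Definition integrals (R : realType) (mu : probability borel_Sigma2 R) :
    {ptws set_type [set f : Sigma2 -> R | continuous f] -> R} :=
  fun f => Rintegral mu setT (set_val f).

(* Borel probability measures on [Sigma2] with the coarsest topology making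
   [mu |-> \int f dmu] continuous for all continuous [f]. *)
Definition weak_probability (R : realType) : Type :=
  initial_topology (@integrals R).
HB.instance Definition _ (R : realType) :=
  Topological.on (weak_probability R).
HB.instance Definition _ (R : realType) :=
  isPointed.Build (weak_probability R) (point : probability borel_Sigma2 R).

Definition invariant_measures (R : realType) : set (weak_probability R) :=
  [set mu : probability borel_Sigma2 R |
    forall X : set borel_Sigma2, measurable X -> mu (shift @^-1` X) = mu X].

Definition denjoy_sets (R : realType) (rho : circle R) : set (set Sigma2) :=
  [set D | denjoy_minimal_set shift rho D].

(* A Denjoy minimal set carries exactly one invariant probability measure,
   which is the one picked by [get]. *)
Definition unique_measure (R : realType) (D : set Sigma2) :
    weak_probability R :=
  get [set mu : probability borel_Sigma2 R |
    @invariant_measures R mu /\ mu D = 1%E].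

Definition denjoy_space (R : realType) (rho : circle R) : Type :=
  initial_topology
    (fun D : set_type (denjoy_sets rho) => unique_measure R (set_val D)).
HB.instance Definition _ (R : realType) (rho : circle R) :=
  Topological.on (denjoy_space rho).

Definition RO0 (R : realType) : set (set (circle R)) :=
  [set U | [/\ U !=set0, U != setT, regopen U & haar (frontier U) = 0%E]].

(* [x + r *~ i] is the [i]-th iterate (i in Z) at [x] of the rotation by [r]. *)
Definition coding_domain (R : realType) (U : set (circle R)) (r : circle R) :
    set (circle R) :=
  [set x | forall i : int, ~ frontier U (x + r *~ i)].

Definition coding (R : realType) (U : set (circle R)) (r : circle R)
    (x : circle R) : Sigma2 :=
  fun i => `[< U (x + r *~ i) >].

Definition Lambda (R : realType) (U : set (circle R)) (r : circle R) :
    set Sigma2 :=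
  closure (coding U r @` coding_domain U r).

Definition lambda (R : realType) (U : set (circle R)) (r : circle R)
    (X : set Sigma2) : \bar R :=
  haar (coding_domain U r `&` coding U r @^-1` X).

(* The subset lambda(RO0, r) of the space of invariant measures. *)
Definition lambda_RO0 (R : realType) (r : circle R) :
    set (weak_probability R) :=
  [set mu : probability borel_Sigma2 R | @invariant_measures R mu /\
    exists2 U, RO0 U &
      forall X : set borel_Sigma2, measurable X -> mu X = lambda U r X].

(* Main.v *)
(* A Denjoy minimal set D in the two-shift is the image of the minimal set of a
   Denjoy example, and Poincare's semiconjugacy gives a map theta from D onto the
   circle carrying the shift to the rotation by alpha and injective outside
   countably many points.  The closed sets theta {s in D | s 0 = b}, b = 0, 1,
   cover the circle and meet in a countable set, so the interior U of the one
   for b = 1 is regular open with countable frontier, and D = Lambda U alpha by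
   minimality.  An invariant measure on D projects to the Lebesgue measure, the
   only rotation-invariant one, hence equals lambda U alpha.

   Conversely, the coding of the rotation by a finite union of disjoint arcs
   starting at multiples k_i alpha is realized by a Denjoy example, obtained by
   blowing up the orbits of the endpoints of the arcs.  Taking short arcs one
   prescribes any finite window of the code of 0, whence density.  For balls, n
   of the lengths are varied: the invariant measure depends continuously on them
   by dominated convergence, and each length is recovered as the measure of a
   cylinder. *)
Require Import Defs.
From HB Require Import structures.
From mathcomp Require Import all_boot all_order all_algebra.
From mathcomp Require Import generic_quotient ring_quotient archimedean.
From mathcomp Require Import all_classical all_reals all_analysis.
From mathcomp Require Import measurable_realfun.
From mathcomp Require Import zify ring lra.
Set Implicit Arguments.
Unset Strict Implicit.
Unset Printing Implicit Defensive.
Import Order.TTheory GRing.Theory Num.Theory.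
Import numFieldTopology.Exports numFieldNormedType.Exports.
Local Open Scope classical_set_scope.
Local Open Scope ring_scope.

(** Three points shape the proof. The lengths of the arcs must fill a whole box, including lengths
    in Z alpha + Z, for which several endpoint orbits merge. The gaps are therefore created by a sum
    of jumps along an enumeration of the endpoints that may repeat, where coincidences simply add
    up. The code must separate the points of the blown-up minimal set. A discontinuity along each
    blown-up orbit separates the two ends of a gap, and one arc strictly longer than all the others
    rules out translational symmetries of the union of arcs. That an invariant measure projects to
    Lebesgue measure is shown through distribution functions: half-open intervals and invariance
    make the distribution function lift to a monotone map of degree one that is additive along
    alpha, and such a map is the identity because it is so on the dense group Z alpha + Z. The
    resulting formula is used twice, for an arbitrary Denjoy minimal set and for the explicit arcs,
    where it allows the measure to be computed from right-continuous codes alone. *)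

Lemma periodicMz {V : zmodType} {T : Type} (f : V -> T) (a : V) :
  (forall x, f (x + a) = f x) -> forall x (k : int), f (x + a *~ k) = f x.
Proof.
move=> fa x k; have fn y (n : nat) : f (y + a *+ n) = f y.
  by elim: n => [|n IH]; rewrite ?mulr0n ?addr0// mulrSr addrA fa.
case: k => n; first exact: fn.
by rewrite NegzE mulrNz -[in RHS](subrK (a *+ n.+1) x) fn.
Qed.

(** * The circle as a quotient of the line, with angles in [0, 1[ *)

Section Circle.
Context {R : realType}.
Implicit Types (x y : R) (n m : int).

Lemma to_circleE x y :
  to_circle x = to_circle y <-> exists k : int, x = y + k%:~R.
Proof.
split=> [/eqmodP|[k ->]].
  move=> /intrP[k xy]; exists k.
  by rewrite -xy addrC subrK.
by apply/eqmodP; apply/intrP; exists k; rewrite addrC addKr.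
Qed.

Lemma to_circleD x y : to_circle (x + y) = to_circle x + to_circle y.
Proof. exact: (raddfD \pi_(Quotient.quot (integers R))%qT). Qed.

Lemma to_circleDz x k : to_circle (x + k%:~R) = to_circle x.
Proof. by apply/to_circleE; exists k. Qed.

Lemma to_circleMz x k : to_circle (x *~ k) = to_circle x *~ k.
Proof. exact: (raddfMz \pi_(Quotient.quot (integers R))%qT). Qed.

Lemma to_circle_repr (c : circle R) : to_circle (repr c) = c.
Proof. exact: reprK. Qed.

Lemma to_circle_continuous : continuous (@to_circle R).
Proof. exact: pi_continuous. Qed.

Lemma open_circle (A : set (circle R)) : open A = open (@to_circle R @^-1` A).
Proof. by []. Qed.

Lemma closed_circle (A : set (circle R)) :
  closed A <-> closed (@to_circle R @^-1` A).
Proof. by rewrite -!openC open_circle preimage_setC. Qed.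

Definition frac x := x - (Num.floor x)%:~R.

Lemma frac_ge0 x : 0 <= frac x.
Proof. by rewrite subr_ge0 floor_le. Qed.

Lemma frac_lt1 x : frac x < 1.
Proof. by rewrite ltrBlDr addrC -intrD1 floorD1_gt. Qed.

Lemma frac_itv x : frac x \in `[0, 1[.
Proof. by rewrite in_itv/= frac_ge0 frac_lt1. Qed.

Lemma fracDz x k : frac (x + k%:~R) = frac x.
Proof. by rewrite /frac floorDrz ?intr_int// intrKfloor intrD; lra. Qed.

Lemma frac_id x : 0 <= x < 1 -> frac x = x.
Proof. by move=> x01; rewrite /frac (@floor_def _ _ 0) ?subr0. Qed.

Lemma to_circle_frac x : to_circle (frac x) = to_circle x.
Proof. by apply/to_circleE; exists (- Num.floor x); rewrite /frac intrN. Qed.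

Lemma fracE x y : to_circle x = to_circle y <-> frac x = frac y.
Proof.
split=> [/to_circleE[k ->]|xy]; first by rewrite fracDz.
by rewrite -(to_circle_frac x) xy to_circle_frac.
Qed.

Definition angle (c : circle R) : R := frac (repr c).

Lemma angle_to_circle x : angle (to_circle x) = frac x.
Proof. by apply/fracE; rewrite to_circle_repr. Qed.

Lemma to_circle_angle c : to_circle (angle c) = c.
Proof. by rewrite to_circle_frac to_circle_repr. Qed.

Lemma angle_ge0 c : 0 <= angle c.
Proof. exact: frac_ge0. Qed.

Lemma angle_lt1 c : angle c < 1.
Proof. exact: frac_lt1. Qed.

Lemma compact_circle : compact [set: circle R].
Proof.
have -> : [set: circle R] = @to_circle R @` `[0, 1]%classic.
  apply/seteqP; split=> // c _; exists (frac (repr c)).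
    by rewrite /= in_itv/= frac_ge0 ltW// frac_lt1.
  by rewrite to_circle_frac to_circle_repr.
apply: continuous_compact; last exact: segment_compact.
apply: continuous_subspaceT; exact: to_circle_continuous.
Qed.

(** [angle] jumps at the class of 0. With these bounds the arc avoids that class, and its preimage
    in the line is the union of the integer translates of one open interval. *)
Lemma open_arc (u v : R) : 0 <= u -> v <= 1 ->
  open [set c : circle R | u < angle c < v].
Proof.
move=> u0 v1; rewrite open_circle.
rewrite (_ : _ @^-1` _ = \bigcup_(k in [set: int]) `]k%:~R + u, k%:~R + v[%classic).
  by apply: bigcup_open => k _; exact: interval_open.
apply/seteqP; split=> x; rewrite /= ?angle_to_circle.
  by move=> h; exists (Num.floor x) => //=; rewrite in_itv/=; move: h; rewrite /frac; lra.
move=> [k _ /=]; rewrite in_itv/= /frac => /andP[h1 h2].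
rewrite (@floor_def _ x k); first by lra.
by rewrite intrD; lra.
Qed.

End Circle.

(** * Density of the integer combinations of an irrational and 1 *)

Section IrrationalRotation.
Context {R : realType} {alpha : R}.
Hypothesis alpha_irr : irrational alpha.
Implicit Types (x y : R) (n m : int).

Lemma irrational_comb n m : n%:~R * alpha + m%:~R = 0 -> n = 0 /\ m = 0.
Proof.
move=> nm0; have n0 : n = 0.
  apply/eqP/negPn/negP => n0; apply: alpha_irr.
  exists (- m%:~R / n%:~R) => //.
  rewrite fmorph_div/= rmorphN/= !ratr_int.
  have n0' : n%:~R != 0 :> R by rewrite intr_eq0.
  by apply: (mulfI n0'); rewrite mulrCA divff// mulr1; lra.
split=> //; move: nm0; rewrite n0 mul0r add0r => /eqP.
by rewrite intr_eq0 => /eqP.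
Qed.

Lemma alpha_ne_int m : alpha <> m%:~R.
Proof.
move=> am; have [] := @irrational_comb 1 (- m); last by [].
by rewrite mul1r intrN am subrr.
Qed.

(** A Euclidean step halves a combination g: with q the integer part of 1 / g, the remainders 1 - q
    g and (q + 1) g - 1 are again combinations and add up to g, so one of them is at most g / 2.
    Carrying [n != 0] along makes them positive, by irrationality. *)
Lemma small_comb (k : nat) : exists n m, n != 0 /\
  0 < n%:~R * alpha + m%:~R < 2 ^- k.
Proof.
have pos n m : n != 0 -> 0 <= n%:~R * alpha + m%:~R ->
    0 < n%:~R * alpha + m%:~R.
  rewrite le_eqVlt => n0 /predU1P[/esym/irrational_comb[] n00|//].
  by rewrite n00 in n0.
elim: k => [|k [n [m [n0 /andP[g0 gk]]]]].
  exists 1, (- Num.floor alpha); split=> //; apply/andP; split.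
    by apply: pos => //; rewrite mul1r intrN frac_ge0.
  by rewrite mul1r intrN expr0 invr1 frac_lt1.
set g := n%:~R * alpha + m%:~R in g0 gk.
pose q := Num.floor (1 / g).
have g1 : g < 1.
  by rewrite (lt_le_trans gk)// invf_le1 ?exprn_gt0// exprn_ege1// ler1n.
have q1 : 1 <= q by rewrite /q floor_ge_int lter_pdivlMr// mul1r ltW.
have := floor_itv (1 / g); rewrite -/q => /andP[].
rewrite lter_pdivlMr// lter_pdivrMr// intrD1 => qg qg1.
have H1 : - q * n != 0 by rewrite mulf_neq0// oppr_eq0; lia.
have H2 : (q + 1) * n != 0 by rewrite mulf_neq0//; lia.
have E1 : (- q * n)%:~R * alpha + (1 - q * m)%:~R = 1 - q%:~R * g.
  by rewrite /g intrB !intrM intrN; ring.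
have E2 : ((q + 1) * n)%:~R * alpha + ((q + 1) * m - 1)%:~R =
   (q%:~R + 1) * g - 1.
  by rewrite /g intrB !intrM intrD1; ring.
have ek : 2 ^- k.+1 = 2 ^- k / 2 :> R by rewrite exprS invfM mulrC.
have P1 := @pos (- q * n) (1 - q * m) H1; rewrite E1 in P1.
have P2 := @pos ((q + 1) * n) ((q + 1) * m - 1) H2; rewrite E2 in P2.
have [h|h] := leP (1 - q%:~R * g) (g / 2).
  exists (- q * n), (1 - q * m); split=> //; rewrite E1 ek.
  by rewrite P1/=; lra.
exists ((q + 1) * n), ((q + 1) * m - 1); split=> //; rewrite E2 ek.
by rewrite P2/=; lra.
Qed.

(** Once a positive combination g is smaller than y - x, its first multiple beyond x falls before
    y. *)
Lemma dense_comb x y : x < y -> exists n m, x < n%:~R * alpha + m%:~R < y.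
Proof.
move=> xy; have yx0 : 0 < y - x by rewrite subr_gt0.
have [k _ /(_ k (leqnn k))/=] := near_infty_natSinv_expn_lt (PosNum yx0).
rewrite mul1r => kyx.
have [n [m [_ /andP[g0 gk]]]] := small_comb k.
set g := _ + _ in g0 gk.
pose q := Num.floor (x / g).
have := floor_itv (x / g); rewrite -/q => /andP[].
rewrite ler_pdivlMr// ltr_pdivrMr// intrD1 => qg qg1.
exists ((q + 1) * n), ((q + 1) * m).
have -> : ((q + 1) * n)%:~R * alpha + ((q + 1) * m)%:~R = (q%:~R + 1) * g.
  by rewrite /g !intrM intrD1; ring.
by rewrite qg1/=; lra.
Qed.
End IrrationalRotation.

(** * Monotone maps and maps of degree one of the line *)

Section MonotoneMaps.
Context {R : realType}.
Implicit Types (f : R -> R) (x y : R).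

(** A monotone map can only be discontinuous by a jump, and a jump leaves a gap in the range. The
    maps defined below through the order ([poincare], [base], [lift]) get their continuity from
    this. *)
Lemma nondecreasing_dense_continuous f : {homo f : x y / x <= y} ->
  (forall a b, a < b -> exists y, a < f y < b) -> continuous f.
Proof.
move=> fmono fdense x; apply/cvgrPdist_lt => e e0.
have [|y1 /andP[y1l y1r]] := fdense (f x - e) (f x); first by lra.
have [|y2 /andP[y2l y2r]] := fdense (f x) (f x + e); first by lra.
have y1x : y1 < x by rewrite ltNge; apply/negP => /fmono; lra.
have xy2 : x < y2 by rewrite ltNge; apply/negP => /fmono; lra.
near=> z.
have /fmono h1 : y1 <= z by near: z; apply: lt_le_nbhsr.
have /fmono h2 : z <= y2 by near: z; apply: lt_le_nbhsl.
by rewrite ltr_distlC; apply/andP; split; lra.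
Unshelve. all: by end_near. Qed.

Lemma degree_one_int f (k : int) : (forall x, f (x + 1) = f x + 1) ->
  forall x, f (x + k%:~R) = f x + k%:~R.
Proof.
move=> f1; have fn (n : nat) x : f (x + n%:R) = f x + n%:R.
  by elim: n => [|n IH]; rewrite ?addr0// -natr1 !addrA f1 IH.
case: k => n x; first exact: fn.
by rewrite NegzE intrN -[LHS](addrK n.+1%:R) -fn subrK.
Qed.

Lemma degree_one_surjective f : continuous f ->
  (forall x, f (x + 1) = f x + 1) -> forall y, exists x, f x = y.
Proof.
move=> fc f1 y; have fz k := degree_one_int k f1.
have [] := @IVT R f (0 + (Num.floor (y - f 0))%:~R)
  (0 + (Num.floor (y - f 0) + 1)%:~R) y.
- by rewrite !add0r ler_int; lia.
- exact: continuous_subspaceT.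
- rewrite !fz; have /andP[] := floor_itv (y - f 0).
  set a := _%:~R; set b := _%:~R => h1 h2.
  by rewrite ge_min le_max; apply/andP; split; apply/orP; [left|right]; lra.
- by move=> x _ <-; exists x.
Qed.

Definition double_values f : set R :=
  [set v | exists y y', [/\ y < y', f y = v & f y' = v]].

(** A value attained at two points is attained on the whole interval between them, hence at a
    rational. *)
Lemma double_values_countable f : {homo f : x y / x <= y} ->
  countable (double_values f).
Proof.
move=> fmono; apply: (@sub_countable _ _ _ ((f \o ratr) @` [set: rat])); last first.
  by apply: (@sub_countable _ _ _ [set: rat]); first exact: card_image_le.
apply: subset_card_le => v [y [y' [yy' fy fy']]].
have [q] := rat_in_itvoo yy'; rewrite in_itv/= => /andP[yq qy'].
exists q => //=; apply/eqP; rewrite eq_le; apply/andP; split.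
- by rewrite -fy' fmono// ltW.
- by rewrite -fy fmono// ltW.
Qed.

End MonotoneMaps.

(** * Poincare's semiconjugacy to a translation *)

Section Poincare.
Context {R : realType} {G : R -> R} {alpha : R}.
Hypotheses (G_homo : {homo G : x y / x < y})
  (G1 : forall x, G (x + 1) = G x + 1)
  (G_rot : forall x, (fun n => iter n G x / n%:R) @ \oo --> alpha).
Implicit Types (x y : R) (n : nat).

Let iter_homo n x y : x < y -> iter n G x < iter n G y.
Proof. by move=> xy; elim: n => //= n; exact: G_homo. Qed.

Let iter_int n (k : int) x : iter n G (x + k%:~R) = iter n G x + k%:~R.
Proof. by elim: n => //= n ->; exact: degree_one_int. Qed.

(** The displacement of [iter n G] is 1-periodic, so x can be compared with the integer translate of
    y that lies ahead of it by at most 1. *)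
Lemma iter_displacement n x y : iter n G x - x < iter n G y - y + 1.
Proof.
have /andP[h1 h2] := floor_itv (x - y).
have : x < y + (Num.floor (x - y) + 1)%:~R by lra.
by move=> /(@iter_homo n); rewrite iter_int intrD; lra.
Qed.

(** If one point moved further, [iter_displacement] would force every point to move by at least some
    b larger than n alpha under [iter n G]; iterating this, the rotation number would exceed
    alpha. *)
Lemma iter_displacement_le n x : iter n G x - x <= n%:R * alpha + 1.
Proof.
case: n => [|n]; first by rewrite /= subrr mul0r add0r.
rewrite leNgt; apply/negP => h.
pose b := iter n.+1 G x - x - 1.
have bz z : iter n.+1 G z >= z + b.
  by have := iter_displacement n.+1 x z; rewrite /b; lra.
have bk k : k%:R * b <= iter (k * n.+1) G 0.
  elim: k => [|k IH]; first by rewrite mul0n mul0r.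
  by rewrite mulSn iterD; have := bz (iter (k * n.+1) G 0); rewrite -natr1; lra.
have n0 : 0 < n.+1%:R :> R by rewrite ltr0n.
have e0 : 0 < b / n.+1%:R - alpha.
  by rewrite subr_gt0 ltr_pdivlMr// mulrC /b; lra.
have /cvgrPdist_lt /(_ _ e0)[N _ hN] := G_rot 0.
(* A multiple of the block length [n.+1] beyond the threshold [N]. *)
have := hN (N.+1 * n.+1)%N (leq_trans (leqnSn N) (leq_pmulr _ (ltn0Sn n))).
apply/negP; rewrite -leNgt distrC (le_trans _ (ler_norm _))// lerB//.
rewrite ler_pdivlMr ?ltr0n// natrM.
by rewrite (_ : b / n.+1%:R * _ = N.+1%:R * b)//; field; lra.
Qed.

Lemma iter_displacement_ge n x : n%:R * alpha - 1 <= iter n G x - x.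
Proof.
case: n => [|n]; first by rewrite /= subrr mul0r add0r; lra.
rewrite leNgt; apply/negP => h.
pose b := iter n.+1 G x - x + 1.
have bz z : iter n.+1 G z <= z + b.
  by have := iter_displacement n.+1 z x; rewrite /b; lra.
have bk k : iter (k * n.+1) G 0 <= k%:R * b.
  elim: k => [|k IH]; first by rewrite mul0n mul0r.
  by rewrite mulSn iterD; have := bz (iter (k * n.+1) G 0); rewrite -natr1; lra.
have n0 : 0 < n.+1%:R :> R by rewrite ltr0n.
have e0 : 0 < alpha - b / n.+1%:R.
  by rewrite subr_gt0 ltr_pdivrMr// mulrC /b; lra.
have /cvgrPdist_lt /(_ _ e0)[N _ hN] := G_rot 0.
have := hN (N.+1 * n.+1)%N (leq_trans (leqnSn N) (leq_pmulr _ (ltn0Sn n))).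
apply/negP; rewrite -leNgt (le_trans _ (ler_norm _))// lerB//.
rewrite ler_pdivrMr ?ltr0n// natrM.
by rewrite (_ : b / n.+1%:R * _ = N.+1%:R * b)//; field; lra.
Qed.

Let upper y : set R :=
  [set c | \forall n \near \oo, iter n G y - n%:R * alpha <= c].

(** This is the limit superior of [iter n G y - n%:R * alpha], finite by the two displacement
    bounds. The sequence oscillates in general, but monotonicity, degree one and the conjugation
    identity all pass to eventual upper bounds. *)
Definition poincare y : R := inf (upper y).

Let has_inf_upper y : has_inf (upper y).
Proof.
split.
  exists (y + 1); apply: nearW => n.
  by have := iter_displacement_le n y; lra.
exists (y - 1) => c [n _ /(_ n (leqnn n))/=].
by have := iter_displacement_ge n y; lra.
Qed.

Lemma poincare_homo : {homo poincare : x y / x <= y}.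
Proof.
move=> x y; rewrite le_eqVlt => /predU1P[->//|xy].
apply: lb_le_inf; first by case: (has_inf_upper y).
move=> c cy; apply: ge_inf; first by case: (has_inf_upper x).
apply: filterS cy => n; apply: le_trans.
by rewrite lerD2r ltW// iter_homo.
Qed.

Let poincare_shift x y t : (forall c, upper x c <-> upper y (c + t)) ->
  poincare y = poincare x + t.
Proof.
move=> xy; apply/eqP; rewrite eq_le; apply/andP; split.
  rewrite -lerBlDr; apply: lb_le_inf; first by case: (has_inf_upper x).
  move=> c /xy cy; rewrite lerBlDr; apply: ge_inf => //.
  by case: (has_inf_upper y).
apply: lb_le_inf; first by case: (has_inf_upper y).
move=> c; rewrite -(subrK t c) => /xy cy; rewrite lerD2r; apply: ge_inf => //.
by case: (has_inf_upper x).
Qed.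

Lemma poincareD1 x : poincare (x + 1) = poincare x + 1.
Proof.
apply: poincare_shift => c.
by split; apply: filterS => n; rewrite (iter_int n 1); lra.
Qed.

(** The sequence attached to [G x] is that of x moved by one index and raised by alpha, and eventual
    bounds do not see the change of index. *)
Lemma poincare_conj x : poincare (G x) = poincare x + alpha.
Proof.
apply: poincare_shift => c; split=> -[N _ h].
  exists N => // n /= Nn; have := h n.+1 (leq_trans Nn (leqnSn n)).
  by rewrite /= -iterSr /= -natr1; lra.
exists N.+1 => // -[//|n] /= Nn; have := h n Nn.
by rewrite /= -iterSr /= -natr1; lra.
Qed.

Hypotheses (alpha_irr : irrational alpha) (G_cont : continuous G).

(** The range contains the translate of the dense group Z alpha + Z by [poincare 0], so it has no
    gap. Negative multiples of alpha come from preimages under iterates of [G], which exist because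
    a continuous map of degree one is onto. *)
Lemma poincare_continuous : continuous poincare.
Proof.
apply: nondecreasing_dense_continuous; first exact: poincare_homo.
move=> a b ab.
have [|n [m /andP[h1 h2]]] := dense_comb alpha_irr (_ : a - poincare 0 < b - poincare 0).
  by lra.
suff [y Py] : exists y, poincare y = poincare 0 + n%:~R * alpha.
  exists (y + m%:~R); rewrite (degree_one_int _ poincareD1) Py; lra.
have pn (k : nat) z : poincare (iter k G z) = poincare z + k%:R * alpha.
  elim: k => [|k IH]; first by rewrite mul0r addr0.
  by rewrite iterS poincare_conj IH -natr1; lra.
case: n {h1 h2} => n; first by exists (iter n G 0); rewrite pn.
have Gn (k : nat) z : exists y, iter k G y = z.
  elim: k z => [|k IH] z; first by exists z.
  have [y yz] := degree_one_surjective G_cont G1 z.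
  by have [y' y'y] := IH y; exists y'; rewrite /= y'y.
have [y yz] := Gn n.+1 0; exists y.
by rewrite NegzE intrN -{1}yz pn; ring.
Qed.

End Poincare.

Local Notation shift := Defs.shift.

(** * Topology and Borel sets of the two-shift *)

Section ShiftSpace.
Implicit Types (s t : Sigma2).

(** Coordinates are enumerated by [pickle], so a word fixes finitely many of them and the cylinders
    form a family indexed by a countable type. Entries of [w] at numbers that encode no integer are
    never read. *)
Definition cylinder (w : seq bool) : set Sigma2 :=
  [set s | forall i : int, (pickle i < size w)%N -> s i = nth false w (pickle i)].

Definition prefix_of s (n : nat) : seq bool :=
  mkseq (fun k => if unpickle k is Some i then s i else false) n.

Lemma cylinder_prefix s n : cylinder (prefix_of s n) =
  [set t | forall i : int, (pickle i < n)%N -> t i = s i].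
Proof.
apply/seteqP; split=> t ts i; rewrite ?size_mkseq => ni.
  by rewrite ts ?size_mkseq// nth_mkseq// pickleK.
by rewrite ts// nth_mkseq// pickleK.
Qed.

Lemma cvg_Sigma2 {T : Type} (F : set_system T) (f : T -> Sigma2) s :
  Filter F -> (forall i, \forall x \near F, f x i = s i) -> f x @[x --> F] --> s.
Proof.
move=> FF Fi; apply/cvg_sup => i U [_ [[V oV <-] /= Vs] VU].
by apply: filterS (Fi i) => x fx; apply: VU; rewrite /preimage /proj/= fx.
Qed.

(** The filter generated by agreement with [s] on longer and longer prefixes converges to [s], since
    each coordinate is eventually constant along it; hence it contains every neighbourhood of
    [s]. *)
Lemma nbhs_Sigma2 s (A : set Sigma2) : nbhs s A ->
  exists n, forall t, (forall i : int, (pickle i < n)%N -> t i = s i) -> A t.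
Proof.
pose B n := [set t : Sigma2 | forall i : int, (pickle i < n)%N -> t i = s i].
pose F := filter_from setT B.
have FF : Filter F.
  apply: filter_from_filter; first by exists 0%N.
  move=> n m _ _; exists (maxn n m) => // t ts; split=> i h; apply: ts.
    exact: leq_trans h (leq_maxl _ _).
  exact: leq_trans h (leq_maxr _ _).
have Fs : t @[t --> F] --> s.
  by apply: cvg_Sigma2 => i; exists (pickle i).+1 => // t; exact.
by move=> /Fs[n _ nA]; exists n => t ts; exact: nA.
Qed.

Lemma open_coord (i : int) (b : bool) : open [set s : Sigma2 | s i = b].
Proof.
have /continuousP pc : continuous (fun s : Sigma2 => s i).
  exact: (@proj_continuous int (fun=> bool) i).
by apply: (pc [set b]); exact: discrete_open.
Qed.

Lemma closed_coord (i : int) (b : bool) : closed [set s : Sigma2 | s i = b].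
Proof.
rewrite -openC (_ : ~` _ = [set s : Sigma2 | s i = ~~ b]); first exact: open_coord.
by apply/seteqP; split=> s /=; case: (s i); case: b.
Qed.

Lemma near_coord s (i : int) : \forall t \near s, t i = s i.
Proof. exact: (open_nbhs_nbhs (conj (open_coord i (s i)) erefl)). Qed.

Lemma shift_continuous : continuous shift.
Proof. move=> s; apply: cvg_Sigma2 => i; exact: near_coord. Qed.

Definition unshift s : Sigma2 := fun i => s (i - 1).

Lemma shiftK : cancel shift unshift.
Proof. by move=> s; apply/funext => i; rewrite /unshift /shift subrK. Qed.

Lemma unshiftK : cancel unshift shift.
Proof. by move=> s; apply/funext => i; rewrite /unshift /shift addrK. Qed.

Lemma unshift_continuous : continuous unshift.
Proof. move=> s; apply: cvg_Sigma2 => i; exact: near_coord. Qed.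

Lemma hausdorff_Sigma2 : hausdorff_space Sigma2.
Proof. by apply: hausdorff_product => i; exact: discrete_hausdorff. Qed.

Lemma compact_Sigma2 : compact [set: Sigma2].
Proof.
have := @tychonoff int (fun=> bool) (fun=> setT) (fun=> bool_compact).
by rewrite (_ : [set f : forall i, bool | _] = setT)//; apply/seteqP; split.
Qed.

Lemma measurable_open_Sigma2 (A : set Sigma2) : open A ->
  measurable (A : set borel_Sigma2).
Proof. by move=> oA; exact: sub_sigma_algebra. Qed.

Lemma measurable_closed_Sigma2 (A : set Sigma2) : closed A ->
  measurable (A : set borel_Sigma2).
Proof.
by move=> cA; rewrite -(setCK A); apply: measurableC;
  apply: measurable_open_Sigma2; rewrite openC.
Qed.

(** An open set is a union of cylinders, a countable one because words are countable, and a cylinder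
    is a countable intersection of conditions on single coordinates. *)
Lemma measurable_fun_Sigma2 d (T : measurableType d) (f : T -> borel_Sigma2) :
  (forall i : int, measurable [set x | (f x : Sigma2) i]) ->
  measurable_fun setT f.
Proof.
move=> mf; apply: (@measurability _ _ T (g_sigma_algebraType (@open Sigma2))
  setT f (@open Sigma2)) => // _ [A oA <-].
rewrite setTI.
have -> : f @^-1` A =
    \bigcup_(w in [set w | cylinder w `<=` A]) (f @^-1` cylinder w).
  apply/seteqP; split=> [x Ax|x [w /= wA fx]]; last exact: wA.
  have [n nA] := nbhs_Sigma2 (open_nbhs_nbhs (conj oA Ax)).
  exists (prefix_of (f x) n); first by rewrite /= cylinder_prefix => t; exact: nA.
  by rewrite /preimage /= cylinder_prefix.
rewrite bigcup_mkcond; apply: countable_bigcupT_measurable => // w.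
case: ifP => // _.
rewrite (_ : _ @^-1` _ = \bigcap_(i in setT) [set x | (pickle i < size w)%N ->
   (f x : Sigma2) i = nth false w (pickle i)]); last first.
  by apply/seteqP; split=> [x fx i _|x fx i]; [exact: fx|exact: (fx i Logic.I)].
rewrite -[X in measurable X]setCK setC_bigcap; apply: measurableC.
apply: countable_bigcupT_measurable => // i; apply: measurableC.
have [iw|iw] := boolP (pickle i < size w)%N; last first.
  rewrite (_ : [set x | _] = setT)//; apply/seteqP; split=> // x _ /=; by [].
case: (nth false w _).
  rewrite (_ : [set x | _] = [set x | (f x : Sigma2) i])//.
  by apply/seteqP; split=> x /=; [exact|].
rewrite (_ : [set x | _] = ~` [set x | (f x : Sigma2) i]); last first.
  apply/seteqP; split=> x /=; first by move=> /(_ erefl) ->.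
  by move=> /negP/negbTE.
exact: measurableC.
Qed.

End ShiftSpace.

(** * Invariance of Lebesgue measure under rotations of the circle *)

Section LebesgueCircle.
Context {R : realType}.
Local Notation leb := (@lebesgue_measure R).
Implicit Types (A : set R) (t : R).

Lemma lebesgue_measure_translation A t : measurable A ->
  leb ((fun x => x + t) @^-1` A) = leb A.
Proof.
move=> mA.
have mt : measurable_fun setT ((fun x => x + t) : R -> measurableTypeR R).
  by apply: measurable_realfun.measurable_funD => //; exact: measurable_cst.
apply/esym.
apply: (lebesgue_measure_unique
  (mu := measure_function_pushforward__canonical__measure_function_Measure
    leb mt)) => // _ [[a b]] _ <-.
rewrite /= /pushforward.
rewrite [RHS](_ : _ = leb `]a - t, b - t]%classic); last first.
  by congr leb; apply/seteqP; split=> x /=; rewrite !in_itv/= ltrBlDr lerBrDr.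
rewrite !lebesgue_measure_itv/= !lte_fin ltrD2r.
by case: ifP => // _; rewrite -!EFinD; congr EFin; lra.
Qed.

(** Periodicity reduces [t] to its fractional part. The translated window [t, 1 + t[ is then cut at
    1 and its outer piece is moved back by 1. *)
Lemma lebesgue_measure_circle_translation A t : measurable A ->
  (forall x, A (x + 1) <-> A x) ->
  leb (`[0, 1[ `&` (fun x => x + t) @^-1` A) = leb (`[0, 1[ `&` A).
Proof.
move=> mA A1.
have Az x (k : int) : A (x + k%:~R) = A x.
  by apply: periodicMz => y; exact/propext/A1.
have -> : (fun x => x + t) @^-1` A = (fun x => x + frac t) @^-1` A.
  apply/seteqP; split=> x /=; rewrite -(Az (x + frac t) (Num.floor t));
    by rewrite /frac -addrA subrK.
have : frac t \in `[0, 1[ by exact: frac_itv.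
move: (frac t) => {}t; rewrite in_itv/= => /andP[t0 t1].
have -> : `[0, 1[%classic `&` (fun x => x + t) @^-1` A =
    (fun x => x + t) @^-1` (`[t, 1 + t[%classic `&` A).
  by apply/seteqP; split=> x /=; rewrite !in_itv/= lerDr ltrD2r.
rewrite lebesgue_measure_translation; last exact: measurableI.
have -> : `[t, 1 + t[%classic `&` A = (`[t, 1[%classic `&` A) `|`
    (`[1, 1 + t[%classic `&` A).
  rewrite -setIUl; congr (_ `&` _); apply/seteqP; split=> x /=; rewrite !in_itv/=.
    move=> /andP[tx xt]; case: (ltP x 1) => x1; [left|right]; exact/andP.
  move=> [] /andP[]; lra.
rewrite measureU; [|exact: measurableI|exact: measurableI|]; last first.
  by apply/seteqP; split=> x //= []; rewrite !in_itv/=; lra.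
transitivity (leb (`[t, 1%R[%classic `&` A) + leb (`[0%R, t[%classic `&` A))%E.
  congr (_ + _)%E; rewrite -[LHS](lebesgue_measure_translation 1);
    last exact: measurableI.
  congr leb; apply/seteqP; split=> x /=; rewrite !in_itv/= A1 => -[h ?];
    by split=> //; lra.
rewrite -[LHS]measureU; [|exact: measurableI|exact: measurableI|]; last first.
  by apply/seteqP; split=> x //= []; rewrite !in_itv/=; lra.
rewrite -setIUl; congr (leb (_ `&` _)).
apply/seteqP; split=> x /=; rewrite !in_itv/=; first by move=> []; lra.
move=> /andP[x0 x1]; case: (ltP x t) => xt; [right|left]; exact/andP.
Qed.

End LebesgueCircle.

Lemma measure_eq_mod_null d (T : measurableType d) (R : realType)
  (m : {measure set T -> \bar R}) (A B N : set T) :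
  measurable A -> measurable B -> measurable N -> m N = 0%E ->
  (forall x, ~ N x -> A x <-> B x) -> m A = m B.
Proof.
move=> mA mB mN N0 AB.
have sub (A' B' : set T) : measurable A' -> measurable B' ->
    (forall x, ~ N x -> A' x -> B' x) -> (m A' <= m B')%E.
  move=> mA' mB' AB'; rewrite -(measureU0 mB' mN)// le_measure ?inE//.
    exact: measurableU.
  by move=> x A'x; have [Nx|Nx] := pselect (N x); [right|left; exact: AB'].
by apply/eqP; rewrite eq_le !sub// => x Nx /(AB x Nx).
Qed.

(** * Unique ergodicity over an irrational rotation *)

Section AdditiveMonotone.
Context {R : realType} {alpha : R} {F : R -> R}.
Hypotheses (alpha_irr : irrational alpha)
  (F_homo : {homo F : x y / x <= y}) (F1 : forall x, F (x + 1) = F x + 1)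
  (Falpha : forall x, F (x + alpha) = F x + F alpha) (F0 : F 0 = 0).

(** [F] stays within 1 of the identity, while n steps along alpha accumulate the error n |F alpha -
    alpha|; so F alpha = alpha. Then [F] fixes the dense group Z alpha + Z, and monotonicity
    squeezes it everywhere else. *)
Lemma additive_monotone_id x : F x = x.
Proof.
have Fz (k : int) : F k%:~R = k%:~R.
  by rewrite -[k%:~R]add0r degree_one_int// F0.
have Fn z (n : int) : F (z + n%:~R * alpha) = F z + n%:~R * F alpha.
  have FN y (m : nat) : F (y + m%:R * alpha) = F y + m%:R * F alpha.
    elim: m => [|m IH]; first by rewrite !mul0r !addr0.
    by rewrite -natr1 mulrDl mul1r addrA Falpha IH mulrDl mul1r addrA.
  case: n => m; first exact: FN.
  rewrite NegzE intrN mulNr.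
  have := FN (z - m.+1%:R * alpha) m.+1; rewrite subrK => ->.
  by rewrite mulNr addrK.
have F01 y : `|F y - y| <= 1.
  have /andP[] := floor_itv y; rewrite intrD1 => h1 h2.
  have := F_homo h1; have := F_homo (ltW h2); rewrite F1 !Fz => h3 h4.
  by rewrite ler_distl; apply/andP; split; lra.
have Fa : F alpha = alpha.
  apply/eqP; rewrite -subr_eq0 -normr_le0 leNgt; apply/negP => d0.
  have dn (n : nat) : n%:R * `|F alpha - alpha| <= 1.
    rewrite -(normr_nat R n) -normrM mulrBr.
    by have := Fn 0 n%:Z; rewrite !add0r F0 add0r => <-.
  have := dn (Num.bound (1 / `|F alpha - alpha|)).
  apply/negP; rewrite -ltNge -ltr_pdivrMr//.
  by apply: archi_boundP; rewrite divr_ge0.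
have Fc (n m : int) : F (n%:~R * alpha + m%:~R) = n%:~R * alpha + m%:~R.
  by rewrite degree_one_int// -[n%:~R * alpha]add0r Fn F0 Fa.
apply/eqP; rewrite eq_le; apply/andP; split; rewrite leNgt; apply/negP => h.
  have [n [m /andP[h1 h2]]] := dense_comb alpha_irr h.
  by have := F_homo (ltW h1); rewrite Fc; lra.
have [n [m /andP[h1 h2]]] := dense_comb alpha_irr h.
by have := F_homo (ltW h2); rewrite Fc; lra.
Qed.

End AdditiveMonotone.

Section UniqueErgodicity.
Context {R : realType} {alpha : R}.
Hypothesis alpha_irr : irrational alpha.
Context {D : set Sigma2} {theta : Sigma2 -> circle R}.
Hypotheses (D_closed : closed D) (D_shift : shift @` D = D)
  (theta_cont : {within D, continuous theta})
  (theta_shift : forall s, D s -> theta (shift s) = theta s + to_circle alpha).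
Context {mu : probability borel_Sigma2 R}.
Hypotheses (mu_inv : @invariant_measures R mu) (mu_D : mu D = 1%E).
Local Notation leb := (@lebesgue_measure R).

Let q (s : borel_Sigma2) : R := angle (theta s).

Let mD : measurable (D : set borel_Sigma2).
Proof. exact: measurable_closed_Sigma2. Qed.

Let measurable_theta (O : set (circle R)) : open O ->
  measurable (D `&` theta @^-1` O : set borel_Sigma2).
Proof.
move=> oO; have : open (theta @^-1` O : set (subspace D)).
  by move/continuousP : theta_cont; apply.
move=> /open_subspaceP[V oV VD].
rewrite (_ : _ `&` _ = V `&` D); last by rewrite VD setIC.
by apply: measurableI => //; exact: measurable_open_Sigma2.
Qed.

Let arc (t : R) : set (circle R) := [set c | 0 < angle c < t].

Let measurable_q t : measurable (D `&` [set s | q s < t] : set borel_Sigma2).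
Proof.
have [t0|t0] := leP t 0.
  rewrite (_ : _ `&` _ = set0)//; apply/seteqP; split=> // s [_ /= qt].
  by have := frac_ge0 (repr (theta s)); rewrite -/(angle _) -/(q s); lra.
have [t1|t1] := leP t 1; last first.
  rewrite (_ : _ `&` _ = D)//; apply/seteqP; split=> [s []//|s Ds]; split=> //=.
  by have := frac_lt1 (repr (theta s)); rewrite -/(angle _) -/(q s); lra.
(* [angle] is discontinuous at the class of 0, so the fibre over that class is treated apart, as the
   complement of the preimage of the arc ]0, 1[. *)
rewrite (_ : _ `&` _ = (D `&` theta @^-1` arc t) `|`
    (D `\` (D `&` theta @^-1` arc 1))); last first.
  apply/seteqP; split=> s.
    move=> [Ds /= qt]; have := frac_ge0 (repr (theta s)).
    rewrite -/(angle _) -/(q s) le_eqVlt => /predU1P[q0|q0].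
      by right; split=> // -[_]; rewrite /arc/= -/(q s) -q0 ltxx.
    by left; split=> //; rewrite /arc/= -/(q s) q0.
  move=> [[Ds /andP[_ h]]//|[Ds h]]; split=> //=.
  have := frac_ge0 (repr (theta s)).
  rewrite -/(angle _) -/(q s) le_eqVlt => /predU1P[<-//|q0].
  by exfalso; apply: h; split=> //; rewrite /arc/= -/(q s) q0/= frac_lt1.
apply: measurableU; first exact: measurable_theta (open_arc (lexx 0) t1).
by apply: measurableD => //; exact: measurable_theta (open_arc (lexx 0) (lexx 1)).
Qed.

Let mq : measurable_fun (D : set borel_Sigma2) q.
Proof.
apply: (measurability _ (measurable_realfun.RGenInftyO.measurableE R)) => //.
move=> _ [_ [x ->] <-].
rewrite (_ : q @^-1` _ = [set s | q s < x]); first exact: measurable_q.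
by apply/seteqP; split=> s /=; rewrite in_itv.
Qed.

Let q_itv s : 0 <= q s < 1.
Proof. by rewrite frac_ge0 frac_lt1. Qed.

Let q_shift s : D s -> q (shift s) = frac (q s + alpha).
Proof.
move=> Ds; rewrite /q theta_shift// -{1}(to_circle_angle (theta s)) -to_circleD.
exact: angle_to_circle.
Qed.

Let D_preshift : shift @^-1` D = D.
Proof.
apply/seteqP; split=> s.
  by rewrite /preimage -{1}D_shift => -[t Dt /(can_inj shiftK) <-].
by rewrite -[X in _ -> X]/(D (shift s)) -{2}D_shift; exists s.
Qed.

Let E (B : set R) : set borel_Sigma2 := D `&` q @^-1` B.

Let mE B : measurable B -> measurable (E B).
Proof. by move=> mB; exact: mq. Qed.

Let eq_E B B' : (forall z, 0 <= z < 1 -> B z <-> B' z) -> E B = E B'.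
Proof.
move=> BB'; apply/seteqP; split=> s [Ds Bs]; split=> //.
  exact/(BB' _ (q_itv s)).
exact/(BB' _ (q_itv s)).
Qed.

Let mu_E_shift B : measurable B ->
  mu (E B) = mu (E [set x | B (frac (x + alpha))]).
Proof.
move=> mB; rewrite -mu_inv; last exact: mE.
congr (mu _); rewrite /E preimage_setI D_preshift.
apply/seteqP; split=> s [Ds] /=; first by rewrite q_shift.
by move=> h; split=> //=; rewrite q_shift.
Qed.

Let phi (t : R) : R := fine (mu (E `]-oo, t[%classic)).

Let phiE t : mu (E `]-oo, t[%classic) = (phi t)%:E.
Proof. by rewrite fineK// fin_num_measure//; exact: mE. Qed.

Let phi0 t : t <= 0 -> phi t = 0.
Proof.
move=> t0; rewrite /phi (_ : E _ = set0) ?measure0//.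
apply/seteqP; split=> // s [_] /=; rewrite in_itv/=.
by have /andP[] := q_itv s; lra.
Qed.

Let phi1 t : 1 <= t -> phi t = 1.
Proof.
move=> t1; rewrite /phi (_ : E _ = D) ?mu_D//.
apply/seteqP; split=> [s []//|s Ds]; split=> //=; rewrite in_itv/=.
by have /andP[] := q_itv s; lra.
Qed.

Let phi_homo : {homo phi : s t / s <= t}.
Proof.
move=> s t st; rewrite -lee_fin -!phiE le_measure// ?inE.
- exact: mE.
- exact: mE.
- by move=> x [Dx] /=; rewrite in_itv/= => h; split=> //=; rewrite in_itv/=; lra.
Qed.

Let phi_itv s t : s <= t -> mu (E `[s, t[%classic) = (phi t - phi s)%:E.
Proof.
move=> st; rewrite EFinB -!phiE.
rewrite (_ : E `[s, t[%classic = E `]-oo, t[%classic `\` E `]-oo, s[%classic); last first.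
  apply/seteqP; split=> x.
    move=> [Dx] /=; rewrite in_itv/= => h; split.
      by split=> //=; rewrite in_itv/=; lra.
    by move=> [_] /=; rewrite in_itv/=; lra.
  move=> [[Dx] /=]; rewrite in_itv/= => h h'; split=> //=; rewrite in_itv/= h andbT.
  by rewrite leNgt; apply/negP => xs; apply: h'; split=> //=; rewrite in_itv.
rewrite measureD; [|exact: mE|exact: mE|by rewrite ltey_eq fin_num_measure//; exact: mE].
congr (mu _ - mu _)%E; apply/seteqP; split=> [x []//|x Ex]; split=> //.
by move: Ex => [Dx] /=; rewrite in_itv/= => h; split=> //=; rewrite in_itv/=; lra.
Qed.

(** Invariance is applied to the rotate of [0, s[ by [a]. If it wraps around, it is the complement
    of [s + a - 1, a[, whence the second case. Working with half-open intervals makes the identity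
    exact without knowing that [phi] is continuous. *)
Let phi_add s : 0 <= s < 1 ->
  let a := frac alpha in
  phi s + phi a = if s + a < 1 then phi (s + a) else 1 + phi (s + a - 1).
Proof.
move=> /andP[s0 s1] a; have a0 : 0 <= a := frac_ge0 alpha.
have a1 : a < 1 := frac_lt1 alpha.
have fa x : 0 <= x < 1 -> frac (x + alpha) = if x + a < 1 then x + a else x + a - 1.
  move=> x01; have -> : x + alpha = x + a + (Num.floor alpha)%:~R.
    by rewrite /a /frac -addrA subrK.
  rewrite fracDz; case: ifP => xa; first by rewrite frac_id//; lra.
  by rewrite -[LHS](fracDz _ (-1)) intrN frac_id//; lra.
case: ifPn => sa.
  have := @mu_E_shift `[a, s + a[%classic; rewrite phi_itv; last by lra.
  rewrite (_ : E [set x | _] = E `[0, s[%classic); last first.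
    by apply: eq_E => z z01 /=; rewrite !in_itv/= fa//; case: ifPn => h3; split; lra.
  rewrite phi_itv// (@phi0 0)// => /(_ ltac:(by [])) [] h; lra.
have := @mu_E_shift (~` `[s + a - 1, a[%classic).
rewrite (_ : E [set x | (~` `[s + a - 1, a[%classic) (frac (x + alpha))] =
  E `[0, s[%classic); last first.
  apply: eq_E => z z01 /=; rewrite !in_itv/= fa//; case: ifPn => h3; split=> h.
  - rewrite ltNge; have /andP[-> _] := z01; apply/negP => sz; apply: h.
    by move: z01; lra.
  - by move=> /andP[]; move: h; lra.
  - rewrite ltNge; have /andP[-> _] := z01; apply/negP => sz; apply: h.
    by move: z01; lra.
  - by move=> /andP[]; move: h; lra.
rewrite phi_itv// (@phi0 0)// subr0.
rewrite (_ : E (~` _) = D `\` E `[s + a - 1, a[%classic); last first.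
  apply/seteqP; split=> x [Dx] h; split=> //; first by move=> -[_] /h.
  by move=> qx; apply: h.
rewrite measureD; [|exact: mD|exact: mE|by rewrite ltey_eq fin_num_measure].
rewrite setIidr; last by move=> x [].
have sa1 : s + a - 1 <= a by lra.
have mN : measurable (~` `[s + a - 1, a[%classic) by exact: measurableC.
move=> /(_ mN) h.
have : (1 - (phi a - phi (s + a - 1))%:E = (phi s)%:E)%E.
  by rewrite -h -mu_D -(phi_itv sa1).
by rewrite -EFinB => -[] {}h; lra.
Qed.

Let mu_E_initial t : mu (E `]-oo, t[%classic) =
  leb (`[0, 1[%classic `&` `]-oo, t[%classic).
Proof.
(* The lift of the distribution function [phi] to a monotone map of degree one; [phi_add] says
   precisely that it is additive along alpha, so it is the identity. *)
pose F x := (Num.floor x)%:~R + phi (frac x).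
have Fid x : F x = x.
  apply: (additive_monotone_id alpha_irr).
  - move=> {}x y xy; rewrite /F.
    have [fxy|fxy] := eqVneq (Num.floor x) (Num.floor y).
      by rewrite fxy lerD2l phi_homo// /frac fxy lerB.
    have h : (Num.floor x)%:~R + 1 <= (Num.floor y)%:~R :> R.
      by rewrite -intrD1 ler_int; have := le_floor xy; lia.
    have h1 : phi (frac x) <= 1.
      by rewrite -(@phi1 1)// phi_homo// ltW// frac_lt1.
    have h2 : 0 <= phi (frac y) by rewrite -(@phi0 0)// phi_homo// frac_ge0.
    by lra.
  - move=> y; rewrite /F (fracDz y 1) floorDrz ?int_num1// floor1 intrD; lra.
  - move=> y; rewrite /F.
    have fy : 0 <= frac y < 1 by rewrite frac_ge0 frac_lt1.
    have := phi_add fy => /=; case: ifPn => h.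
      have -> : frac (y + alpha) = frac y + frac alpha.
        rewrite -[LHS](fracDz _ (- Num.floor y - Num.floor alpha)) -[RHS]frac_id//.
          by congr frac; rewrite /frac intrB intrN; ring.
        by rewrite h andbT addr_ge0 ?frac_ge0.
      have -> : Num.floor (y + alpha) = Num.floor y + Num.floor alpha.
        apply: floor_def; move: h (frac_ge0 y) (frac_ge0 alpha).
        by rewrite /frac !intrD; lra.
      by rewrite intrD; lra.
    have -> : frac (y + alpha) = frac y + frac alpha - 1.
      rewrite -[LHS](fracDz _ (- Num.floor y - Num.floor alpha - 1)) -[RHS]frac_id//.
        by congr frac; rewrite /frac !intrB intrN; ring.
      by move: h (frac_lt1 y) (frac_lt1 alpha); lra.
    have -> : Num.floor (y + alpha) = Num.floor y + Num.floor alpha + 1.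
      apply: floor_def; move: h (frac_lt1 y) (frac_lt1 alpha).
      by rewrite /frac !intrD; lra.
    by rewrite !intrD; lra.
  - by rewrite /F floor0 add0r phi0// frac_id// lexx ltr01.
have [t0|t0] := leP t 0.
  rewrite phiE phi0// (_ : _ `&` _ = set0) ?measure0//.
  by apply/seteqP; split=> // x [] /=; rewrite !in_itv/=; lra.
have [t1|t1] := leP 1 t.
  rewrite phiE phi1// (_ : _ `&` _ = `[0, 1[%classic).
    by rewrite lebesgue_measure_itv/= lte_fin ltr01 -EFinB subr0.
  by apply/seteqP; split=> [x []//|x] /=; rewrite !in_itv/=; lra.
rewrite phiE (_ : _ `&` _ = `[0, t[%classic).
  rewrite lebesgue_measure_itv/= lte_fin t0 -EFinB subr0.
  by have := Fid t; rewrite /F (@floor_def _ t 0) ?frac_id ?add0r => [-> //||]; lra.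
by apply/seteqP; split=> x /=; rewrite !in_itv/=; lra.
Qed.

Lemma invariant_measure_angle (B : set R) : measurable B ->
  mu (D `&` (fun s => angle (theta s)) @^-1` B : set borel_Sigma2) =
  leb (`[0, 1[%classic `&` B).
Proof.
(* The value -1 off [D] makes the map total; the measure pushed forward is restricted to [D] and
   never sees it. *)
pose qD (s : borel_Sigma2) : measurableTypeR R := if s \in D then q s else -1.
have qDB (A : set R) : D `&` qD @^-1` A = E A.
  by apply/seteqP; split=> s [Ds]; rewrite /= /qD mem_set.
have mqD : measurable_fun setT qD.
  apply: measurable_fun_if => //=.
    by apply: (measurable_fun_bool true); rewrite setTI preimage_mem_true.
  by rewrite setTI preimage_mem_true.
pose nu := measure_function_pushforward__canonical__measure_function_Measure
  (mrestr mu mD) mqD.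
pose nu' := mrestr leb (measurable_itv `[(0 : R), 1[).
move=> mB; have nuE (A : set R) : nu A = mu (E A).
  by rewrite /nu/= /pushforward /mrestr setIC qDB.
rewrite -/(E B) setIC -nuE.
apply: (@measure_unique _ R (measurableTypeR R) (@measurable_realfun.RGenInftyO.G R)
  (fun n => `]-oo, n%:R[%classic) _ _ _ _ nu nu') => //.
- exact: measurable_realfun.RGenInftyO.measurableE.
- move=> _ _ [x ->] [y ->]; exists (Num.min x y).
  apply/seteqP; split=> z /=; rewrite !in_itv/= lt_min; first by move=> [-> ->].
  by move=> /andP[].
- by move=> i; exists i%:R.
- apply/seteqP; split=> // x _; exists (Num.bound `|x|) => //=.
  by rewrite in_itv/= (le_lt_trans (ler_norm _))// archi_boundP.
- by move=> A [x ->]; rewrite nuE mu_E_initial /nu' /mrestr setIC.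
- move=> k; rewrite nuE ltey_eq fin_num_measure//.
  exact: mE.
Qed.

Context {Q : set R} {code : R -> borel_Sigma2}.
Hypotheses (Q_countable : countable Q) (code_meas : measurable_fun setT code)
  (code_theta : forall s, D s -> ~ Q (angle (theta s)) ->
    s = code (angle (theta s))).

(** Off the fibres over the countable set [Q], which are null, [code] inverts the angle of [theta];
    since that angle has Lebesgue distribution, [mu] is the image of Lebesgue measure under
    [code]. *)
Lemma invariant_measureE (X : set borel_Sigma2) : measurable X ->
  mu X = leb (`[0, 1[%classic `&` code @^-1` X).
Proof.
move=> mX.
have mQ : measurable Q by exact: countable_measurable.
have mcX : measurable (code @^-1` X).
  by rewrite -[X in measurable X]setTI; exact: code_meas.
have mDC : mu (~` D : set borel_Sigma2) = 0%E.
  by rewrite probability_setC// mu_D subee.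
have EQ0 : mu (E Q) = 0%E.
  rewrite /E invariant_measure_angle//; apply/eqP; rewrite -measure_le0.
  rewrite -(countable_lebesgue_measure0 Q_countable).
  by rewrite le_measure ?inE//; exact: measurableI.
rewrite -invariant_measure_angle//.
apply: (@measure_eq_mod_null _ _ _ mu _ _ (~` D `|` E Q)) => //.
- exact: mE.
- by apply: measurableU; [exact: measurableC|exact: mE].
- by rewrite measureU0//; [exact: measurableC|exact: mE].
- move=> s /not_orP[/contrapT Ds QQ].
  have {}QQ : ~ Q (angle (theta s)) by move=> h; apply: QQ.
  by split=> [Xs|[_ /=]]; [split=> //=|]; rewrite -code_theta.
Qed.

End UniqueErgodicity.

(** * Separation in the circle and maps induced by maps of degree one *)

Section CircleTopology.
Context {R : realType}.
Implicit Types (c d : circle R).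

Lemma circle_translation_continuous d : continuous (fun c => c + d).
Proof.
apply/quotient_continuous.
rewrite (_ : _ \o _ = @to_circle R \o (fun x => x + repr d)).
  move=> x; apply: continuous_comp; last exact: to_circle_continuous.
  by apply: cvgD; [exact: cvg_id|exact: cvg_cst].
by apply/funext => x /=; rewrite to_circleD to_circle_repr.
Qed.

Lemma hausdorff_circle : hausdorff_space (circle R).
Proof.
rewrite open_hausdorff => c d cd.
(* Rotating by [t] moves the midpoint of the two angles to 1/2. The two points then lie on opposite
   sides of 1/2 and away from the class of 0, so [open_arc] separates them. *)
pose t : circle R := to_circle (2^-1 - (angle c + angle d) / 2).
have c0 := angle_ge0 c; have c1 := angle_lt1 c.
have d0 := angle_ge0 d; have d1 := angle_lt1 d.
have ct : angle (c + t) = 2^-1 + (angle c - angle d) / 2.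
  by rewrite -{1}(to_circle_angle c) -to_circleD angle_to_circle frac_id; lra.
have dt : angle (d + t) = 2^-1 - (angle c - angle d) / 2.
  by rewrite -{1}(to_circle_angle d) -to_circleD angle_to_circle frac_id; lra.
have open_t u v : 0 <= u -> v <= 1 -> open [set e | u < angle (e + t) < v].
  move=> u0 v1; have /continuousP tc : continuous (fun c => c + t).
    exact: circle_translation_continuous.
  exact: (tc _ (open_arc u0 v1)).
have o1 : open [set e | 0 < angle (e + t) < 2^-1] by apply: open_t; lra.
have o2 : open [set e | 2^-1 < angle (e + t) < 1] by apply: open_t; lra.
have ne : angle c != angle d.
  by apply: contra cd => /eqP cd; rewrite -(to_circle_angle c) cd to_circle_angle.
have disj : [set e | 0 < angle (e + t) < 2^-1] `&`
    [set e | 2^-1 < angle (e + t) < 1] = set0.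
  by apply/seteqP; split=> // e [/= /andP[_ h1] /andP[h2 _]]; lra.
have [h|h] := ltP (angle c) (angle d).
  exists ([set e | 0 < angle (e + t) < 2^-1], [set e | 2^-1 < angle (e + t) < 1]).
    by rewrite !inE/= ct dt; split; lra.
  by split=> //=; apply/eqP.
have {}h : angle d < angle c by rewrite lt_neqAle eq_sym ne h.
exists ([set e | 2^-1 < angle (e + t) < 1], [set e | 0 < angle (e + t) < 2^-1]).
  by rewrite !inE/= ct dt; split; lra.
by split=> //=; rewrite setIC; apply/eqP.
Qed.

End CircleTopology.

Section CircleMap.
Context {R : realType} {F : R -> R}.
Hypothesis F1 : forall x, F (x + 1) = F x + 1.

Definition circle_map (f : R -> R) (c : circle R) : circle R :=
  to_circle (f (repr c)).

Lemma circle_mapE x : circle_map F (to_circle x) = to_circle (F x).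
Proof.
have /to_circleE[k xk] := to_circle_repr (to_circle x).
by rewrite /circle_map xk degree_one_int// to_circleDz.
Qed.

Lemma circle_map_continuous : continuous F -> continuous (circle_map F).
Proof.
move=> Fc; apply/quotient_continuous.
rewrite (_ : _ \o _ = @to_circle R \o F).
  by move=> x; apply: continuous_comp; [exact: Fc|exact: to_circle_continuous].
by apply/funext => x /=; rewrite -circle_mapE.
Qed.

End CircleMap.

(** * The circle factor of a Denjoy minimal set in the shift *)

Section ShiftInvariantSets.
Context {D : set Sigma2}.
Hypothesis D_shift : shift @` D = D.

Definition shiftz (n : int) (s : Sigma2) : Sigma2 := fun i => s (i + n).

Lemma shiftz0 s : shiftz 0 s = s.
Proof. by apply/funext => i; rewrite /shiftz addr0. Qed.

Lemma shiftzD n m s : shiftz n (shiftz m s) = shiftz (n + m) s.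
Proof. by apply/funext => i; rewrite /shiftz addrA. Qed.

Lemma mem_shift s : D (shift s) <-> D s.
Proof.
split=> [|Ds]; last by rewrite -D_shift; exists s.
by rewrite -{1}D_shift => -[t Dt /(can_inj shiftK) <-].
Qed.

Lemma mem_shiftz n s : D (shiftz n s) <-> D s.
Proof.
have step k t : D (shiftz (k + 1) t) <-> D (shiftz k t).
  by rewrite [k + 1]addrC -shiftzD; exact: mem_shift (shiftz k t).
elim/int_ind: n => [|n IH|n IH]; first by rewrite shiftz0.
  by rewrite -addn1 PoszD step.
rewrite -IH -(step (- n.+1%:Z)) (_ : - n.+1%:Z + 1 = - n%:Z)//; lia.
Qed.

Lemma shiftz_equivariant (V : zmodType) (theta : Sigma2 -> V) (a : V) :
  (forall s, D s -> theta (shift s) = theta s + a) ->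
  forall n s, D s -> theta (shiftz n s) = theta s + a *~ n.
Proof.
move=> theta_shift n s Ds.
have step k : theta (shiftz (k + 1) s) = theta (shiftz k s) + a.
  by rewrite [k + 1]addrC -shiftzD -theta_shift//; exact/mem_shiftz.
elim/int_ind: n => [|n IH|n IH]; first by rewrite shiftz0 mulr0z addr0.
  by rewrite -addn1 PoszD step IH mulrzDr addrA.
apply: (addIr a); rewrite -step (_ : - n.+1%:Z + 1 = - n%:Z); last by lia.
by rewrite IH -addrA -[X in _ + (_ + X)]mulr1z -mulrzDr; congr (_ + _ *~ _); lia.
Qed.

End ShiftInvariantSets.

Section DenjoyFactor.
Context {R : realType} {alpha : R} {D : set Sigma2}.
Hypotheses (alpha_irr : irrational alpha)
  (D_denjoy : denjoy_minimal_set shift (to_circle alpha) D).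

Lemma denjoy_minimal : minimal_set shift D.
Proof.
case: D_denjoy => D_compact D_shift [g [M [_ _ [M0 M_closed gM M_min]]]].
move=> [h [k [[hD kh h_cont k_cont] h_conj]]].
have D_closed : closed D by exact: compact_closed hausdorff_Sigma2 _.
have kM c : M c -> D (k c) /\ h (k c) = c.
  by rewrite -hD => -[s Ds <-]; rewrite kh.
split=> //.
  by case: M0 => c /kM[? _]; exists (k c).
move=> N [s Ns] N_closed N_shift ND.
suff hN : h @` N = M.
  apply/seteqP; split=> // t Dt.
  have : (h @` N) (h t) by rewrite hN -hD; exists t.
  by move=> [u Nu]; move=> /(congr1 k); rewrite !kh//; [move=> <-|exact: ND].
apply: M_min.
- by exists (h s); exists s.
(* The image of [N] is rewritten as a preimage under the inverse [k], so that its closedness comes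
   from the continuity of [k] on the closed set [M]. *)
- rewrite (_ : h @` N = M `&` k @^-1` N); last first.
    apply/seteqP; split=> [_ [t Nt <-]|c [Mc Nkc]].
      by split; [rewrite -hD; exists t => //; exact: ND|rewrite /= kh//; exact: ND].
    by exists (k c) => //; case: (kM c Mc).
  have /continuous_closedP /(_ N N_closed) := k_cont.
  move=> /closed_subspaceP[V V_closed VM]; rewrite setIC -VM.
  exact: closedI.
- rewrite -[in RHS]N_shift; apply/seteqP; split=> [_ [_ [t Nt <-] <-]|_ [_ [t Nt <-] <-]].
    by exists (shift t); [exists t|rewrite h_conj//; exact: ND].
  by exists (h t); [exists t|rewrite h_conj//; exact: ND].
- by move=> _ [t Nt <-]; rewrite -hD; exists t => //; exact: ND.
Qed.

(** The factor map is the conjugacy onto the minimal set of a Denjoy example followed by Poincare's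
    map. Its exceptional set consists of the values that Poincare's map takes on a whole
    interval. *)
Lemma denjoy_factor : exists (theta : Sigma2 -> circle R) (Q : set R),
  [/\ {within D, continuous theta},
      forall s, D s -> theta (shift s) = theta s + to_circle alpha,
      theta @` D = setT &
      [/\ countable Q, forall x, Q (x + 1) <-> Q x,
          forall x, Q (x + alpha) <-> Q x &
          forall s t, D s -> D t -> theta s = theta t ->
            ~ Q (angle (theta s)) -> s = t]].
Proof.
have [D0 D_closed D_shift _] := denjoy_minimal.
case: D_denjoy => D_compact _ [g [M [_ [G0 [a [[G0c G0h G01 G0g] G0r aE]]] _]]].
move=> [h [k [[hD kh h_cont k_cont] h_conj]]].
have /to_circleE[m alphaE] := aE.
(* The rotation number is given only modulo 1; adding [m] to the lift makes its translation number
   equal to [alpha] itself. *)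
pose G x := G0 x + m%:~R.
have Gc : continuous G by move=> x; apply: cvgD; [exact: G0c|exact: cvg_cst].
have Gh : {homo G : x y / x < y} by move=> x y xy; rewrite /G ltrD2r G0h.
have G1 x : G (x + 1) = G x + 1 by rewrite /G G01 addrAC.
have iterG n x : iter n G x = iter n G0 x + n%:R * m%:~R.
  elim: n => [|n IH]; first by rewrite mul0r addr0.
  rewrite !iterS IH /G (_ : n%:R * m%:~R = (n%:Z * m)%:~R); last by rewrite intrM.
  rewrite (degree_one_int _ G01) intrM -natr1; lra.
have Gr x : (fun n => iter n G x / n%:R) @ \oo --> alpha.
  rewrite alphaE.
  apply: (@cvg_trans _ ((fun n => iter n G0 x / n%:R + m%:~R) @ \oo)).
    apply: near_eq_cvg; exists 1%N => // n /= n1.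
    rewrite iterG mulrDl; congr (_ + _); rewrite mulrAC divff ?mul1r//.
    by rewrite pnatr_eq0 -lt0n.
  by apply: cvgD; [exact: G0r|exact: cvg_cst].
have GE x : to_circle (G x) = g (to_circle x) by rewrite /G to_circleDz.
pose P := poincare (G := G) (alpha := alpha).
have P_homo : {homo P : x y / x <= y} := poincare_homo Gh G1 Gr.
have P1 x : P (x + 1) = P x + 1 := poincareD1 Gh G1 Gr x.
have PG x : P (G x) = P x + alpha := poincare_conj Gh G1 Gr x.
have P_cont : continuous P := poincare_continuous Gh G1 Gr alpha_irr Gc.
pose theta s := circle_map P (h s).
have theta_cont : {within D, continuous theta}.
  move=> s; apply: (@continuous_comp (subspace D) (circle R) (circle R) h
    (circle_map P)); first exact: h_cont.
  exact: circle_map_continuous.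
have theta_shift s : D s -> theta (shift s) = theta s + to_circle alpha.
  move=> Ds; rewrite /theta h_conj// -(to_circle_repr (h s)) -GE.
  by rewrite !circle_mapE// PG to_circleD.
exists theta, (double_values P); split=> //; last split=> //.
- apply/seteqP; split=> // c _.
  have im_closed : closed (theta @` D).
    apply: compact_closed; first exact: hausdorff_circle.
    exact: continuous_compact.
  rewrite (closure_id (theta @` D)).1// => B.
  rewrite -(to_circle_repr c) => /to_circle_continuous.
  rewrite nbhs_filterE => /nbhs_ballP[e /= e0 eB].
  case: D0 => s Ds.
  (* The image of [D] is closed and contains a full orbit of the rotation, which is dense. *)
  have [|n [j /andP[h1 h2]]] := dense_comb alpha_irr
    (_ : repr c - e - repr (theta s) < repr c + e - repr (theta s)); first by lra.
  exists (theta (shiftz n s)); split.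
    by exists (shiftz n s) => //; apply/(mem_shiftz D_shift).
  rewrite (shiftz_equivariant D_shift theta_shift)// -(to_circle_repr (theta s)).
  rewrite -to_circleMz -to_circleD -(to_circleDz _ j); apply: eB.
  rewrite /ball/= ltr_distlC -mulrzl; apply/andP; split; lra.
- exact: double_values_countable.
- move=> x; split=> [[y [y' [yy' Py Py']]]|[y [y' [yy' Py Py']]]].
    exists (y - 1), (y' - 1); have := P1 (y - 1); have := P1 (y' - 1).
    by rewrite !subrK => h1 h2; split; lra.
  by exists (y + 1), (y' + 1); rewrite !P1; split; lra.
- move=> x; split=> [[y [y' [yy' Py Py']]]|[y [y' [yy' Py Py']]]]; last first.
    by exists (G y), (G y'); rewrite !PG Py Py'; split=> //; exact: Gh.
  have [z zy] := degree_one_surjective Gc G1 y.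
  have [z' zy'] := degree_one_surjective Gc G1 y'.
  exists z, z'; have := PG z; have := PG z'; rewrite zy zy' => h1 h2.
  split; [|lra|lra].
  rewrite ltNge; apply/negP; rewrite le_eqVlt => /predU1P[zz|/Gh]; last by lra.
  by move: yy'; rewrite -zy -zy' zz ltxx.
- move=> s t Ds Dt st Qs.
  have {}st : to_circle (P (repr (h s))) = to_circle (P (repr (h t))) by [].
  have /to_circleE[j Pst] := st.
  suff : repr (h s) = repr (h t) + j%:~R.
    move=> /(congr1 (@to_circle R)); rewrite to_circleDz !to_circle_repr.
    by move=> /(congr1 k); rewrite !kh.
  (* If the two lifts were distinct, [P] would take one value at both, so this value, and by
     periodicity its fractional part, would be exceptional. *)
  rewrite -(degree_one_int _ P1) in Pst.
  apply: contra_notP Qs => /eqP ne.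
  rewrite /theta /circle_map angle_to_circle /frac.
  set y := repr (h s) in Pst ne *; set f := Num.floor (P y).
  have PE z : P (z - f%:~R) = P z - f%:~R by rewrite -intrN degree_one_int.
  have [yz|yz|yz] := ltgtP y (repr (h t) + j%:~R).
  - by exists (y - f%:~R), (repr (h t) + j%:~R - f%:~R); rewrite !PE -Pst; split; lra.
  - by exists (repr (h t) + j%:~R - f%:~R), (y - f%:~R); rewrite !PE -Pst; split; lra.
  - by rewrite yz eqxx in ne.
Qed.

End DenjoyFactor.

(** * Recovering a Denjoy set and its measure from the coding of a rotation *)

Section RotationMeasure.
Context {R : realType} {alpha : R} {code : R -> borel_Sigma2}.
Hypotheses (code_meas : measurable_fun setT code)
  (code1 : forall x, code (x + 1) = code x)
  (code_shift : forall x, code (x + alpha) = shift (code x)).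
Local Notation leb := (@lebesgue_measure R).

Let code01 := pushforward (mrestr leb (measurable_itv `[(0 : R), 1[)) code.

Let code01E X : code01 X = leb (`[0, 1[%classic `&` code @^-1` X).
Proof. by rewrite /code01 /pushforward /mrestr setIC. Qed.

HB.instance Definition _ := Measure.copy code01
  (measure_function_pushforward__canonical__measure_function_Measure
    (mrestr leb (measurable_itv `[(0 : R), 1[)) code_meas).

Let code01T : code01 setT = 1%E.
Proof.
rewrite code01E preimage_setT setIT lebesgue_measure_itv/= lte_fin ltr01.
by rewrite -EFinB subr0.
Qed.

HB.instance Definition _ := Measure_isProbability.Build _ _ _ code01 code01T.

(** Provides the existence behind [unique_measure]: [get] is meaningful only once some invariant
    measure gives the set full mass. *)
Lemma rotation_measure_exists : exists mu : probability borel_Sigma2 R,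
  @invariant_measures R mu /\
  forall X, mu X = leb (`[0, 1[%classic `&` code @^-1` X).
Proof.
exists code01; split; last exact: code01E.
move=> X mX /=; rewrite !code01E.
rewrite (_ : code @^-1` _ = (fun x => x + alpha) @^-1` (code @^-1` X)).
  apply: lebesgue_measure_circle_translation.
    by rewrite -[X in measurable X]setTI; exact: code_meas.
  by move=> x; rewrite /preimage/= code1.
by apply/funext => x; rewrite /preimage/= code_shift.
Qed.

End RotationMeasure.

Section CodedDenjoySet.
Context {R : realType} {alpha : R} {D : set Sigma2}
  {theta : Sigma2 -> circle R} {Q : set R}.
Hypotheses (alpha_irr : irrational alpha) (D_min : minimal_set shift D)
  (theta_cont : {within D, continuous theta})
  (theta_shift : forall s, D s -> theta (shift s) = theta s + to_circle alpha)
  (theta_onto : theta @` D = setT) (Q_countable : countable Q)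
  (Q1 : forall x, Q (x + 1) <-> Q x)
  (Qalpha : forall x, Q (x + alpha) <-> Q x)
  (theta_inj : forall s t, D s -> D t -> theta s = theta t ->
    ~ Q (angle (theta s)) -> s = t).
Local Notation leb := (@lebesgue_measure R).

Let D_closed : closed D. Proof. by case: D_min. Qed.
Let D_shift : shift @` D = D. Proof. by case: D_min. Qed.

Let bad : set (circle R) := [set c | Q (angle c)].

Let Qz x (k : int) : Q (x + k%:~R) = Q x.
Proof. by apply: periodicMz => y; exact/propext/Q1. Qed.

Let bad_to_circle x : bad (to_circle x) <-> Q x.
Proof. by rewrite /bad/= angle_to_circle /frac -intrN Qz. Qed.

Let bad_shift (c : circle R) : bad (c + to_circle alpha) <-> bad c.
Proof. by rewrite -(to_circle_repr c) -to_circleD !bad_to_circle. Qed.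

Let bad_shiftz (c : circle R) (n : int) :
  bad (c + to_circle alpha *~ n) <-> bad c.
Proof. by rewrite (periodicMz (fun d => propext (bad_shift d))). Qed.

Let leb_Q (A : set R) : A `<=` Q -> leb A = 0%E.
Proof.
move=> AQ; apply: countable_lebesgue_measure0.
by apply: sub_countable Q_countable; exact: subset_card_le.
Qed.

Let good_dense (x e : R) : 0 < e -> exists2 y, `|x - y| < e & ~ Q y.
Proof.
move=> e0; apply: contrapT => h.
suff /leb_Q : `]x - e, x + e[%classic `<=` Q.
  rewrite lebesgue_measure_itv/= lte_fin ifT; last by lra.
  by rewrite -EFinB => /eqP; rewrite eqe => /eqP; lra.
move=> y /=; rewrite in_itv/= => /andP[h1 h2]; apply: contrapT => Qy.
by apply: h; exists y => //; rewrite ltr_distlC; apply/andP; split; lra.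
Qed.

Let haar_bad (A : set (circle R)) : A `<=` bad -> haar A = 0%E.
Proof.
move=> Abad; rewrite /haar; apply: leb_Q => x [_ Ax].
exact/bad_to_circle/Abad.
Qed.

Let K (b : bool) : set (circle R) := theta @` (D `&` [set s | s 0 = b]).

Let K_closed b : closed (K b).
Proof.
apply: compact_closed; first exact: hausdorff_circle.
apply: continuous_compact.
  by apply: continuous_subspaceW theta_cont => s [].
have D_compact : compact D by exact: subclosed_compact D_closed compact_Sigma2 _.
apply: (subclosed_compact _ D_compact); last by move=> s [].
by apply: closedI => //; exact: closed_coord.
Qed.

Let mem_K s (i : int) : D s -> K (s i) (theta s + to_circle alpha *~ i).
Proof.
move=> Ds; exists (shiftz i s); last exact: (shiftz_equivariant D_shift theta_shift).
by split; [exact/mem_shiftz|rewrite /shiftz/= add0r].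
Qed.

Let theta_surj c : exists2 s, D s & theta s = c.
Proof.
have : (theta @` D) c by rewrite theta_onto.
by move=> [s Ds <-]; exists s.
Qed.

Let K_cover c : K true c \/ K false c.
Proof.
have [s Ds <-] := theta_surj c.
have := mem_K 0 Ds; rewrite mulr0z addr0.
by case: (s 0) => h; [left|right].
Qed.

Let K_bad b c : K b c -> K (~~ b) c -> bad c.
Proof.
move=> [s [Ds sb] sc] [t [Dt tb] tc]; apply: contrapT => h.
suff st : s = t by move: sb tb; rewrite st /= => ->; by case: (b).
by apply: theta_inj => //; rewrite ?sc ?tc.
Qed.

(** Otherwise every class would be exceptional: a point of [D] showing the symbol [b] has an iterate
    over [K b], and exceptional classes are invariant, while a point never showing [b] is constant,
    hence fixed by the shift, which would make alpha an integer. The two values of [b] show that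
    [coding_set] is nonempty and proper. *)
Let K_not_bad b : ~ (K b `<=` bad).
Proof.
move=> Kbad.
have allbad c : bad c.
  have [s Ds <-] := theta_surj c.
  have [[i si]|sb] := pselect (exists i, s i = b).
    by have := mem_K i Ds; rewrite si => /Kbad /bad_shiftz.
  have ss : shift s = s.
    apply/funext => i; have sE j : s j = ~~ b.
      by case: (b) sb => h; case sj : (s j) => //; exfalso; apply: h; exists j.
    by rewrite /Defs.shift !sE.
  have := theta_shift Ds; rewrite ss -{1}[theta s]addr0 => /addrI.
  have <- : to_circle 0 = 0 :> circle R by rewrite -(mulr0z 0) to_circleMz mulr0z.
  move=> /esym/to_circleE[k]; rewrite add0r => /(alpha_ne_int alpha_irr).
  exact: False_ind.
have [y _] := good_dense 0 ltr01; apply.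
exact/bad_to_circle.
Qed.

Definition coding_set : set (circle R) := (K true)°.
Local Notation U := coding_set.

Let UK : U `<=` K true. Proof. exact: interior_subset. Qed.

Let notK0 c : ~ K false c -> U c.
Proof.
suff h : ~` K false `<=` U by exact: h.
rewrite -open_subsetE ?openC//; by move=> d /= Kd; case: (K_cover d).
Qed.

Let U_open : open U. Proof. exact: open_interior. Qed.

(** A frontier point stays in the closed set [K true] but leaves its interior, so it also lies in
    [K false]. *)
Let frontier_bad : frontier U `<=` bad.
Proof.
move=> c [cU UU]; have nU : ~ U c.
  by move=> Uc; apply: UU; rewrite ((interior_id U).1 U_open).
apply: (@K_bad true); last by apply: contrapT => /notK0.
rewrite ((closure_id (K true)).1 (@K_closed true)).
exact: closure_subset UK _ cU.
Qed.

Lemma coding_set_RO0 : RO0 U.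
Proof.
split.
- apply/set0P/eqP => U0; apply: (@K_not_bad true) => c Kc.
  apply: K_bad Kc _; apply: contrapT => /notK0; by rewrite U0.
- apply/eqP => UT; apply: (@K_not_bad false) => c Kc.
  by apply: K_bad Kc _; apply: UK; rewrite UT.
- exact: interior_closed_regopen.
- exact: haar_bad frontier_bad.
Qed.

Local Notation code := (coding U (to_circle alpha)).

Lemma coding_factor s : D s -> ~ Q (angle (theta s)) -> code (theta s) = s.
Proof.
move=> Ds good; apply/funext => i; rewrite /coding.
have {}good : ~ bad (theta s + to_circle alpha *~ i) by move=> /bad_shiftz.
have := mem_K i Ds; case: (s i) => Ki.
  apply/asboolP/notK0 => Kf; apply: good; exact: K_bad Ki Kf.
apply/asboolP => /UK Kt; apply: good; exact: K_bad Ki Kt.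
Qed.

Lemma good_coding_domain c : ~ Q (angle c) -> coding_domain U (to_circle alpha) c.
Proof. by move=> good i /frontier_bad /bad_shiftz. Qed.

Lemma coding_continuous c : coding_domain U (to_circle alpha) c ->
  code d @[d --> c] --> code c.
Proof.
move=> cdom; apply: (cvg_Sigma2 (nbhs_filter c)) => i.
pose c' : circle R := c + to_circle alpha *~ i.
have cvg_c : d + to_circle alpha *~ i @[d --> c] --> c'.
  exact: circle_translation_continuous.
have Fc : ~ frontier U c' := cdom i.
have [Uc|Uc] := pselect (U c').
  have : nbhs c' U by exact: open_nbhs_nbhs.
  move=> /cvg_c; apply: (@filterS _ _ (nbhs_filter c)) => d /= Ud; rewrite /coding.
  by rewrite !asboolT.
have cUc : ~ closure U c'.
  by move=> h; apply: Fc; split=> //; rewrite ((interior_id U).1 U_open).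
have : nbhs c' (~` closure U).
  by apply: open_nbhs_nbhs; split=> //; rewrite openC; exact: closed_closure.
move=> /cvg_c; apply: (@filterS _ _ (nbhs_filter c)) => d /= Ud; rewrite /coding.
by rewrite !asboolF// => h; apply: Ud; exact: subset_closure.
Qed.

(** The class [c] may be exceptional, where [coding_factor] says nothing. It is then a limit of good
    classes, whose codes lie in the closed set [D], and the coding is continuous at [c]. *)
Lemma coding_mem c : coding_domain U (to_circle alpha) c -> D (code c).
Proof.
move=> cdom; rewrite ((closure_id D).1 D_closed) => B.
move=> /(coding_continuous cdom).
rewrite -{1}(to_circle_repr c) => /to_circle_continuous.
move=> /nbhs_ballP[e /= e0 eB].
have [y ye Qy] := good_dense (repr c) e0.
exists (code (to_circle y)); split; last exact: eB.
have [s Ds sy] := theta_surj (to_circle y).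
rewrite -sy coding_factor// sy.
by move=> /(bad_to_circle y).
Qed.

Lemma coding_shift c : code (c + to_circle alpha) = shift (code c).
Proof.
apply/funext => i; rewrite /coding /Defs.shift.
by rewrite [i + 1]addrC mulrzDr mulr1z addrA.
Qed.

Lemma coding_unshift c : code (c - to_circle alpha) = unshift (code c).
Proof. by rewrite -{2}(subrK (to_circle alpha) c) coding_shift shiftK. Qed.

Lemma coding_domain_shiftz c (n : int) : coding_domain U (to_circle alpha) c ->
  coding_domain U (to_circle alpha) (c + to_circle alpha *~ n).
Proof. by move=> cdom i; rewrite -addrA -mulrzDr; exact: cdom. Qed.

Lemma coded_set_Lambda : D = Lambda U (to_circle alpha).
Proof.
have image_closure (f : Sigma2 -> Sigma2) (A : set Sigma2) : continuous f ->
    (forall s, A s -> A (f s)) -> forall s, closure A s -> closure A (f s).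
  move=> fc fA s sA B /fc /sA[t [At Bt]]; exists (f t); split => //; exact: fA.
case: D_min => _ _ _ /(_ (Lambda U (to_circle alpha))) -> //.
- have [y _ Qy] := good_dense 0 ltr01.
  exists (code (to_circle y)); apply: subset_closure.
  by exists (to_circle y) => //; apply: good_coding_domain => /(bad_to_circle y).
- exact: closed_closure.
- apply/seteqP; split=> [_ [s Ls <-]|s Ls].
    apply: (image_closure shift) Ls; first exact: shift_continuous.
    move=> _ [c cdom <-]; exists (c + to_circle alpha); last exact: coding_shift.
    by have := coding_domain_shiftz (n := 1) cdom; rewrite mulr1z.
  exists (unshift s); last exact: unshiftK.
  apply: (image_closure unshift) Ls; first exact: unshift_continuous.
  move=> _ [c cdom <-]; exists (c - to_circle alpha); last exact: coding_unshift.
  by have := coding_domain_shiftz (n := - 1) cdom; rewrite mulrNz mulr1z.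
- rewrite [X in _ `<=` X]((closure_id D).1 D_closed).
  by apply: closure_subset => _ [c cdom <-]; exact: coding_mem.
Qed.

Let real_code : R -> borel_Sigma2 := code \o @to_circle R.

Let real_code_meas : measurable_fun setT real_code.
Proof.
apply: measurable_fun_Sigma2 => i.
apply: measurable_realfun.open_measurable.
rewrite (_ : [set x | _] = (fun x => to_circle x + to_circle alpha *~ i) @^-1` U).
  have /continuousP h : continuous (fun x : R => to_circle x + to_circle alpha *~ i).
    move=> x; apply: (@continuous_comp _ _ _ (@to_circle R)
      (fun c => c + to_circle alpha *~ i)); first exact: to_circle_continuous.
    exact: circle_translation_continuous.
  exact: h.
by apply/seteqP; split=> x /= /asboolP.
Qed.

Lemma lambdaE X : measurable (X : set borel_Sigma2) ->
  lambda U (to_circle alpha) X = leb (`[0, 1[%classic `&` real_code @^-1` X).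
Proof.
move=> mX.
have mcX : measurable (real_code @^-1` X).
  by rewrite -[X in measurable X]setTI; exact: real_code_meas.
have mQ : measurable Q by exact: countable_measurable.
rewrite /lambda /haar preimage_setI.
have goodQ x : ~ Q x -> coding_domain U (to_circle alpha) (to_circle x).
  by move=> Qx; apply: good_coding_domain => /(bad_to_circle x).
apply: (@measure_eq_mod_null _ _ _ leb _ _ Q) => //.
- apply: measurableI => //; apply: measurableI => //.
  (* The coding domain is measurable because its complement lifts into the countable set [Q]. *)
  rewrite -[X in measurable X]setCK; apply: measurableC.
  apply: countable_measurable => //; apply: sub_countable Q_countable.
  apply: subset_card_le => x /=; apply: contra_notP; exact: goodQ.
- exact: measurableI.
- exact: leb_Q.
- move=> x Qx; split=> [[x01 [_ Xx]]//|[x01 Xx]].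
  by split=> //; split=> //; exact: goodQ.
Qed.

(** The image of Lebesgue measure under the coding is a witness: almost every class is good, and
    codes of good classes lie in [D]. Hence [get] does not fall back on its default. *)
Lemma unique_measureP : @invariant_measures R (unique_measure R D) /\
  (unique_measure R D : probability borel_Sigma2 R) D = 1%E.
Proof.
have [mu [mu_inv muE]] : exists mu : probability borel_Sigma2 R,
    @invariant_measures R mu /\
    forall X, mu X = leb (`[0, 1[%classic `&` real_code @^-1` X).
  apply: (rotation_measure_exists (alpha := alpha)) => //.
  - by move=> x; rewrite /real_code/= (to_circleDz x 1).
  - by move=> x; rewrite /real_code/= to_circleD coding_shift.
have mQ : measurable Q by exact: countable_measurable.
have muD : mu D = 1%E.
  rewrite muE (_ : 1%E = leb `[(0 : R), 1[%classic); last first.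
    by rewrite lebesgue_measure_itv/= lte_fin ltr01 -EFinB subr0.
  apply: (@measure_eq_mod_null _ _ _ leb _ _ Q) => //.
  - apply: measurableI => //; rewrite -[X in measurable X]setTI.
    by apply: real_code_meas => //; exact: measurable_closed_Sigma2.
  - exact: leb_Q.
  - move=> x Qx; split=> [[]//|x01]; split=> //; apply: coding_mem.
    by apply: good_coding_domain => /(bad_to_circle x).
rewrite /unique_measure; case: xgetP => [nu _ [nu_inv nuD]|]; first by [].
by move=> /(_ mu); case.
Qed.

Lemma coded_unique_measure : lambda_RO0 (to_circle alpha) (unique_measure R D).
Proof.
have [nu_inv nuD] := unique_measureP.
split=> //; exists coding_set; first exact: coding_set_RO0.
move=> X mX; rewrite lambdaE//.
apply: (invariant_measureE alpha_irr D_closed D_shift theta_cont theta_shift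
  nu_inv nuD Q_countable real_code_meas) => // s Ds Qs.
by rewrite /real_code/= to_circle_angle coding_factor.
Qed.

End CodedDenjoySet.

Section DenjoySetsAreCoded.
Context {R : realType} {alpha : R} {D : set Sigma2}.
Hypotheses (alpha_irr : irrational alpha)
  (D_denjoy : denjoy_minimal_set shift (to_circle alpha) D).

Lemma denjoy_set_coded : exists2 U : set (circle R), RO0 U &
  D = Lambda U (to_circle alpha).
Proof.
have [theta [Q [tc ts to [Qc Q1 Qa ti]]]] := denjoy_factor alpha_irr D_denjoy.
have D_min := denjoy_minimal D_denjoy.
exists (@coding_set R D theta).
  exact: (coding_set_RO0 alpha_irr D_min tc ts to Qc Q1 Qa ti).
exact: (coded_set_Lambda D_min tc ts to Qc Q1 Qa ti).
Qed.

Lemma denjoy_unique_measure :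
  lambda_RO0 (to_circle alpha) (unique_measure R D).
Proof.
have [theta [Q [tc ts to [Qc Q1 Qa ti]]]] := denjoy_factor alpha_irr D_denjoy.
have D_min := denjoy_minimal D_denjoy.
exact: (coded_unique_measure alpha_irr D_min tc ts to Qc Q1 Qa ti).
Qed.

Lemma denjoy_unique_measureP : @invariant_measures R (unique_measure R D) /\
  (unique_measure R D : probability borel_Sigma2 R) D = 1%E.
Proof.
have [theta [Q [tc ts to [Qc Q1 Qa ti]]]] := denjoy_factor alpha_irr D_denjoy.
have D_min := denjoy_minimal D_denjoy.
exact: (unique_measureP D_min tc ts to Qc Q1 Qa ti).
Qed.

End DenjoySetsAreCoded.

(** * Dyadic averages and increasing maps with prescribed jumps *)

Section DyadicSum.
Context {R : realType}.
Implicit Types (a b : nat -> R) (C : R).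

Definition bounded_seq a := exists C, forall i, `|a i| <= C.

(** The weights 1/2, 1/4, ... add up to 1, so this is an average and fixes constants; averaged
    floors and ceilings thus have degree one. Boundedness gives the convergence on which [limn]
    relies. *)
Definition dyadic_sum a : R := limn (series (fun i => a i / 2 ^+ i.+1)).

Let half_lt1 : `|2^-1| < 1 :> R.
Proof. by rewrite ger0_norm ?invr_ge0// invf_lt1// ltr1n. Qed.

Let pow0 n : 0 < 2 ^+ n :> R. Proof. exact: exprn_gt0. Qed.

Lemma dyadic_sum_cvg a : bounded_seq a ->
  cvgn (series (fun i => a i / 2 ^+ i.+1)).
Proof.
move=> [C aC]; apply: normed_cvg.
apply: (@series_le_cvg _ _ (geometric (C / 2) 2^-1)) => //.
- by move=> n; exact: normr_ge0.
- move=> n; rewrite /= mulr_ge0 ?exprn_ge0 ?divr_ge0//.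
  by rewrite (le_trans _ (aC 0%N)).
- move=> n; rewrite /= normrM normfV (ger0_norm (ltW (pow0 _))) exprS invfM.
  by rewrite mulrA exprVn ler_pM2r ?invr_gt0// ler_pM2r ?invr_gt0.
- exact: is_cvg_geometric_series.
Qed.

Lemma bounded_seqD a b : bounded_seq a -> bounded_seq b ->
  bounded_seq (fun i => a i + b i).
Proof.
move=> [C aC] [C' bC']; exists (C + C') => i.
by rewrite (le_trans (ler_normD _ _))// lerD.
Qed.

Lemma bounded_seqN a : bounded_seq a -> bounded_seq (fun i => - a i).
Proof. by move=> [C aC]; exists C => i; rewrite normrN. Qed.

Lemma bounded_seq_cst C : bounded_seq (fun=> C).
Proof. by exists `|C|. Qed.

Lemma dyadic_sumD a b : bounded_seq a -> bounded_seq b ->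
  dyadic_sum (fun i => a i + b i) = dyadic_sum a + dyadic_sum b.
Proof.
move=> ba bb; rewrite /dyadic_sum -limD; [|exact: dyadic_sum_cvg..].
congr (limn _); apply/funext => n; rewrite /series /=.
by under eq_bigr do rewrite mulrDl; rewrite big_split.
Qed.

Lemma dyadic_sumN a : bounded_seq a ->
  dyadic_sum (fun i => - a i) = - dyadic_sum a.
Proof.
move=> ba; rewrite /dyadic_sum -limN; last exact: dyadic_sum_cvg.
congr (limn _); apply/funext => n; rewrite /series /=.
by under eq_bigr do rewrite mulNr; rewrite sumrN.
Qed.

Lemma dyadic_sum_cst C : dyadic_sum (fun=> C) = C.
Proof.
apply: cvg_lim => //.
rewrite [X in _ --> X](_ : _ = (C / 2) * (1 - 2^-1)^-1); last by field.
rewrite (_ : (fun i => C / 2 ^+ i.+1) = geometric (C / 2) 2^-1).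
  exact: cvg_geometric_series.
by apply/funext => i; rewrite /= exprS invfM mulrA exprVn.
Qed.

Lemma ler_dyadic_sum a b : bounded_seq a -> bounded_seq b ->
  (forall i, a i <= b i) -> dyadic_sum a <= dyadic_sum b.
Proof.
move=> ba bb ab; apply: ler_lim; [exact: dyadic_sum_cvg..|].
apply: nearW => n; apply: ler_sum => i _.
by rewrite ler_pM2r ?invr_gt0.
Qed.

Lemma dyadic_sum_gt0 a k : bounded_seq a -> (forall i, 0 <= a i) -> 0 < a k ->
  0 < dyadic_sum a.
Proof.
move=> ba a0 ak; have u0 i : 0 <= a i / 2 ^+ i.+1 by rewrite divr_ge0.
have := nondecreasing_cvgn_le (nondecreasing_series (fun n _ _ => u0 n) (P := xpredT))
  (dyadic_sum_cvg ba) k.+1.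
apply: lt_le_trans; rewrite big_nat_recr//= ltr_wpDl ?divr_gt0//.
by apply: sumr_ge0 => i _; exact: u0.
Qed.

Lemma dyadic_sum_tail a C N : 0 <= C -> (forall i, `|a i| <= C) ->
  (forall i, (i < N)%N -> a i = 0) -> `|dyadic_sum a| <= C / 2 ^+ N.
Proof.
move=> C0 aC aN; have ba : bounded_seq a by exists C.
(* The bound is strengthened for the induction: [C / 2 ^+ maxn n N] is what the terms still to come
   can contribute. *)
have key n : `|series (fun i => a i / 2 ^+ i.+1) n| + C / 2 ^+ maxn n N <=
    C / 2 ^+ N.
  elim: n => [|n IH]; first by rewrite /series /= big_geq// normr0 add0r max0n.
  rewrite seriesSr; have [nN|Nn] := ltnP n N.
    rewrite (aN n nN) mul0r addr0 (maxn_idPr nN).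
    by rewrite (maxn_idPr (ltnW nN)) in IH.
  rewrite (maxn_idPl (leqW Nn)); rewrite (maxn_idPl Nn) in IH.
  apply: le_trans IH; have -> : C / 2 ^+ n = C / 2 ^+ n.+1 + C / 2 ^+ n.+1.
    by rewrite exprS; field; rewrite gt_eqF.
  rewrite addrA lerD2r (le_trans (ler_normD _ _))// lerD2l.
  by rewrite normrM normfV (ger0_norm (ltW (pow0 _))) ler_pM2r ?invr_gt0.
have key' n : `|series (fun i => a i / 2 ^+ i.+1) n| <= C / 2 ^+ N.
  by apply: le_trans (key n); rewrite lerDl divr_ge0// ltW.
rewrite ler_norml; apply/andP; split.
  apply: limr_ge; first exact: dyadic_sum_cvg.
  by apply: nearW => n; have := key' n; rewrite ler_norml => /andP[].
apply: limr_le; first exact: dyadic_sum_cvg.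
by apply: nearW => n; have := key' n; rewrite ler_norml => /andP[].
Qed.

End DyadicSum.

Section JumpFunctions.
Context {R : realType}.
Implicit Types (e : nat -> R) (x y : R).

(* The right-continuous and left-continuous versions of an increasing map of
   degree one whose discontinuities are the points of [e i + Z]. *)
Definition jump_right e x : R :=
  (x + dyadic_sum (fun i => (Num.floor (x - e i))%:~R)) / 2.

Definition jump_left e x : R :=
  (x + dyadic_sum (fun i => (Num.ceil (x - e i))%:~R - 1)) / 2.

Let floor_bounded e x : (forall i, `|e i| <= 1) ->
  forall i, `|(Num.floor (x - e i))%:~R : R| <= `|x| + 2.
Proof.
move=> e1 i; have /andP[] := floor_itv (x - e i); rewrite intrD1 => h1 h2.
have := e1 i; have := ler_norm x; have := ler_norm (- x); rewrite normrN.
by rewrite !ler_norml => h3 h4 /andP[h5 h6]; apply/andP; split; lra.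
Qed.

Let floor_seq e x : (forall i, `|e i| <= 1) ->
  bounded_seq (fun i => (Num.floor (x - e i))%:~R : R).
Proof. by move=> e1; exists (`|x| + 2); exact: floor_bounded. Qed.

(** The ceiling of t is minus the floor of -t, so x to -x exchanges the two versions. The constant
    is half of the 1 subtracted from the ceilings in [jump_left]. *)
Lemma jump_left_reflect e x : (forall i, `|e i| <= 1) ->
  jump_left e x = - jump_right (fun i => - e i) (- x) - 2^-1.
Proof.
move=> e1; have e1' i : `|- e i| <= 1 by rewrite normrN.
have fs := floor_seq (- x) e1'.
rewrite /jump_left /jump_right (_ : (fun i => _) =
   (fun i => - (Num.floor (- x - - e i))%:~R + -1)); last first.
  by apply/funext => i; rewrite ceilNfloor intrN opprB opprK (addrC (- x)).
rewrite (dyadic_sumD (bounded_seqN fs) (bounded_seq_cst _)) dyadic_sum_cst.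
by rewrite dyadic_sumN//; field.
Qed.

Section Bounded.
Context {e : nat -> R}.
Hypothesis e1 : forall i, `|e i| <= 1.

Let ceil_seq x : bounded_seq (fun i => (Num.ceil (x - e i))%:~R - 1 : R).
Proof.
have e1' i : `|- e i| <= 1 by rewrite normrN.
have [C hC] := bounded_seqD (bounded_seqN (floor_seq (- x) e1')) (bounded_seq_cst (-1)).
exists C => i; have := hC i.
by rewrite ceilNfloor intrN opprB opprK (addrC (- x)).
Qed.

Lemma jump_rightD1 x : jump_right e (x + 1) = jump_right e x + 1.
Proof.
rewrite /jump_right (_ : (fun i => _) = (fun i => (Num.floor (x - e i))%:~R + 1)).
  rewrite (dyadic_sumD (floor_seq x e1) (bounded_seq_cst 1)) dyadic_sum_cst.
  by field.
by apply/funext => i; rewrite addrAC floorDrz ?int_num1// floor1 intrD.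
Qed.

Lemma jump_leftD1 x : jump_left e (x + 1) = jump_left e x + 1.
Proof.
rewrite /jump_left (_ : (fun i => _) = (fun i => (Num.ceil (x - e i))%:~R - 1 + 1)).
  rewrite (dyadic_sumD (ceil_seq x) (bounded_seq_cst 1)) dyadic_sum_cst.
  by field.
by apply/funext => i; rewrite addrAC ceilDrz ?int_num1// ceil1 intrD addrAC.
Qed.

Let ceil_floor_le i x : (Num.ceil (x - e i))%:~R - 1 <= (Num.floor (x - e i))%:~R :> R.
Proof. by rewrite ceil_floor intrD; case: (x - e i \is a Num.int) => /=; lra. Qed.

Lemma jump_left_right x : jump_left e x <= jump_right e x.
Proof.
rewrite ler_pM2r ?invr_gt0// lerD2l; apply: ler_dyadic_sum => //.
exact: floor_seq.
Qed.

(** Ceiling minus 1 and floor agree off the integers and differ by 1 on them, so the difference of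
    the two averages has nonnegative terms, positive exactly at the indices that hit x. *)
Lemma jump_lt x :
  (exists i, x - e i \is a Num.int) <-> jump_left e x < jump_right e x.
Proof.
have fs := floor_seq x e1; have cs := ceil_seq x.
rewrite ltr_pM2r ?invr_gt0// ltrD2l; split=> [[k xk]|].
  rewrite -subr_gt0 -(dyadic_sumN cs) -(dyadic_sumD fs (bounded_seqN cs)).
  apply: (@dyadic_sum_gt0 _ _ k); first exact/bounded_seqD/bounded_seqN.
    by move=> i; rewrite subr_ge0.
  by rewrite /= ceil_floor xk addr0; lra.
apply: contraPP => /forallNP h; rewrite (_ : (fun i => _ - 1) =
  (fun i => (Num.floor (x - e i))%:~R)) ?ltxx//.
apply/funext => i; rewrite ceil_floor intrD; have /negP -> := h i.
by rewrite /= mulr1z addrK.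
Qed.

(** The strict inequality comes from the summand x; the averages are compared only weakly. *)
Lemma jump_mono x y : x < y -> jump_right e x < jump_left e y.
Proof.
move=> xy; rewrite ltr_pM2r ?invr_gt0// ltr_leD//.
apply: ler_dyadic_sum; [exact: floor_seq|exact: ceil_seq|].
move=> i; have : (Num.floor (x - e i))%:~R < (Num.ceil (y - e i))%:~R :> R.
  by have := floor_le (x - e i); have := ceil_ge (y - e i); lra.
by rewrite ltr_int => h; rewrite lerBrDr -intrD1 ler_int; lia.
Qed.

Lemma jump_left_ge x : x - 2 <= jump_left e x.
Proof.
have : dyadic_sum (fun=> x - 2) <= dyadic_sum (fun i => (Num.ceil (x - e i))%:~R - 1).
  apply: ler_dyadic_sum; [exact: bounded_seq_cst|exact: ceil_seq|].
  move=> i; have := ceil_ge (x - e i); have := e1 i.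
  by rewrite ler_norml => /andP[]; lra.
rewrite dyadic_sum_cst /jump_left; lra.
Qed.

Lemma jump_right_le x : jump_right e x <= x + 2.
Proof.
have : dyadic_sum (fun i => (Num.floor (x - e i))%:~R) <= dyadic_sum (fun=> x + 1).
  apply: ler_dyadic_sum; [exact: floor_seq|exact: bounded_seq_cst|].
  move=> i; have := floor_le (x - e i); have := e1 i.
  by rewrite ler_norml => /andP[]; lra.
rewrite dyadic_sum_cst /jump_right; lra.
Qed.

(** With 2^-N below eps / 4, the first N floors do not change just to the right of x; the others
    change by at most 2 each, which contributes at most 2 / 2^N, less than eps / 2, to the
    average. *)
Lemma jump_right_cvg x (eps : R) : 0 < eps ->
  exists2 d, 0 < d & forall y, x < y -> y < x + d ->
    jump_right e y < jump_right e x + eps.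
Proof.
move=> eps0; have eps4 : 0 < eps / 4 by lra.
have [N _ /(_ N (leqnn N))/=] := near_infty_natSinv_expn_lt (PosNum eps4).
rewrite /= mul1r => Neps.
have [d d0 dP] : exists2 d, 0 < d & forall y, x < y -> y < x + d ->
    forall i, (i < N)%N -> Num.floor (y - e i) = Num.floor (x - e i).
  elim: N {Neps} => [|N [d d0 dP]]; first by exists 1.
  have /andP[h1 h2] := floor_itv (x - e N).
  exists (Num.min d ((Num.floor (x - e N) + 1)%:~R - (x - e N))).
    by rewrite lt_min d0 subr_gt0.
  move=> y xy yd i; rewrite ltnS leq_eqVlt => /predU1P[->|iN].
    apply: floor_def; have : y < x + ((Num.floor (x - e N) + 1)%:~R - (x - e N)).
      by rewrite (lt_le_trans yd)// lerD2l ge_min lexx orbT.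
    by move=> h3; apply/andP; split; lra.
  by apply: dP => //; rewrite (lt_le_trans yd)// lerD2l ge_min lexx.
exists (Num.min d (Num.min 1 eps)); first by rewrite !lt_min d0 ltr01 eps0.
move=> y xy; rewrite -ltrBlDl !lt_min => /andP[yd /andP[y1 yeps]].
have fx := floor_seq x e1; have fy := floor_seq y e1.
have : `|dyadic_sum (fun i => (Num.floor (y - e i))%:~R - (Num.floor (x - e i))%:~R : R)|
    <= 2 / 2 ^+ N.
  apply: dyadic_sum_tail => // i.
    have /andP[h1 h2] := floor_itv (x - e i); rewrite intrD1 in h2.
    have /andP[h3 h4] := floor_itv (y - e i); rewrite intrD1 in h4.
    by rewrite ler_norml; apply/andP; split; lra.
  by move=> iN; rewrite dP// ?subrr//; lra.
rewrite (dyadic_sumD fy (bounded_seqN fx)) (dyadic_sumN fx) ler_norml.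
by move=> /andP[_]; rewrite /jump_right; lra.
Qed.

End Bounded.

Lemma jump_left_cvg e x (eps : R) : (forall i, `|e i| <= 1) -> 0 < eps ->
  exists2 d, 0 < d & forall y, x - d < y -> y < x ->
    jump_left e x - eps < jump_left e y.
Proof.
move=> e1 eps0; have e1' i : `|- e i| <= 1 by rewrite normrN.
have [d d0 dP] := jump_right_cvg e1' (- x) eps0; exists d => // y xy yx.
rewrite !jump_left_reflect//.
by have := dP (- y) ltac:(lra) ltac:(lra); lra.
Qed.

End JumpFunctions.

(** * Denjoy's construction: blowing up invariant orbits *)

Section DenjoyConstruction.
Context {R : realType} {Pm Pp : R -> R} {E : set R} {alpha : R}.
Hypotheses (alpha_irr : irrational alpha)
  (Pm1 : forall x, Pm (x + 1) = Pm x + 1)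
  (Pp1 : forall x, Pp (x + 1) = Pp x + 1)
  (Pmp : forall x, Pm x <= Pp x)
  (P_jump : forall x, E x <-> Pm x < Pp x)
  (P_lt : forall x y, x < y -> Pp x < Pm y)
  (Pm_ge : forall x, x - 2 <= Pm x) (Pp_le : forall x, Pp x <= x + 2)
  (Pm_left : forall x e, 0 < e ->
    exists2 d, 0 < d & forall y, x - d < y -> y < x -> Pm x - e < Pm y)
  (Pp_right : forall x e, 0 < e ->
    exists2 d, 0 < d & forall y, x < y -> y < x + d -> Pp y < Pp x + e)
  (E_alpha : forall x, E (x + alpha) <-> E x).

(* The circle is blown up by inserting the interval [Pm x, Pp x] at each point
   [x] of [E]; [base] collapses these intervals. *)
Definition base (z : R) : R := sup [set x | Pm x <= z].

Let has_sup_base z : has_sup [set x | Pm x <= z].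
Proof.
split; first by exists (z - 2); have := Pp_le (z - 2); have := Pmp (z - 2) => /=; lra.
by exists (z + 2) => x /= h; have := Pm_ge x; lra.
Qed.

(** The intervals [Pm x, Pp x] cover the line: if z escaped the one at the supremum, left continuity
    of [Pm] or right continuity of [Pp] would contradict the choice of the supremum. *)
Lemma base_itv z : Pm (base z) <= z <= Pp (base z).
Proof.
have [ne ub] := has_sup_base z; apply/andP; split; rewrite leNgt; apply/negP => h.
  have [|d d0 dP] := Pm_left (base z) (_ : 0 < Pm (base z) - z); first by lra.
  have [x /= xz xd] := sup_adherent d0 (has_sup_base z).
  have xb : x <= base z by apply: sup_upper_bound.
  have [xE|xb'] := eqVneq x (base z); first by move: xz; rewrite xE; lra.
  by have := dP x xd; rewrite lt_neqAle xb' xb => /(_ isT); lra.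
have [|d d0 dP] := Pp_right (base z) (_ : 0 < z - Pp (base z)); first by lra.
have h1 := dP (base z + d / 2) ltac:(lra) ltac:(lra).
have : base z + d / 2 <= base z.
  by apply: sup_upper_bound => //=; have := Pmp (base z + d / 2); lra.
by lra.
Qed.

Lemma base_unique x z : Pm x <= z <= Pp x -> base z = x.
Proof.
move=> /andP[h1 h2]; have /andP[h3 h4] := base_itv z.
by have [/P_lt|/P_lt|//] := ltgtP (base z) x; lra.
Qed.

Lemma base_Pm x : base (Pm x) = x.
Proof. by apply: base_unique; rewrite lexx Pmp. Qed.

Lemma base_Pp x : base (Pp x) = x.
Proof. by apply: base_unique; rewrite lexx Pmp. Qed.

Lemma base_homo : {homo base : z z' / z <= z'}.
Proof.
move=> z z' zz'; rewrite leNgt; apply/negP => /P_lt.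
by have /andP[h1 h2] := base_itv z; have /andP[h3 h4] := base_itv z'; lra.
Qed.

Lemma base1 z : base (z + 1) = base z + 1.
Proof. by apply: base_unique; rewrite Pm1 Pp1 !lerD2r base_itv. Qed.

Lemma base_continuous : continuous base.
Proof.
apply: nondecreasing_dense_continuous; first exact: base_homo.
by move=> a b ab; exists (Pm ((a + b) / 2)); rewrite base_Pm; apply/andP; split; lra.
Qed.

Lemma base_near z : `|z - base z| <= 2.
Proof.
have /andP[h1 h2] := base_itv z; have := Pm_ge (base z); have := Pp_le (base z).
by rewrite ler_distl => h3 h4; apply/andP; split; lra.
Qed.

Let w x := Pp x - Pm x.

Let w_gt0 x : E x <-> 0 < w x.
Proof. by rewrite P_jump subr_gt0. Qed.

Let w_ge0 x : 0 <= w x. Proof. by rewrite subr_ge0. Qed.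

Let w_eq0 x : ~ E x -> w x = 0.
Proof.
by move=> Ex; apply/eqP; rewrite eq_le w_ge0 andbT leNgt; apply/negP => /w_gt0.
Qed.

(* The translation by [b], extended affinely to the inserted intervals (off [E],
   where [w] vanishes, the second term is [0]). *)
Definition lift (b z : R) : R :=
  Pm (base z + b) + (z - Pm (base z)) * (w (base z + b) / w (base z)).

Section Lift.
Context {b : R}.
Hypothesis E_b : forall x, E (x + b) <-> E x.

Lemma lift_Pm x : lift b (Pm x) = Pm (x + b).
Proof. by rewrite /lift base_Pm subrr mul0r addr0. Qed.

Lemma lift_Pp x : lift b (Pp x) = Pp (x + b).
Proof.
rewrite /lift base_Pp -/(w x).
have [Ex|Ex] := pselect (E x).
  have /w_gt0 w0 := Ex; rewrite mulrCA divff ?gt_eqF// mulr1 /w; lra.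
have Exb : ~ E (x + b) by rewrite E_b.
by rewrite (w_eq0 Ex) mul0r addr0; have := w_eq0 Exb; rewrite /w; lra.
Qed.

Lemma lift_itv z : Pm (base z + b) <= lift b z <= Pp (base z + b).
Proof.
have /andP[h1 h2] := base_itv z; rewrite /lift.
have [Ez|Ez] := pselect (E (base z)); last first.
  by rewrite (w_eq0 Ez) invr0 !mulr0 addr0 lexx Pmp.
have /w_gt0 w0 := Ez; rewrite lerDl mulr_ge0 ?divr_ge0//=; last by lra.
rewrite -lerBrDl -/(w _) mulrCA ler_piMr// ler_pdivrMr// mul1r /w; lra.
Qed.

Lemma base_lift z : base (lift b z) = base z + b.
Proof. exact/base_unique/lift_itv. Qed.

Lemma lift1 z : lift b (z + 1) = lift b z + 1.
Proof.
rewrite /lift base1 Pm1 addrAC Pm1 /w addrAC Pm1 Pp1 (addrAC (base z)) Pm1 Pp1.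
have sub1 (u v : R) : u + 1 - (v + 1) = u - v by ring.
by rewrite !sub1 addrAC.
Qed.

(** Points with different bases stay ordered because the gaps are. Two distinct points with the same
    base lie in a genuine gap, where [lift] is affine with positive slope. *)
Lemma lift_homo : {homo lift b : z z' / z < z'}.
Proof.
move=> z z' zz'; have := base_homo (ltW zz').
have /andP[h1 h2] := lift_itv z; have /andP[h3 h4] := lift_itv z'.
rewrite le_eqVlt => /predU1P[zE|lt_base]; last first.
  have /P_lt h5 : base z + b < base z' + b by rewrite ltrD2r.
  lra.
rewrite /lift zE ltrD2l ltr_pM2r ?ltrD2r//.
have Ez : E (base z').
  apply/P_jump; have /andP[h5 h6] := base_itv z'.
  by have := base_itv z; rewrite zE => /andP[h7 h8]; lra.
by rewrite divr_gt0//; apply/w_gt0 => //; exact/E_b.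
Qed.

End Lift.

Let E_b_opp b : (forall x, E (x + b) <-> E x) -> forall x, E (x - b) <-> E x.
Proof. by move=> Eb x; rewrite -Eb subrK. Qed.

(** The slopes of [lift b] and [lift (- b)] on corresponding gaps are inverse to each other; off [E]
    the gap is a point. Allowing any [b] that preserves [E] gives the inverse of the Denjoy map in
    the same form. *)
Lemma liftK b : (forall x, E (x + b) <-> E x) -> cancel (lift b) (lift (- b)).
Proof.
move=> Eb z; rewrite {1}/lift base_lift// addrK.
rewrite (_ : lift b z - Pm (base z + b) =
  (z - Pm (base z)) * (w (base z + b) / w (base z))); last first.
  by rewrite /lift addrC addKr.
have /andP[h1 h2] := base_itv z.
have [Ez|Ez] := pselect (E (base z)); last first.
  have wz := w_eq0 Ez; rewrite wz mul0r mulr0 addr0.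
  by move: wz; rewrite /w; lra.
have /w_gt0 w0 := Ez; have /w_gt0 w1 : E (base z + b) by exact/Eb.
by field; rewrite !gt_eqF.
Qed.

Lemma lift_continuous b : (forall x, E (x + b) <-> E x) -> continuous (lift b).
Proof.
move=> Eb; apply: nondecreasing_dense_continuous.
  by move=> x y; rewrite le_eqVlt => /predU1P[->//|/(lift_homo Eb)/ltW].
move=> u v uv; exists (lift (- b) ((u + v) / 2)).
have /liftK := E_b_opp Eb; rewrite opprK => ->; apply/andP; split; lra.
Qed.

Let E_alphaN x : E (x - alpha) <-> E x. Proof. exact: E_b_opp. Qed.

Definition denjoy_map : circle R -> circle R := circle_map (lift alpha).
Definition denjoy_inverse : circle R -> circle R := circle_map (lift (- alpha)).

Lemma denjoy_mapE z : denjoy_map (to_circle z) = to_circle (lift alpha z).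
Proof. by apply: circle_mapE; exact: lift1. Qed.

Lemma denjoy_inverseE z : denjoy_inverse (to_circle z) = to_circle (lift (- alpha) z).
Proof. by apply: circle_mapE; exact: lift1. Qed.

Lemma denjoy_mapK : cancel denjoy_map denjoy_inverse.
Proof.
move=> c; rewrite -(to_circle_repr c) denjoy_mapE denjoy_inverseE.
by rewrite (liftK E_alpha).
Qed.

Lemma denjoy_inverseK : cancel denjoy_inverse denjoy_map.
Proof.
move=> c; rewrite -(to_circle_repr c) denjoy_inverseE denjoy_mapE.
by have /liftK := E_alphaN; rewrite opprK => ->.
Qed.

Lemma denjoy_map_homeomorphism : homeomorphism denjoy_map.
Proof.
exists denjoy_inverse; split.
- exact: denjoy_mapK.
- exact: denjoy_inverseK.
- by apply: circle_map_continuous; [exact: lift1|exact: lift_continuous].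
- by apply: circle_map_continuous; [exact: lift1|exact: lift_continuous].
Qed.

Lemma lift_of_denjoy_map : lift_of denjoy_map (lift alpha).
Proof.
split; [exact: lift_continuous|exact: lift_homo|exact: lift1|].
by move=> x; rewrite denjoy_mapE.
Qed.

(** [base] turns the lift into the translation by alpha and stays within 2 of the identity, so the
    error in the average displacement is bounded by a constant over n. *)
Lemma denjoy_map_rotation_number :
  is_rotation_number denjoy_map (to_circle alpha).
Proof.
exists (lift alpha), alpha; split=> //; first exact: lift_of_denjoy_map.
move=> z; have base_iter n : base (iter n (lift alpha) z) = base z + n%:R * alpha.
  elim: n => [|n IH]; first by rewrite mul0r addr0.
  by rewrite iterS base_lift// IH -natr1; lra.
apply/cvgrPdist_lt => e e0.
near=> n.
have n0 : 0 < n%:R :> R by rewrite ltr0n; near: n; exact: nbhs_infty_gt.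
have -> : alpha - iter n (lift alpha) z / n%:R =
    - (iter n (lift alpha) z - base (iter n (lift alpha) z) + base z) / n%:R.
  by rewrite base_iter; field; rewrite gt_eqF.
rewrite normrM normrN [X in _ * X]gtr0_norm ?invr_gt0// ltr_pdivrMr//.
rewrite (le_lt_trans (ler_normD _ _))//.
rewrite (@le_lt_trans _ _ (2 + `|base z|))// ?lerD2r ?base_near//.
rewrite -ltr_pdivrMl//; near: n; exact: nbhs_infty_gtr.
Unshelve. all: by end_near. Qed.

(** The complement of the open gaps; over a point outside [E] the two alternatives coincide. *)
Definition denjoy_points : set R := [set z | z = Pm (base z) \/ z = Pp (base z)].

Definition denjoy_minimal_points : set (circle R) := @to_circle R @` denjoy_points.

Local Notation M := denjoy_minimal_points.

Let mem_Pm x : denjoy_points (Pm x). Proof. by left; rewrite base_Pm. Qed.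
Let mem_Pp x : denjoy_points (Pp x). Proof. by right; rewrite base_Pp. Qed.

Lemma preimage_denjoy_minimal_points : @to_circle R @^-1` M = denjoy_points.
Proof.
apply/seteqP; split=> [z [z' Mz' /to_circleE[k z'E]]|z Mz]; last by exists z.
have base_z : base z' = base z + k%:~R.
  by rewrite z'E (degree_one_int _ base1).
have := Mz'; rewrite /denjoy_points/= base_z (degree_one_int _ Pm1)
  (degree_one_int _ Pp1) z'E.
by move=> [h|h]; [left|right]; lra.
Qed.

Lemma closed_denjoy_points : closed denjoy_points.
Proof.
rewrite -[X in closed X]setCK; apply: open_closedC.
rewrite (_ : ~` _ = \bigcup_(x in [set: R]) `]Pm x, Pp x[%classic).
  by apply: bigcup_open => x _; exact: interval_open.
apply/seteqP; split=> [z Mz|z [x _]].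
  exists (base z) => //=; rewrite in_itv/= !lt_neqAle.
  have /andP[-> ->] := base_itv z; rewrite !andbT.
  by apply/andP; split; apply/eqP => zE; apply: Mz; [left|right].
rewrite /= in_itv/= => /andP[h1 h2].
have bz : base z = x by apply: base_unique; rewrite !ltW.
by rewrite /denjoy_points/= bz => -[]; lra.
Qed.

Lemma closed_denjoy_minimal_points : closed M.
Proof.
apply/closed_circle; rewrite preimage_denjoy_minimal_points.
exact: closed_denjoy_points.
Qed.

Lemma lift_denjoy_points b z : (forall x, E (x + b) <-> E x) ->
  denjoy_points z -> denjoy_points (lift b z).
Proof.
by move=> Eb [->|->]; rewrite ?lift_Pm ?lift_Pp.
Qed.

Lemma denjoy_map_minimal_points : denjoy_map @` M = M.
Proof.
apply/seteqP; split=> [_ [_ [z Mz <-] <-]|_ [z Mz <-]].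
  by rewrite denjoy_mapE; exists (lift alpha z) => //; exact: lift_denjoy_points.
exists (to_circle (lift (- alpha) z)).
  by exists (lift (- alpha) z) => //; exact: lift_denjoy_points.
by rewrite -denjoy_inverseE denjoy_inverseK.
Qed.

(** Orbits of the rotation are dense, so [N] has points over every interval. This alone locates them
    only up to a gap: a left end [Pm x] is approached by points based just left of x, where [Pm] is
    left-continuous, and a right end from the other side. *)
Lemma minimal_denjoy_map : minimal_set denjoy_map M.
Proof.
split; [by exists (to_circle (Pm 0)), (Pm 0)|exact: closed_denjoy_minimal_points|
  exact: denjoy_map_minimal_points|].
move=> N [c0 Nc0] N_closed gN NM.
apply/seteqP; split=> // _ [z1 Mz1 <-].
have N_lift z : N (to_circle z) -> N (to_circle (lift alpha z)).
  by move=> Nz; rewrite -gN -denjoy_mapE; exists (to_circle z).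
have N_liftN z : N (to_circle z) -> N (to_circle (lift (- alpha) z)).
  rewrite -{1}gN => -[c Nc cz]; rewrite -denjoy_inverseE -cz.
  by rewrite denjoy_mapK.
pose x0 := base (repr c0).
have N_base (n m : int) :
    exists2 z, N (to_circle z) & base z = x0 + (n%:~R * alpha + m%:~R).
  suff [z Nz zE] : exists2 z, N (to_circle z) & base z = x0 + n%:~R * alpha.
    exists (z + m%:~R); first by rewrite to_circleDz.
    by rewrite (degree_one_int _ base1) zE addrA.
  elim/int_ind: n => [|n [z Nz zE]|n [z Nz zE]].
  - by exists (repr c0); rewrite ?to_circle_repr// mul0r addr0.
  - exists (lift alpha z); first exact: N_lift.
    by rewrite base_lift// zE -addn1 PoszD intrD; lra.
  - exists (lift (- alpha) z); first exact: N_liftN.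
    by rewrite base_lift// zE -addn1 PoszD opprD intrD; lra.
have N_between u v : u < v ->
    exists z, [/\ N (to_circle z), u < base z & base z < v].
  move=> uv; have [|n [m /andP[h1 h2]]] := dense_comb alpha_irr (_ : u - x0 < v - x0).
    by lra.
  by have [z Nz zE] := N_base n m; exists z; rewrite zE; split=> //; lra.
suff h e : 0 < e -> exists2 z, N (to_circle z) & `|z1 - z| < e.
  have /closed_circle N_closed' := N_closed.
  suff : closure (@to_circle R @^-1` N) z1 by rewrite -((closure_id _).1 N_closed').
  move=> B /nbhs_ballP[e /= e0 eB]; have [z Nz ze] := h e e0.
  by exists z; split => //; exact: eB.
move=> e0; case: Mz1 => z1E.
  have [d d0 dP] := Pm_left (base z1) e0.
  have [|z [Nz h1 h2]] := N_between (base z1 - d) (base z1); first by lra.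
  exists z => //; have /andP[h3 h4] := base_itv z.
  have := dP _ h1 h2; have := P_lt h2; rewrite -z1E => h5 h6.
  by rewrite ltr_distlC; apply/andP; split; lra.
have [d d0 dP] := Pp_right (base z1) e0.
have [|z [Nz h1 h2]] := N_between (base z1) (base z1 + d); first by lra.
exists z => //; have /andP[h3 h4] := base_itv z.
have := dP _ h1 h2; have := P_lt h1; rewrite -z1E => h5 h6.
by rewrite ltr_distlC; apply/andP; split; lra.
Qed.

(** The midpoint of a gap lies in the open complement of [M], which the orbit of a point of [M]
    never enters. *)
Lemma denjoy_map_not_minimal : E !=set0 ->
  ~ forall c, dense (full_orbit denjoy_map c).
Proof.
move=> [x /P_jump Ex] /(_ (to_circle (Pm x)) (~` M)) [].
- exists (to_circle ((Pm x + Pp x) / 2)).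
  move=> Mz.
  have : denjoy_points ((Pm x + Pp x) / 2).
    by rewrite -preimage_denjoy_minimal_points.
  have bz : base ((Pm x + Pp x) / 2) = x by apply: base_unique; lra.
  by rewrite /denjoy_points/= bz => -[]; lra.
- by rewrite openC; exact: closed_denjoy_minimal_points.
- move=> c [Mc [n nc]]; apply: Mc.
  have M0 : M (to_circle (Pm x)) by exists (Pm x).
  case: nc => [->|nc].
    elim: n {c} => //= n IH; rewrite -denjoy_map_minimal_points.
    by exists (iter n denjoy_map (to_circle (Pm x))).
  move: M0; rewrite nc; elim: n {nc} => //= n IH.
  rewrite -{1}denjoy_map_minimal_points => -[c' Mc'].
  by move=> /(can_inj denjoy_mapK) => cE; apply: IH; rewrite -cE.
Qed.

Lemma denjoy_example_map : E !=set0 -> denjoy_example denjoy_map.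
Proof.
move=> E0; split.
- exact: denjoy_map_homeomorphism.
- by eexists; exact: lift_of_denjoy_map.
- by exists alpha => //; exact: denjoy_map_rotation_number.
- exact: denjoy_map_not_minimal.
Qed.

(** * Symbolic models of the blown-up minimal set *)

Section SymbolicModel.
Context {code : R -> Sigma2}.
Hypotheses (E0 : E !=set0)
  (code1 : forall z, code (z + 1) = code z)
  (code_cont : {within denjoy_points, continuous code})
  (code_lift : forall z, denjoy_points z -> code (lift alpha z) = shift (code z))
  (code_inj : forall z z', denjoy_points z -> denjoy_points z' ->
    code z = code z' -> to_circle z = to_circle z').

Let codeE z : code (repr (to_circle z)) = code z.
Proof.
by have /to_circleE[k ->] := to_circle_repr (to_circle z); exact: periodicMz.
Qed.

Let kappa (c : circle R) : Sigma2 := code (repr c).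

Let kappa_closed (V : set Sigma2) : closed V -> closed (M `&` kappa @^-1` V).
Proof.
move=> V_closed; apply/closed_circle.
rewrite preimage_setI preimage_denjoy_minimal_points.
rewrite (_ : _ @^-1` (_ @^-1` V) = code @^-1` V); last first.
  by apply/seteqP; split=> z; rewrite /preimage/= /kappa codeE.
have /continuous_closedP /(_ V V_closed) := code_cont.
move=> /closed_subspaceP[W W_closed WV]; rewrite setIC -WV.
apply: closedI => //; exact: closed_denjoy_points.
Qed.

Let kappa_cont : {within M, continuous kappa}.
Proof.
apply/continuous_closedP => V V_closed; apply/closed_subspaceP.
exists (M `&` kappa @^-1` V); first exact: kappa_closed.
by rewrite setIAC setIid setIC.
Qed.

Let M_compact : compact M.
Proof.
apply: subclosed_compact compact_circle _ => //.
exact: closed_denjoy_minimal_points.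
Qed.

Let kappa_inj c c' : M c -> M c' -> kappa c = kappa c' -> c = c'.
Proof.
by move=> [z Mz <-] [z' Mz' <-]; rewrite /kappa !codeE; exact: code_inj.
Qed.

Let kappa_map c : M c -> kappa (denjoy_map c) = shift (kappa c).
Proof. by move=> [z Mz <-]; rewrite denjoy_mapE /kappa !codeE code_lift. Qed.

Let kappa_image : kappa @` M = code @` denjoy_points.
Proof.
apply/seteqP; split=> [_ [_ [z Mz <-] <-]|_ [z Mz <-]].
  by exists z => //; rewrite /kappa codeE.
by exists (to_circle z); [exists z|rewrite /kappa codeE].
Qed.

Definition symbolic_inverse (s : Sigma2) : circle R :=
  get [set c | M c /\ code (repr c) = s].

Let symbolic_inverseP c : M c -> symbolic_inverse (kappa c) = c.
Proof.
move=> Mc; rewrite /symbolic_inverse; case: xgetP => [c' _ [Mc' cc']|/(_ c)].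
  exact: kappa_inj.
by move=> /(_ (conj Mc erefl)).
Qed.

Lemma symbolic_inverse_code z : denjoy_points z ->
  symbolic_inverse (code z) = to_circle z.
Proof. by move=> Mz; rewrite -codeE symbolic_inverseP//; exists z. Qed.

(** A continuous injection of a compact space into a Hausdorff one is closed: the preimage of [N]
    under the inverse is the image of the compact set [M] intersected with [N]. *)
Lemma symbolic_inverse_continuous :
  {within code @` denjoy_points, continuous symbolic_inverse}.
Proof.
apply/continuous_closedP => N N_closed; apply/closed_subspaceP.
exists (kappa @` (M `&` N)).
  apply: compact_closed; first exact: hausdorff_Sigma2.
  apply: continuous_compact; first by apply: continuous_subspaceW kappa_cont => c [].
  apply: subclosed_compact M_compact _; last by move=> c [].
  by apply: closedI => //; exact: closed_denjoy_minimal_points.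
rewrite -kappa_image; apply/seteqP; split=> [s [[c [Mc Nc] cs] Ds]|s [Nc [c Mc cs]]].
  by split=> //; change (N (symbolic_inverse s)); rewrite -cs symbolic_inverseP.
move: Nc; change (N (symbolic_inverse s) -> (kappa @` (M `&` N) `&` kappa @` M) s).
by rewrite -cs symbolic_inverseP// => Nc; split; exists c.
Qed.

Lemma symbolic_denjoy_set :
  denjoy_minimal_set shift (to_circle alpha) (code @` denjoy_points).
Proof.
rewrite -kappa_image; split.
- exact: continuous_compact.
- apply/seteqP; split=> [_ [_ [c Mc <-] <-]|_ [c Mc <-]].
    exists (denjoy_map c); last exact: kappa_map.
    by rewrite -denjoy_map_minimal_points; exists c.
  move: Mc; rewrite -{1}denjoy_map_minimal_points => -[c' Mc' <-].
  by exists (kappa c'); [exists c'|rewrite kappa_map].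
exists denjoy_map, M; split.
- exact: denjoy_example_map.
- exact: denjoy_map_rotation_number.
- exact: minimal_denjoy_map.
exists symbolic_inverse, kappa; split; first split=> //.
- apply/seteqP; split=> [_ [_ [c Mc <-] <-]|c Mc].
    by rewrite symbolic_inverseP.
  by exists (kappa c); [exists c|rewrite symbolic_inverseP].
- by move=> _ [c Mc <-]; rewrite symbolic_inverseP.
- rewrite kappa_image; exact: symbolic_inverse_continuous.
- move=> _ [c Mc <-]; rewrite -kappa_map// !symbolic_inverseP//.
  by rewrite -denjoy_map_minimal_points; exists c.
Qed.

End SymbolicModel.

(* [A] and [Am] are the right-continuous and left-continuous versions of the
   indicator of a finite union of arcs; the code of a point of the minimal set
   reads [A] at right endpoints of gaps and [Am] at left endpoints. *)
Section OneSidedCoding.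
Context {A Am : R -> bool}.
Hypotheses (E0 : E !=set0)
  (A1 : forall x, A (x + 1) = A x) (Am1 : forall x, Am (x + 1) = Am x)
  (A_right : forall x, exists2 d, 0 < d & forall y, x < y -> y < x + d ->
    A y = A x /\ Am y = A x)
  (A_left : forall x, exists2 d, 0 < d & forall y, x - d < y -> y < x ->
    A y = Am x /\ Am y = Am x)
  (A_jump : forall x, A x != Am x -> E x)
  (E_jump : forall x, E x -> exists n : int,
    A (x + n%:~R * alpha) != Am (x + n%:~R * alpha))
  (A_aperiodic : forall u, (forall x, A (x + u) = A x) -> u \is a Num.int).

Definition one_sided_code (z : R) : Sigma2 := fun i =>
  (if z == Pp (base z) then A else Am) (base z + i%:~R * alpha).

Local Notation code := one_sided_code.

Let E_alphaz x (n : int) : E (x + n%:~R * alpha) <-> E x.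
Proof. by rewrite mulrzl (periodicMz (fun y => propext (E_alpha y))). Qed.

Lemma one_sided_code_Pp x i : code (Pp x) i = A (x + i%:~R * alpha).
Proof. by rewrite /code base_Pp eqxx. Qed.

Lemma one_sided_code_Pm x i : code (Pm x) i = Am (x + i%:~R * alpha).
Proof.
rewrite /code base_Pm; case: ifPn => [/eqP PmE|//].
apply/eqP; apply: contrapT => /negP /A_jump /E_alphaz /P_jump.
by rewrite PmE ltxx.
Qed.

Let A_jump_eq x i : ~ E x -> A (x + i%:~R * alpha) = Am (x + i%:~R * alpha).
Proof.
by move=> Ex; apply/eqP; apply: contrapT => /negP /A_jump /E_alphaz.
Qed.

Let code_cases z i : denjoy_points z ->
  (z = Pp (base z) /\ code z i = A (base z + i%:~R * alpha)) \/
  (z = Pm (base z) /\ code z i = Am (base z + i%:~R * alpha)).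
Proof.
move=> [zE|zE]; [right|left]; split=> //; rewrite {1}zE.
  exact: one_sided_code_Pm.
exact: one_sided_code_Pp.
Qed.

Lemma one_sided_code1 z : code (z + 1) = code z.
Proof.
apply/funext => i; rewrite /code base1 Pp1 (inj_eq (addIr 1)) addrAC.
by case: ifP.
Qed.

Lemma one_sided_code_lift z : denjoy_points z ->
  code (lift alpha z) = shift (code z).
Proof.
move=> Mz; apply/funext => i; rewrite /Defs.shift.
case: Mz => ->.
  by rewrite lift_Pm// !one_sided_code_Pm intrD; congr Am; ring.
by rewrite lift_Pp// !one_sided_code_Pp intrD; congr A; ring.
Qed.

Lemma one_sided_code_continuous : {within denjoy_points, continuous code}.
Proof.
apply/subspace_continuousP => z Mz.
apply: cvg_Sigma2 => i.
suff : \forall z' \near (z : R), denjoy_points z' -> code z' i = code z i.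
  by rewrite near_withinE.
set x := base z.
have [dr dr0 Ar] := A_right (x + i%:~R * alpha).
have [dl dl0 Al] := A_left (x + i%:~R * alpha).
have right z' : denjoy_points z' -> x < base z' -> base z' < x + dr ->
    code z' i = A (x + i%:~R * alpha).
  move=> Mz' h1 h2; have [] := Ar (base z' + i%:~R * alpha); [lra|lra|].
  by case: (code_cases i Mz') => -[_ ->].
have left z' : denjoy_points z' -> x - dl < base z' -> base z' < x ->
    code z' i = Am (x + i%:~R * alpha).
  move=> Mz' h1 h2; have [] := Al (base z' + i%:~R * alpha); [lra|lra|].
  by case: (code_cases i Mz') => -[_ ->].
have upper : \forall z' \near (z : R), base z' < x + dr.
  have /cvgrPdist_lt /(_ _ dr0) := @base_continuous (z : R).
  by apply: filterS => z'; rewrite ltr_distlC -/x => /andP[].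
have lower : \forall z' \near (z : R), x - dl < base z'.
  have /cvgrPdist_lt /(_ _ dl0) := @base_continuous (z : R).
  by apply: filterS => z'; rewrite ltr_distlC -/x => /andP[].
(* Off [E] the values of [A] and [Am] at the point read agree, so approaching from either side gives
   the same symbol. *)
have [Ex|Ex] := pselect (E x); last first.
  near=> z' => Mz'; have AAm := A_jump_eq i Ex.
  have -> : code z i = A (x + i%:~R * alpha).
    by case: (code_cases i Mz) => -[_ ->].
  have [h|h|h] := ltgtP x (base z').
  - by apply: right => //; near: z'.
  - by rewrite AAm; apply: left => //; near: z'.
  - by case: (code_cases i Mz') => -[_ ->]; rewrite -h.
have /P_jump PmPp := Ex.
(* Inside the minimal set an end of a gap is accumulated only from outside the gap: points near
   [Pp x] exceed [Pm x], so their base is x or larger, and symmetrically at [Pm x]. *)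
have [[zE ->]|[zE ->]] := code_cases i Mz; rewrite -/x in zE *.
  near=> z' => Mz'.
  have zz' : Pm x < z' by near: z'; apply: lt_nbhsr; rewrite zE.
  have [h|h|h] := ltgtP x (base z').
  - by apply: right => //; near: z'.
  - by have := P_lt h; have /andP[] := base_itv z'; lra.
  - case: (code_cases i Mz') => -[z'E ->]; rewrite -h// in z'E *.
    by move: zz'; rewrite z'E ltxx.
near=> z' => Mz'.
have zz' : z' < Pp x by near: z'; apply: lt_nbhsl; rewrite zE.
have [h|h|h] := ltgtP x (base z').
- by have := P_lt h; have /andP[] := base_itv z'; lra.
- by apply: left => //; near: z'.
- case: (code_cases i Mz') => -[z'E ->]; rewrite -h// in z'E *.
  by move: zz'; rewrite z'E ltxx.
Unshelve. all: by end_near. Qed.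

Let A_int x (k : int) : A (x + k%:~R) = A x.
Proof. exact: periodicMz. Qed.

Let Am_int x (k : int) : Am (x + k%:~R) = Am x.
Proof. exact: periodicMz. Qed.

Let code_int z (k : int) : code (z + k%:~R) = code z.
Proof. exact/periodicMz/one_sided_code1. Qed.

(** Equal codes make the difference of the bases a period of [A], hence an integer. The points could
    then differ only as the two ends of one gap, which [E_jump] distinguishes at some coordinate. *)
Lemma one_sided_code_inj z z' : denjoy_points z -> denjoy_points z' ->
  code z = code z' -> to_circle z = to_circle z'.
Proof.
move=> Mz Mz' zz'.
have /intrP[k uE] : base z' - base z \is a Num.int.
  set u := base z' - base z.
  apply: A_aperiodic => x.
  have [d d0 Ax] := A_right x; have [d' d'0 Axu] := A_right (x + u).
  (* One time n brings both bases just to the right of x and of x + u. There [A] and [Am] agree, so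
     it does not matter which of them the codes read. *)
  have [|n [m /andP[h1 h2]]] := dense_comb alpha_irr
    (_ : x - base z < x + Num.min d d' - base z).
    by rewrite ltrD2r ltrDl lt_min d0 d'0.
  have h3 : base z + n%:~R * alpha + m%:~R < x + d.
    have : Num.min d d' <= d by rewrite ge_min lexx. lra.
  have h4 : base z' + n%:~R * alpha + m%:~R < x + u + d'.
    have : Num.min d d' <= d' by rewrite ge_min lexx orbT. rewrite /u; lra.
  have e1 : code z n = A x.
    have [] := Ax (base z + n%:~R * alpha + m%:~R); [lra|lra|].
    by rewrite A_int Am_int; case: (code_cases n Mz) => -[_ ->].
  have e2 : code z' n = A (x + u).
    have [] := Axu (base z' + n%:~R * alpha + m%:~R); [rewrite /u; lra|lra|].
    by rewrite A_int Am_int; case: (code_cases n Mz') => -[_ ->].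
  by rewrite -e1 -e2 zz'.
have {}uE : base z' = base z + k%:~R by rewrite -uE addrC subrK.
have same : Pm (base z) < Pp (base z) -> code (Pm (base z)) <> code (Pp (base z)).
  move=> /P_jump /E_jump[n /negP An] eqc; apply: An.
  by rewrite -one_sided_code_Pp -eqc one_sided_code_Pm.
have [PP|/same {}same] := leP (Pp (base z)) (Pm (base z)).
  apply/esym/to_circleE; exists k.
  have PE : Pp (base z) = Pm (base z) by apply/eqP; rewrite eq_le PP Pmp.
  case: Mz Mz' => [->|->] [->|->]; rewrite uE ?(degree_one_int _ Pm1)
    ?(degree_one_int _ Pp1) ?base_Pm ?base_Pp; lra.
apply/esym/to_circleE; exists k.
case: Mz Mz' => zE [] z'E; rewrite uE ?(degree_one_int _ Pm1)
    ?(degree_one_int _ Pp1) in z'E.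
- by rewrite z'E [in RHS]zE.
- by exfalso; apply: same; rewrite -zE zz' z'E code_int.
- by exfalso; apply: same; rewrite -zE zz' z'E code_int.
- by rewrite z'E [in RHS]zE.
Qed.

Lemma one_sided_denjoy_set :
  denjoy_minimal_set shift (to_circle alpha) (code @` denjoy_points).
Proof.
apply: symbolic_denjoy_set => //.
- exact: one_sided_code1.
- exact: one_sided_code_continuous.
- exact: one_sided_code_lift.
- exact: one_sided_code_inj.
Qed.

Definition right_code (t : R) : borel_Sigma2 :=
  (fun i => A (t + i%:~R * alpha)) : Sigma2.

Lemma right_code_mem t : (code @` denjoy_points) (right_code t).
Proof.
exists (Pp t); first exact: mem_Pp.
by apply/funext => i; rewrite one_sided_code_Pp.
Qed.

(** Collapsing the gaps gives the factor onto the rotation. Right and left readings differ only over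
    the countable set [E], so [right_code] alone computes the measure. *)
Lemma one_sided_measure (mu : probability borel_Sigma2 R)
    (X : set borel_Sigma2) :
  countable E -> measurable_fun setT right_code ->
  @invariant_measures R mu -> mu (code @` denjoy_points) = 1%E ->
  measurable X ->
  mu X = lebesgue_measure (`[0, 1[%classic `&` right_code @^-1` X).
Proof.
move=> E_countable mcode mu_inv muD mX.
have [D_compact D_shift _] := one_sided_denjoy_set.
pose inv := symbolic_inverse (code := code).
have invE z : denjoy_points z -> inv (code z) = to_circle z.
  move=> Mz; apply: symbolic_inverse_code => //; first exact: one_sided_code1.
  exact: one_sided_code_inj.
pose theta s := circle_map base (inv s).
have thetaE z : denjoy_points z -> theta (code z) = to_circle (base z).
  by move=> Mz; rewrite /theta invE// circle_mapE//; exact: base1.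
apply: (@invariant_measureE R alpha alpha_irr (code @` denjoy_points) theta
  _ _ _ _ mu _ _ E) => //.
- exact: compact_closed hausdorff_Sigma2 _.
- move=> s; apply: (@continuous_comp (subspace _) (circle R) (circle R) inv
    (circle_map base)).
    apply: symbolic_inverse_continuous; [exact: one_sided_code1|
      exact: one_sided_code_continuous|exact: one_sided_code_inj].
  by apply: circle_map_continuous; [exact: base1|exact: base_continuous].
- move=> _ [z Mz <-]; rewrite -one_sided_code_lift// !thetaE//.
    by rewrite base_lift// to_circleD.
  exact: lift_denjoy_points.
- move=> _ [z Mz <-]; rewrite thetaE// angle_to_circle => Ez.
  have {}Ez : ~ E (base z - (Num.floor (base z))%:~R) by [].
  have zE : Pp (base (z - (Num.floor (base z))%:~R)) = z - (Num.floor (base z))%:~R.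
    have := Mz; rewrite -intrN (degree_one_int _ base1) (degree_one_int _ Pp1).
    rewrite -(degree_one_int _ Pp1) intrN.
    have PE : Pp (base z - (Num.floor (base z))%:~R) =
        Pm (base z - (Num.floor (base z))%:~R).
      by apply/eqP; rewrite eq_le Pmp andbT leNgt; apply/negP => /P_jump.
    move=> [->|->]; last by rewrite base_Pp -intrN (degree_one_int _ Pp1).
    rewrite base_Pm; move: PE.
    rewrite -intrN !(degree_one_int _ Pp1, degree_one_int _ Pm1); lra.
  rewrite /frac -(code_int _ (- Num.floor (base z))) intrN -zE.
  apply/funext => i; rewrite one_sided_code_Pp /right_code.
  by rewrite -intrN (degree_one_int _ base1).
Qed.

End OneSidedCoding.
End DenjoyConstruction.

(** * Finite unions of arcs and their Denjoy minimal sets *)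

Section ArcMeasure.
Context {R : realType}.
Implicit Types (c l : R).

Lemma measurable_arc c l : measurable [set t : R | frac (t - c) < l].
Proof.
have [l1|l1] := leP l 1; last first.
  rewrite (_ : [set _ | _] = setT)//; apply/seteqP; split=> // t _ /=.
  exact: lt_trans (frac_lt1 _) l1.
rewrite (_ : [set _ | _] =
  \bigcup_(n in [set: int]) `[c + n%:~R, c + n%:~R + l[%classic).
  exact: countable_bigcupT_measurable.
apply/seteqP; split=> [t /= tl|t [n _ /=]].
  exists (Num.floor (t - c)) => //=; rewrite in_itv/=.
  by have := frac_ge0 (t - c); move: tl; rewrite /frac; lra.
rewrite in_itv/= => /andP[h1 h2]; rewrite /frac (@floor_def _ _ n); first by lra.
by rewrite intrD; lra.
Qed.

Lemma lebesgue_measure_arc c l : 0 < l <= 1 ->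
  lebesgue_measure (`[0, 1[%classic `&` [set t : R | frac (t - c) < l]) = l%:E.
Proof.
move=> /andP[l0 l1].
have := @lebesgue_measure_circle_translation R [set t | frac (t - 0) < l] (- c)
  (measurable_arc 0 l).
rewrite (_ : _ @^-1` _ = [set t | frac (t - c) < l]); last first.
  by apply/seteqP; split=> t /=; rewrite subr0.
move=> ->; last by move=> x /=; rewrite addrAC (fracDz _ 1).
rewrite (_ : _ `&` _ = `[0, l[%classic).
  by rewrite lebesgue_measure_itv/= lte_fin l0 -EFinB subr0.
apply/seteqP; split=> t /=; rewrite !in_itv/= subr0.
  by move=> [t01]; rewrite frac_id//; lra.
by move=> tl; rewrite frac_id; lra.
Qed.

End ArcMeasure.

Section ArcFamily.
Context {R : realType} {alpha : R}.
Hypothesis alpha_irr : irrational alpha.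
Context {I : finType} {o : I} {k : I -> int} {len : I -> R}.
Hypotheses (len_gt0 : forall i, 0 < len i) (len_lt : forall i, i != o -> len i < len o)
  (len_o_lt1 : len o < 1)
  (k_sep : forall i j, i != j -> len o < frac ((k i - k j)%:~R * alpha)).

(** By [k_sep], used for both orders of i and j, the left endpoints are more than [len o] apart, so
    the arcs are disjoint. The strictly longest arc [o] serves to break periodicity. *)
Definition arcs (x : R) : bool := [exists i, frac (x - (k i)%:~R * alpha) < len i].

Definition arcs_left (x : R) : bool :=
  [exists i, 0 < frac (x - (k i)%:~R * alpha) <= len i].

Let len_le i : len i <= len o.
Proof. by have [->//|/len_lt/ltW] := eqVneq i o. Qed.

Let len_lt1 i : len i < 1. Proof. exact: le_lt_trans (len_le i) len_o_lt1. Qed.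

Let frac_add (x d : R) : 0 <= frac x + d < 1 -> frac (x + d) = frac x + d.
Proof.
move=> h; rewrite -[RHS]frac_id// -[LHS](fracDz _ (- Num.floor x)).
by congr frac; rewrite /frac intrN; ring.
Qed.

Let common_radius (P : I -> R -> Prop) :
  (forall i, exists2 d, 0 < d & P i d) ->
  (forall i d d', 0 < d' <= d -> P i d -> P i d') ->
  exists2 d, 0 < d & forall i, P i d.
Proof.
move=> hP mono.
have [d dP] := choice (fun i => let: ex_intro2 d d0 h := hP i in
  ex_intro (fun d => 0 < d /\ P i d) d (conj d0 h)).
suff [r r0 rP] : exists2 r, 0 < r & forall i, r <= d i.
  by exists r => // i; apply: (mono i (d i)); [rewrite r0 rP|case: (dP i)].
suff [r r0 rP] : exists2 r, 0 < r & forall i, i \in enum I -> r <= d i.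
  by exists r => // i; apply: rP; rewrite mem_enum.
elim: (enum I) => [|i s [r r0 rP]]; first by exists 1.
exists (Num.min r (d i)); first by rewrite lt_min r0; case: (dP i) => ->.
move=> j; rewrite inE => /predU1P[->|js]; first by rewrite ge_min lexx orbT.
by rewrite ge_min rP.
Qed.

Lemma arcsD1 x : arcs (x + 1) = arcs x.
Proof. by apply: eq_existsb => i; rewrite addrAC (fracDz _ 1). Qed.

Lemma arcs_leftD1 x : arcs_left (x + 1) = arcs_left x.
Proof. by apply: eq_existsb => i; rewrite addrAC (fracDz _ 1). Qed.

Lemma arcs_right_cst x : exists2 d, 0 < d & forall y, x < y -> y < x + d ->
  arcs y = arcs x /\ arcs_left y = arcs x.
Proof.
pose f i y := frac (y - (k i)%:~R * alpha).
have [d d0 dP] : exists2 d, 0 < d & forall i, forall y, x < y -> y < x + d ->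
    (f i y < len i) = (f i x < len i) /\ (0 < f i y <= len i) = (f i x < len i).
  apply: (@common_radius (fun i d => forall y, x < y -> y < x + d ->
    (f i y < len i) = (f i x < len i) /\ (0 < f i y <= len i) = (f i x < len i))).
    move=> i; have f0 : 0 <= f i x := frac_ge0 _; have f1 : f i x < 1 := frac_lt1 _.
    have l1 := len_lt1 i.
    have fy y : 0 <= f i x + (y - x) < 1 -> f i y = f i x + (y - x).
      by move=> h; rewrite -frac_add//; congr frac; ring.
    have [h|h] := ltP (f i x) (len i).
      exists (len i - f i x); first by lra.
      by move=> y xy yd; rewrite fy; last lra; split; lra.
    exists (1 - f i x); first by lra.
    by move=> y xy yd; rewrite fy; last lra; split; [apply/negP|apply/negP]; lra.
  by move=> i d d' /andP[d'0 d'd] h y xy yd; apply: h => //; lra.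
exists d => // y xy yd; split; apply: eq_existsb => i;
  by have [] := dP i y xy yd.
Qed.

Lemma arcs_left_cst x : exists2 d, 0 < d & forall y, x - d < y -> y < x ->
  arcs y = arcs_left x /\ arcs_left y = arcs_left x.
Proof.
pose f i y := frac (y - (k i)%:~R * alpha).
have [d d0 dP] : exists2 d, 0 < d & forall i, forall y, x - d < y -> y < x ->
    (f i y < len i) = (0 < f i x <= len i) /\
    (0 < f i y <= len i) = (0 < f i x <= len i).
  apply: (@common_radius (fun i d => forall y, x - d < y -> y < x ->
    (f i y < len i) = (0 < f i x <= len i) /\
    (0 < f i y <= len i) = (0 < f i x <= len i))).
    move=> i; have f0 : 0 <= f i x := frac_ge0 _; have f1 : f i x < 1 := frac_lt1 _.
    have l1 := len_lt1 i; have l0 := len_gt0 i.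
    have fy y : 0 <= f i x + (y - x) < 1 -> f i y = f i x + (y - x).
      by move=> h; rewrite -frac_add//; congr frac; ring.
    (* When x is itself a left endpoint, the fractional part jumps: just before x it is close to 1,
       beyond the length of the arc. *)
    have fy1 y : f i x = 0 -> 0 <= 1 + (y - x) < 1 -> f i y = 1 + (y - x).
      move=> fx h; rewrite /f -(fracDz _ 1).
      rewrite (_ : y - _ + _ = x - (k i)%:~R * alpha + (1 + (y - x))).
        by rewrite frac_add -/(f i x) fx ?add0r.
      by rewrite (_ : 1%:~R = 1)//; ring.
    have [h|h] := ltP (len i) (f i x).
      exists (f i x - len i); first by lra.
      by move=> y xy yd; rewrite fy; last lra; split; lra.
    have [fx0|fx0] := eqVneq (f i x) 0.
      exists (1 - len i); first by lra.
      by move=> y xy yd; rewrite fy1//; last lra; split; lra.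
    have {}fx0 : 0 < f i x by rewrite lt_neqAle eq_sym fx0.
    exists (f i x); first by lra.
    by move=> y xy yd; rewrite fy; last lra; split; lra.
  by move=> i d d' /andP[d'0 d'd] h y xy yd; apply: h => //; lra.
exists d => // y xy yd; split; apply: eq_existsb => i;
  by have [] := dP i y xy yd.
Qed.

(* Orbits of the arc endpoints: [None] stands for the common orbit of the left
   endpoints. *)
Definition endpoint (p : option I * int) : R :=
  (if p.1 is Some i then len i else 0) + p.2%:~R * alpha.

(** The default pair encodes the endpoint 0, so it adds no new point. Repetitions, which occur when
    lengths are related modulo Z alpha + Z, only enlarge the corresponding gaps. *)
Definition endpoint_seq (j : nat) : R :=
  frac (endpoint (odflt (None, 0) (unpickle j))).

Definition endpoints : set R := [set x | exists j, x - endpoint_seq j \is a Num.int].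

Lemma endpoint_seq_le1 j : `|endpoint_seq j| <= 1.
Proof. by rewrite ger0_norm ?frac_ge0// ltW// frac_lt1. Qed.

Lemma endpointsP x : endpoints x <-> exists p (n : int), x = endpoint p + n%:~R.
Proof.
split=> [[j /intrP[n xE]]|[p [n xE]]].
  exists (odflt (None, 0) (unpickle j)).
  exists (n - Num.floor (endpoint (odflt (None, 0) (unpickle j)))).
  by move: xE; rewrite /endpoint_seq /frac intrB; lra.
exists (pickle p); apply/intrP; exists (n + Num.floor (endpoint p)).
by rewrite /endpoint_seq pickleK/= xE /frac intrD; lra.
Qed.

Lemma endpoints_alpha x : endpoints (x + alpha) <-> endpoints x.
Proof.
rewrite !endpointsP; split=> -[[p n] [m xE]].
  by exists (p, n - 1), m; move: xE; rewrite /endpoint/= intrB; lra.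
by exists (p, n + 1), m; move: xE; rewrite /endpoint/= intrD; lra.
Qed.

Lemma endpoints_countable : countable endpoints.
Proof.
apply: (@sub_countable _ _ _
    ((fun p : (option I * int) * int => endpoint p.1 + p.2%:~R) @` setT)).
  by apply: subset_card_le => x /endpointsP[p [n ->]]; exists (p, n).
by apply: sub_countable (card_image_le _ _) _.
Qed.

Lemma endpoints_neq0 : endpoints !=set0.
Proof. by exists 0; apply/endpointsP; exists (None, 0), 0; rewrite /endpoint/=; lra. Qed.

Lemma arcs_jump x : arcs x != arcs_left x -> endpoints x.
Proof.
apply: contraPP => Ex; apply/negP/negPn/eqP; apply: eq_existsb => i.
have f0 := frac_ge0 (x - (k i)%:~R * alpha).
have fne c p : endpoint p = c + (k i)%:~R * alpha -> frac (x - (k i)%:~R * alpha) != c.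
  move=> pE; apply/eqP => fx; apply: Ex; apply/endpointsP.
  exists p, (Num.floor (x - (k i)%:~R * alpha)); rewrite pE -fx /frac; lra.
have := fne 0 (None, k i) erefl; have := fne (len i) (Some i, k i) erefl.
set f := frac _ in f0 * => h1 h2.
have -> : 0 < f by rewrite lt_neqAle eq_sym h2.
by rewrite le_eqVlt (negbTE h1).
Qed.

Let frac_sep i j (r : R) : i != j -> 0 <= r -> r <= len o ->
  len o < frac ((k i)%:~R * alpha + r - (k j)%:~R * alpha).
Proof.
move=> ij r0 rl; have := k_sep ij; have := k_sep (_ : j != i).
rewrite eq_sym ij => /(_ isT).
set n := (k i - k j)%:~R * alpha.
have -> : (k j - k i)%:~R * alpha = - n by rewrite /n !intrB; ring.
have -> : (k i)%:~R * alpha + r - (k j)%:~R * alpha = n + r.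
  by rewrite /n intrB; ring.
(* Separation in the other order bounds [frac n] by 1 - [len o], so adding [r] does not wrap
   around. *)
move=> h1 h2; have fN : frac (- n) = 1 - frac n.
  rewrite -(fracDz _ (1 + Num.floor n)) intrD.
  rewrite (_ : - n + _ = 1 - frac n); last by rewrite /frac; ring.
  by rewrite frac_id//; have := frac_lt1 n; lra.
rewrite fN in h1; rewrite frac_add; lra.
Qed.

Let frac_self i (r : R) : 0 <= r < 1 ->
  frac ((k i)%:~R * alpha + r - (k i)%:~R * alpha) = r.
Proof. by move=> r01; rewrite addrAC subrr add0r frac_id. Qed.

Lemma arcs_right_endpoint i : arcs ((k i)%:~R * alpha + len i) = false.
Proof.
apply/negbTE/negP; rewrite /arcs => /existsP[j]; have [<-|ij] := eqVneq i j.
  by rewrite frac_self ?ltxx// len_lt1 ltW.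
by have := frac_sep ij (ltW (len_gt0 i)) (len_le i); have := len_le j; lra.
Qed.

Lemma arcs_left_right_endpoint i : arcs_left ((k i)%:~R * alpha + len i).
Proof.
rewrite /arcs_left; apply/existsP; exists i.
by rewrite frac_self ?lexx ?len_gt0//= len_lt1 ltW.
Qed.

Lemma arcs_arc i (r : R) : 0 <= r < len i -> arcs ((k i)%:~R * alpha + r).
Proof.
move=> /andP[r0 rl]; rewrite /arcs; apply/existsP; exists i; rewrite frac_self//.
by rewrite r0 (lt_trans rl).
Qed.

Lemma arcs_left_left_endpoint : arcs_left ((k o)%:~R * alpha) = false.
Proof.
apply/negbTE/negP; rewrite /arcs_left => /existsP[j]; rewrite -[(k o)%:~R * alpha]addr0.
have [<-|ij] := eqVneq o j; first by rewrite frac_self ?ltxx// lexx ltr01.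
by have := frac_sep ij (lexx 0) (ltW (len_gt0 o)); have := len_le j; lra.
Qed.

Let arcs_int x (n : int) : arcs (x + n%:~R) = arcs x.
Proof. exact/periodicMz/arcsD1. Qed.

Let arcs_left_int x (n : int) : arcs_left (x + n%:~R) = arcs_left x.
Proof. exact/periodicMz/arcs_leftD1. Qed.

(** Every endpoint orbit meets an actual end of an arc, where no other arc interferes: the right end
    of arc i for the orbit of [len i], and the left end of arc [o] for the common orbit of the left
    ends. *)
Lemma endpoints_jump x : endpoints x -> exists n : int,
  arcs (x + n%:~R * alpha) != arcs_left (x + n%:~R * alpha).
Proof.
move=> /endpointsP[[[i|] n] [m ->]]; rewrite /endpoint/=.
  exists (k i - n).
  rewrite (_ : _ + _ = (k i)%:~R * alpha + len i + m%:~R); last first.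
    by rewrite intrB; ring.
  by rewrite arcs_int arcs_left_int arcs_right_endpoint arcs_left_right_endpoint.
exists (k o - n).
rewrite (_ : _ + _ = (k o)%:~R * alpha + 0 + m%:~R); last first.
  by rewrite intrB; ring.
rewrite arcs_int arcs_left_int arcs_arc ?lexx ?len_gt0//.
by rewrite addr0 arcs_left_left_endpoint.
Qed.

(** A period carries the left end of the longest arc to a point at offset [f] in some arc i. Unless
    i = o and f = 0, less than [len o] remains of arc i, so a point still inside arc [o] is carried
    to the right end of arc i, outside all arcs. *)
Lemma arcs_aperiodic u : (forall x, arcs (x + u) = arcs x) -> u \is a Num.int.
Proof.
move=> per.
have := per ((k o)%:~R * alpha + 0); rewrite arcs_arc ?lexx ?len_gt0//.
rewrite addr0 /arcs => /existsP[i]; set f := frac _ => fi.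
have f0 : 0 <= f := frac_ge0 _.
have [->//|h] : u \is a Num.int \/ len i - f < len o.
  have [io|io] := eqVneq i o; last by right; have := len_lt io; lra.
  have [fE|fE] := eqVneq f 0.
    left; move: fE; rewrite /f io addrAC subrr add0r /frac => /eqP.
    by rewrite subr_eq0 => /eqP ->; exact: intr_int.
  by right; rewrite io ltrBlDr ltrDl lt_neqAle eq_sym fE.
have := per ((k o)%:~R * alpha + (len i - f)).
rewrite (arcs_arc (i := o)); last by rewrite subr_ge0 ltW.
rewrite (_ : _ + u = (k i)%:~R * alpha + len i +
    (Num.floor ((k o)%:~R * alpha + u - (k i)%:~R * alpha))%:~R).
  by rewrite arcs_int arcs_right_endpoint.
by rewrite /f /frac; ring.
Qed.

Definition arcs_set : set Sigma2 :=
  @one_sided_code R (jump_left endpoint_seq) (jump_right endpoint_seq) alpha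
    arcs arcs_left @`
  denjoy_points (Pm := jump_left endpoint_seq) (Pp := jump_right endpoint_seq).

Definition arcs_code : R -> borel_Sigma2 := right_code (alpha := alpha) (A := arcs).

Lemma arcs_code_mem t : arcs_set (arcs_code t).
Proof.
apply: right_code_mem.
- by move=> x; apply: jump_left_right; exact: endpoint_seq_le1.
- by move=> x y; apply: jump_mono; exact: endpoint_seq_le1.
- by move=> x; apply: jump_left_ge; exact: endpoint_seq_le1.
- by move=> x; apply: jump_right_le; exact: endpoint_seq_le1.
- by move=> x e; apply: jump_left_cvg; exact: endpoint_seq_le1.
- by move=> x e; apply: jump_right_cvg; exact: endpoint_seq_le1.
Qed.

Lemma denjoy_arcs_set : denjoy_minimal_set shift (to_circle alpha) arcs_set.
Proof.
have e1 := endpoint_seq_le1.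
apply: (one_sided_denjoy_set (E := endpoints) alpha_irr (jump_leftD1 e1)
  (jump_rightD1 e1) (jump_left_right e1) (jump_lt e1) (jump_mono e1)
  (jump_left_ge e1) (jump_right_le e1)
  (fun x eps => @jump_left_cvg R endpoint_seq x eps e1)
  (jump_right_cvg e1) endpoints_alpha endpoints_neq0).
- exact: arcsD1.
- exact: arcs_leftD1.
- exact: arcs_right_cst.
- exact: arcs_left_cst.
- exact: arcs_jump.
- exact: endpoints_jump.
- exact: arcs_aperiodic.
Qed.

Lemma arcs_code_measurable : measurable_fun setT arcs_code.
Proof.
apply: measurable_fun_Sigma2 => i.
rewrite (_ : [set _ | _] = \bigcup_(j in [set: I])
    [set t | frac (t - ((k j)%:~R * alpha - i%:~R * alpha)) < len j]).
  by apply: countable_bigcupT_measurable => // j; exact: measurable_arc.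
apply/seteqP; split=> [t /existsP[j]|t [j _ /= h]].
  by exists j => //=; rewrite opprB addrA.
by apply/existsP; exists j; move: h; rewrite opprB addrA.
Qed.

Lemma unique_measure_arcs (X : set borel_Sigma2) : measurable X ->
  (unique_measure R arcs_set : probability borel_Sigma2 R) X =
  lebesgue_measure (`[0, 1[%classic `&` arcs_code @^-1` X).
Proof.
move=> mX; have e1 := endpoint_seq_le1.
have [mu_inv muD] := denjoy_unique_measureP alpha_irr denjoy_arcs_set.
apply: (one_sided_measure (E := endpoints) alpha_irr (jump_leftD1 e1)
  (jump_rightD1 e1) (jump_left_right e1) (jump_lt e1) (jump_mono e1)
  (jump_left_ge e1) (jump_right_le e1)
  (fun x eps => @jump_left_cvg R endpoint_seq x eps e1)
  (jump_right_cvg e1) endpoints_alpha endpoints_neq0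
  arcsD1 arcs_leftD1 arcs_right_cst arcs_left_cst arcs_jump endpoints_jump
  arcs_aperiodic endpoints_countable arcs_code_measurable mu_inv muD mX).
Qed.

End ArcFamily.

(** * Weak convergence of measures carried by codes *)

Section WeakContinuity.
Context {R : realType}.
Local Notation leb := (@lebesgue_measure R).

Lemma continuous_Sigma2_bounded (f : Sigma2 -> R) : continuous f ->
  exists C, forall s, `|f s| <= C.
Proof.
move=> fc.
have : compact (range f).
  by apply: continuous_compact compact_Sigma2; exact: continuous_subspaceT.
move=> /compact_bounded[C [_ hC]]; exists (C + 1) => s.
by apply: (hC (C + 1)); [rewrite ltrDl|exists s].
Qed.

Lemma continuous_Sigma2_measurable (f : Sigma2 -> R) : continuous f ->
  measurable_fun setT (f : borel_Sigma2 -> R).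
Proof.
move=> /continuousP fc.
apply: (measurability _ (measurable_realfun.RGenOpens.measurableE R)).
move=> _ [_ [a [b ->]] <-]; rewrite setTI.
apply: measurable_open_Sigma2; exact: fc.
Qed.

Local Notation m0 := (mrestr leb (measurable_itv `[(0 : R), 1[)).

Let m0_fin : (m0 setT < +oo)%E.
Proof.
rewrite /mrestr setTI lebesgue_measure_itv/= lte_fin ltr01 -EFinB.
exact: ltry.
Qed.

Let integrable_comp (f : Sigma2 -> R) (c : R -> borel_Sigma2) :
  continuous f -> measurable_fun setT c ->
  m0.-integrable setT (EFin \o (f \o c)).
Proof.
move=> fc mc; apply: measurable_bounded_integrable => //.
  by apply: measurableT_comp => //; exact: continuous_Sigma2_measurable.
have [C fC] := continuous_Sigma2_bounded fc.
exists C; split; first exact: num_real.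
by move=> x Cx t _; rewrite /= (le_trans (fC _))// ltW.
Qed.

Lemma Rintegral_code (mu : probability borel_Sigma2 R) (c : R -> borel_Sigma2)
    (f : Sigma2 -> R) : continuous f -> measurable_fun setT c ->
  (forall X, measurable X -> mu X = leb (`[0, 1[%classic `&` c @^-1` X)) ->
  \int[mu]_(s in setT) f s = fine (\int[m0]_(t in setT) (f (c t))%:E)%E.
Proof.
move=> fc mc muE; rewrite /Rintegral.
have mf := continuous_Sigma2_measurable fc.
congr fine.
transitivity (\int[measure_function_pushforward__canonical__measure_function_Measure
    m0 mc]_(s in setT) (f s)%:E)%E.
  apply: eq_measure_integral => X mX _.
  transitivity (leb (`[0%R, 1%R[%classic `&` c @^-1` X)); first exact: muE.
  by rewrite /= /pushforward /mrestr setIC.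
pose g : g_sigma_algebraType (@open Sigma2) -> \bar R := EFin \o f.
have mg : measurable_fun setT g by exact: measurableT_comp.
have ic : m0.-integrable (c @^-1` setT) (g \o c).
  by rewrite preimage_setT; exact: integrable_comp.
have := @integral_pushforward _ _ (measurableTypeR R) _ R c mc _ _ _ mg ic measurableT.
by rewrite preimage_setT.
Qed.

(** Off [N] each coordinate of the codes is eventually constant, so the codes converge in the shift
    space, and f, being continuous on a compact space, supplies the constant dominating function. *)
Lemma cvg_Rintegral_code (mu_ : nat -> probability borel_Sigma2 R)
    (mu : probability borel_Sigma2 R) (c_ : nat -> R -> borel_Sigma2)
    (c : R -> borel_Sigma2) (N : set R) (f : Sigma2 -> R) :
  continuous f -> countable N ->
  (forall n, measurable_fun setT (c_ n)) -> measurable_fun setT c ->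
  (forall n X, measurable X -> mu_ n X = leb (`[0, 1[%classic `&` c_ n @^-1` X)) ->
  (forall X, measurable X -> mu X = leb (`[0, 1[%classic `&` c @^-1` X)) ->
  (forall t i, ~ N t -> \forall n \near \oo,
    (c_ n t : Sigma2) i = (c t : Sigma2) i) ->
  \int[mu_ n]_(s in setT) f s @[n --> \oo] --> \int[mu]_(s in setT) f s.
Proof.
move=> fc N_countable mc_ mc muE_ muE cvg_c.
have [C fC] := continuous_Sigma2_bounded fc.
rewrite (Rintegral_code fc mc muE).
under eq_fun do rewrite (Rintegral_code fc (mc_ _) (muE_ _)).
have mN : measurable N by exact: countable_measurable.
have mfc (c' : R -> borel_Sigma2) : measurable_fun setT c' ->
    measurable_fun setT (fun t => (f (c' t))%:E).
  move=> mc'; apply: measurableT_comp => //.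
  by apply: measurableT_comp mc'; exact: continuous_Sigma2_measurable.
apply: fine_cvg; rewrite fineK; last first.
  by apply: integrable_fin_num => //; exact: integrable_comp.
have [] := @dominated_convergence _ _ R m0 setT measurableT
  (fun n t => (f (c_ n t))%:E) (fun t => (f (c t))%:E) (cst C%:E).
- by move=> n; exact: mfc.
- exact: mfc.
- exists N; split=> //.
    apply: countable_lebesgue_measure0; apply: sub_countable N_countable.
    by apply: subset_card_le => t [].
  move=> t /= ht; apply: contrapT => Nt; apply: ht => _.
  apply: cvg_EFin; first exact: nearW.
  rewrite /comp/=; apply: (@cvg_comp _ _ _ (fun n => c_ n t) f); last exact: fc.
  by apply: cvg_Sigma2 => i; exact: cvg_c.
- by apply: (@integrable_comp (fun=> C) c) => // s; exact: cvg_cst.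
- by exists set0; split=> // t /=; apply: contra_notP => _ n _; rewrite lee_fin.
by move=> _ _; apply.
Qed.

End WeakContinuity.

(** * Density of the union of the Denjoy minimal sets *)

Section Separation.
Context {R : realType} {alpha : R}.
Hypothesis alpha_irr : irrational alpha.

Lemma frac_comb_gt0 (n : int) : n != 0 -> 0 < frac (n%:~R * alpha).
Proof.
move=> n0; rewrite lt_neqAle frac_ge0 andbT eq_sym; apply/eqP => h.
have [] := @irrational_comb _ _ alpha_irr n (- Num.floor (n%:~R * alpha)).
  by rewrite intrN.
by move=> nE; rewrite nE in n0.
Qed.

(** Each step adds the two integers of absolute value B + 1. Both signs count, as an arc must be
    clear of the others on either side; halving the minimum makes the bound strict. *)
Lemma separation (B : nat) : exists2 L : R, 0 < L < 1 &
  forall n : int, n != 0 -> (`|n| <= B)%N -> L < frac (n%:~R * alpha).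
Proof.
elim: B => [|B [L /andP[L0 L1] hL]].
  by exists 2^-1; [lra|move=> n n0 n0'; lia].
pose p := frac ((B.+1)%:Z%:~R * alpha); pose q := frac ((- B.+1%:Z)%:~R * alpha).
have p0 : 0 < p by apply: frac_comb_gt0; lia.
have q0 : 0 < q by apply: frac_comb_gt0; lia.
pose m := Num.min L (Num.min p q).
have m0 : 0 < m by rewrite !lt_min L0 p0 q0.
have mL : m <= L by rewrite ge_min lexx.
have mp : m <= p by rewrite !ge_min lexx orbT.
have mq : m <= q by rewrite !ge_min lexx !orbT.
exists (m / 2); first by lra.
move=> n n0; rewrite leq_eqVlt => /orP[/eqP nB|nB].
  have [nE|nE] : n = B.+1%:Z \/ n = - B.+1%:Z by lia.
    by rewrite nE -/p; lra.
  by rewrite nE -/q; lra.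
by have := hL n n0 nB; lra.
Qed.

End Separation.

Section Density.
Context {R : realType} {alpha : R}.
Hypothesis alpha_irr : irrational alpha.

Lemma denjoy_sets_dense :
  dense (\bigcup_(D in denjoy_sets (to_circle alpha)) D).
Proof.
move=> O [s Os] O_open.
have [n nO] := nbhs_Sigma2 (open_nbhs_nbhs (conj O_open Os)).
pose v (j : nat) : int := odflt 0 (unpickle j).
pose B := (\max_(j < n) `|v j|)%N.
have bound (i : int) : (pickle i < n)%N -> (`|i| <= B)%N.
  by move=> ni; have := @leq_bigmax _ (fun j : 'I_n => `|v j|%N) (Ordinal ni);
    rewrite /v /= pickleK.
(* All differences of positions below are at most 2 (B + 1) in absolute value. *)
have [L /andP[L0 L1] sepL] := separation alpha_irr (4 * B.+1).
(* One short arc starts at j alpha for each j in [-B, B] where [s] has a 1. The extra index [None]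
   is the strictly longest arc, placed at (B + 1) alpha, outside the window to be prescribed. *)
pose I0 := {j : 'I_(2 * B).+1 | s ((j : nat)%:Z - B%:Z)}.
pose k (a : option I0) : int :=
  if a is Some j then ((val j : nat)%:Z - B%:Z) else B.+1%:Z.
pose len (a : option I0) : R := if a is Some _ then L / 2 else L.
have k_bound a : (`|k a| <= B.+1)%N.
  by case: a => [[[j jB] sj]|] /=; lia.
have k_Some_bound j : (`|k (Some j)| <= B)%N.
  by case: j => [[j jB] sj] /=; lia.
have k_inj a b : a != b -> k a != k b.
  apply: contra => /eqP; case: a b => [a|] [b|] //.
  - case: a b => [[a aB] sa] [[b bB] sb] /= h; apply/eqP; congr Some.
    by apply/val_inj/val_inj => /=; lia.
  - by move=> h; have := k_Some_bound a; rewrite h /=; lia.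
  - by move=> h; have := k_Some_bound b; rewrite -h /=; lia.
have len_gt0 a : 0 < len a by case: a => [?|] /=; lra.
have len_lt a : a != None -> len a < len None by case: a => [?|] //= _; lra.
have k_sep a b : a != b -> len None < frac ((k a - k b)%:~R * alpha).
  move=> ab; apply: sepL; first by rewrite subr_eq0 k_inj.
  by have := k_bound a; have := k_bound b; lia.
pose t0 := arcs_code (alpha := alpha) (k := k) (len := len) 0.
exists t0; split.
  apply: nO => i /bound iB.
  rewrite /t0 /arcs_code /right_code add0r.
  case si : (s i).
    pose m : nat := `|(i + B%:Z)%R|%N.
    have mE : m%:Z - B%:Z = i by rewrite /m; lia.
    have mB : (m < (2 * B).+1)%N by rewrite /m; lia.
    have sj : s ((Ordinal mB : nat)%:Z - B%:Z) by rewrite /= mE.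
    apply/existsP; exists (Some (exist _ (Ordinal mB) sj)); rewrite /= mE.
    by rewrite subrr frac_id ?lexx ?ltr01//; lra.
  (* If [s] has a 0 at i, no arc starts at i alpha, and by separation i alpha is further than [L]
     past every left endpoint. *)
  apply/negbTE/negP => /existsP[a].
  rewrite -mulrBl -intrB => h.
  have ika : i - k a = 0.
    apply/eqP/negPn/negP => ne.
    have : L < frac ((i - k a)%:~R * alpha).
      by apply: sepL => //; have := k_bound a; lia.
    by move: h; case: (a) => [?|] /=; lra.
  case: a ika {h} => [[[j jB] sj]|] /= ij; last by lia.
  have iE : j%:Z - B%:Z = i by lia.
  by move: sj; rewrite /= iE si.
exists (arcs_set (alpha := alpha) (k := k) (len := len)).
  exact: (denjoy_arcs_set alpha_irr len_gt0 len_lt L1 k_sep).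
exact: (arcs_code_mem (alpha := alpha) (k := k) (len := len)).
Qed.

End Density.

(** * Topological balls of Denjoy minimal sets *)

Section SequentialContinuity.
Context {R : realType}.

(** Dominated convergence is about sequences; this transfers it to continuity in the vector of
    lengths. *)
Lemma sequentially_continuous (X : pseudoMetricType R) (g : X -> R) (x : X) :
  (forall u : nat -> X, u n @[n --> \oo] --> x -> g (u n) @[n --> \oo] --> g x) ->
  g y @[y --> x] --> g x.
Proof.
move=> seqc; apply/cvgrPdist_lt => e e0; apply: contrapT => ne.
have /choice[u hu] : forall n : nat, exists y,
    ball x n.+1%:R^-1 y /\ ~ (`|g x - g y| < e).
  move=> n; apply: contrapT => h; apply: ne; apply/nbhs_ballP.
  exists n.+1%:R^-1; first by rewrite /= invr_gt0 ltr0n.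
  by move=> y xy; apply: contrapT => gy; apply: h; exists y.
have ux : u n @[n --> \oo] --> x.
  apply/cvg_ballP => d d0; near=> n.
  have [+ _] := hu n; apply: le_ball.
  rewrite invf_ple ?posrE ?ltr0n//; apply: ltW.
  rewrite (@lt_le_trans _ _ n%:R)//; last by rewrite ler_nat.
  by near: n; exact: nbhs_infty_gtr.
have /cvgrPdist_lt/(_ e e0)[N _ /(_ N (leqnn N))] := seqc u ux.
by have [_] := hu N.
Unshelve. all: by end_near. Qed.

Lemma cvg_ptws {T : Type} {I : eqType} (F : set_system T)
    (f : T -> prod_topology (fun _ : I => R)) (l : prod_topology (fun _ : I => R)) :
  Filter F -> (forall i, f x i @[x --> F] --> l i) -> f x @[x --> F] --> l.
Proof.
move=> FF Fi; apply/cvg_sup => i U [_ [[V oV <-] /= Vl] VU].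
have := Fi i V (open_nbhs_nbhs (conj oV Vl)).
by apply: (@filterS _ F) => x; exact: VU.
Qed.

Lemma cvg_row {T : Type} n (F : set_system T) (f : T -> 'rV[R]_n) (l : 'rV[R]_n) :
  Filter F -> (forall j, f x ord0 j @[x --> F] --> l ord0 j) ->
  f x @[x --> F] --> l.
Proof.
move=> FF Fj U [P lP PU].
have : \forall x \near F, forall j, P ord0 j (f x ord0 j).
  by apply: filter_forall => j; apply: (Fj j); exact: lP.
by apply: (@filterS _ F) => x Px; apply: PU => i j; rewrite ord1.
Qed.

End SequentialContinuity.

Section Balls.
Context {R : realType} {alpha : R} {n : nat} {L : R}.
Hypotheses (alpha_irr : irrational alpha) (L_gt0 : 0 < L) (L_lt1 : L < 1)
  (L_sep : forall m : int, m != 0 -> (`|m| <= 6 * n.+1)%N ->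
    L < frac (m%:~R * alpha)).

(** The piecewise linear retraction of the line onto [-1, 1]. It keeps the lengths admissible for
    every row vector, so the embedding is total and continuous on the whole space. *)
Let clamp (x : R) : R := (`|x + 1| - `|x - 1|) / 2.

Let clamp_id x : `|x| <= 1 -> clamp x = x.
Proof.
rewrite ler_norml => /andP[h1 h2]; rewrite /clamp.
by rewrite ger0_norm ?ler0_norm; lra.
Qed.

Let clamp_itv x : -1 <= clamp x <= 1.
Proof.
have : `| `|x + 1| - `|x - 1| | <= 2.
  by rewrite (le_trans (ler_dist_dist _ _))// (_ : _ - _ = 2) ?ger0_norm//; ring.
by rewrite ler_norml /clamp => /andP[]; lra.
Qed.

Let clamp_continuous : continuous clamp.
Proof.
move=> x; rewrite /clamp; apply: cvgMl.
apply: cvgB; apply: cvg_norm; [apply: cvgD|apply: cvgB];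
  by [exact: cvg_id|exact: cvg_cst].
Qed.

Let k (a : option 'I_n) : int := if a is Some j then (2 * j + 1)%:Z else 0.

(** The variable lengths run through [L / 4, 3 L / 4], so they stay positive and the arc [None]
    remains strictly longest. *)
Let len (v : 'rV[R]_n) (a : option 'I_n) : R :=
  if a is Some j then L / 2 + L / 4 * clamp (v ord0 j) else L.

Let len_itv v j : L / 4 <= len v (Some j) <= 3 / 4 * L.
Proof.
rewrite /len; move: (clamp_itv (v ord0 j)); move: (clamp _) => c /andP[c1 c2].
have h1 : 0 <= L * (1 + c) by rewrite mulr_ge0 ?(ltW L_gt0)//; lra.
have h2 : 0 <= L * (1 - c) by rewrite mulr_ge0 ?(ltW L_gt0)//; lra.
by apply/andP; split; lra.
Qed.

Let len_gt0 v a : 0 < len v a.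
Proof.
case: a => [j|]; last exact: L_gt0.
by move: (len v _) (len_itv v j) L_gt0 => x /andP[]; lra.
Qed.

Let len_lt v a : a != None -> len v a < len v None.
Proof.
case: a => [j _|//]; change (len v None) with L.
by move: (len v _) (len_itv v j) L_gt0 => x /andP[]; lra.
Qed.

Let k_sep v a b : a != b -> len v None < frac ((k a - k b)%:~R * alpha).
Proof.
move=> ab; apply: L_sep.
  apply: contra ab; rewrite subr_eq0 => /eqP.
  case: a b => [[a an]|] [[b bn]|] //= h; apply/eqP; last by lia.
  - by congr Some; apply: val_inj => /=; lia.
  - by lia.
by case: a b {ab} => [[a an]|] [[b bn]|] //=; lia.
Qed.

Let D (v : 'rV[R]_n) : set Sigma2 := arcs_set (alpha := alpha) (k := k) (len := len v).

Let D_denjoy v : denjoy_sets (to_circle alpha) (D v).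
Proof. exact: (denjoy_arcs_set alpha_irr (len_gt0 v) (len_lt v) L_lt1 (k_sep v)). Qed.

Let muD v : probability borel_Sigma2 R := unique_measure R (D v).

Let code v : R -> borel_Sigma2 := arcs_code (alpha := alpha) (k := k) (len := len v).

Let muDE v (X : set borel_Sigma2) : measurable X ->
  muD v X = lebesgue_measure (`[0, 1[%classic `&` code v @^-1` X).
Proof.
exact: (unique_measure_arcs alpha_irr (len_gt0 v) (len_lt v) L_lt1 (k_sep v)).
Qed.

Let len_continuous a : continuous (len^~ a).
Proof.
case: a => [j|] v; last exact: (@cst_continuous _ _ L).
apply: (@continuous_comp _ _ _ (fun w : 'rV[R]_n => w ord0 j)
  (fun c => L / 2 + L / 4 * clamp c)); first exact: coord_continuous.
by apply: cvgD; [exact: cvg_cst|apply: cvgMr; exact: clamp_continuous].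
Qed.

Let muD_continuous (f : Sigma2 -> R) : continuous f ->
  continuous (fun v => \int[muD v]_(s in setT) f s).
Proof.
move=> fc v; apply: sequentially_continuous => u uv.
apply: (cvg_Rintegral_code (c_ := fun m => code (u m)) (c := code v)
  (N := endpoints (alpha := alpha) (len := len v))) => //.
- exact: endpoints_countable.
- by move=> m; exact: arcs_code_measurable.
- exact: arcs_code_measurable.
- by move=> m X mX; exact: muDE.
- exact: muDE.
- move=> t i tN.
  (* Only the right ends move with [v]. When t avoids the endpoints for [v], each comparison with a
     length is strict and therefore stable. *)
  have : \forall m \near \oo, forall a : option 'I_n,
      (frac (t + i%:~R * alpha - (k a)%:~R * alpha) < len (u m) a) =
      (frac (t + i%:~R * alpha - (k a)%:~R * alpha) < len v a).
    apply: filter_forall => a; set x := frac _.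
    have ulen : len (u m) a @[m --> \oo] --> len v a.
      by apply: (@cvg_comp _ _ _ u (len^~ a)); [exact: uv|exact: len_continuous].
    have [xl|xl|xl] := ltgtP x (len v a).
    - by near=> m; near: m; exact: (cvgr_gt _ ulen).
    - near=> m; apply/negbTE; rewrite -leNgt ltW//; near: m.
      exact: (cvgr_lt _ ulen).
    - exfalso; apply: tN; apply/endpointsP.
      exists (Some a, k a - i), (Num.floor (t + i%:~R * alpha - (k a)%:~R * alpha)).
      by rewrite /endpoint/= -xl /x /frac intrB; ring.
  by apply: (@filterS _ \oo) => m h; apply: eq_existsb => a; exact: h.
Unshelve. all: by end_near. Qed.

Definition ball_embedding (v : 'rV[R]_n) : denjoy_space (to_circle alpha) :=
  exist _ (D v) (mem_set (D_denjoy v)).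

Lemma ball_embedding_continuous : continuous ball_embedding.
Proof.
apply: continuous_comp_initial; apply: continuous_comp_initial => v.
apply: (@cvg_ptws R _ _ (nbhs v)) => f.
by apply: muD_continuous; exact: set_valP f.
Qed.

(** A finite coordinate condition, hence with continuous indicator, whose integral is weakly
    continuous; it is chosen so that this integral is the length of the j-th arc. *)
Let corr (j : 'I_n) : set Sigma2 := [set s | s 0 && s (- k (Some j))].

Let corr_continuous j : continuous (\1_(corr j) : Sigma2 -> R).
Proof.
move=> s; apply: cvg_near_cst; near=> t; rewrite !indicE; congr (nat_of_bool _)%:R.
rewrite /corr; apply/idP/idP; rewrite !inE/= => /andP[h1 h2]; apply/andP.
  rewrite -(near (near_coord s 0) t)// -(near (near_coord s (- k (Some j))) t)//.
rewrite (near (near_coord s 0) t)// (near (near_coord s (- k (Some j))) t)//.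
Unshelve. all: by end_near. Qed.

Let corr_fun j : set_type [set f : Sigma2 -> R | continuous f] :=
  exist _ (\1_(corr j)) (mem_set (@corr_continuous j)).

Let frac_lt (x y c : R) : frac x < c -> frac y < c -> c < 1 ->
  frac (x - y) < c \/ frac (y - x) < c.
Proof.
move=> xc yc c1; have x0 := frac_ge0 x; have y0 := frac_ge0 y.
have [xy|xy] := leP (frac y) (frac x).
  left; rewrite -(fracDz _ (Num.floor y - Num.floor x)).
  rewrite (_ : _ + _ = frac x - frac y); last by rewrite /frac intrB; ring.
  by rewrite frac_id; lra.
right; rewrite -(fracDz _ (Num.floor x - Num.floor y)).
rewrite (_ : _ + _ = frac y - frac x); last by rewrite /frac intrB; ring.
by rewrite frac_id; lra.
Qed.

(* A point of the union of the arcs stays in it after translation by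
   [- k_j alpha] only if it lies in the [j]-th arc, because [k_a = k_j + k_b]
   forces [a = Some j] and [b = None]: all [k_a] but [k_None = 0] are odd. *)
Let corr_code v j t : corr j (code v t : Sigma2) <->
  frac (t - (k (Some j))%:~R * alpha) < len v (Some j).
Proof.
rewrite /corr/= /code /arcs_code /right_code; split=> [/andP[]|h].
  rewrite mul0r addr0 intrN mulNr => /existsP[a ha] /existsP[b hb].
  have len_le c : len v c <= L.
    by case: c => [c|//]; exact: ltW (len_lt v (isT : Some c != None)).
  have km : k a = k (Some j) + k b.
    apply: contrapT => /eqP; rewrite -subr_eq0 => ne.
    have {}ha := lt_le_trans ha (len_le a).
    have {}hb := lt_le_trans hb (len_le b).
    (* Each of the three positions is below 2 n, which is where the bound 6 (n + 1) in [L_sep] comes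
       from. *)
    have kb : (`|(k a - (k (Some j) + k b))%R| <= 6 * n.+1)%N.
      case: j a b {ha hb ne} => j jn [[a an]|] [[b bn]|] /=; lia.
    have [] := frac_lt ha hb L_lt1.
      rewrite (_ : _ - _ = (- (k a - (k (Some j) + k b)))%:~R * alpha); last first.
        by rewrite intrN intrB intrD; ring.
      have := @L_sep (- (k a - (k (Some j) + k b))).
      by rewrite oppr_eq0 abszN => /(_ ne kb)/lt_trans/[apply]; rewrite ltxx.
    rewrite (_ : _ - _ = (k a - (k (Some j) + k b))%:~R * alpha); last first.
      by rewrite intrB intrD; ring.
    by move=> /(lt_trans (L_sep ne kb)); rewrite ltxx.
  suff aj : a = Some j by rewrite aj in ha.
  case: a b km {ha hb} => [a|] [b|] /=; [lia| |lia|lia].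
  by move=> h; congr Some; apply: val_inj => /=; lia.
rewrite mul0r addr0 intrN mulNr; apply/andP; split; apply/existsP.
  by exists (Some j).
exists None; rewrite mul0r subr0.
exact: lt_trans h (len_lt v (isT : Some j != None)).
Qed.

Let integral_corr v j :
  integrals (muD v) (corr_fun j) = len v (Some j).
Proof.
rewrite /integrals /Rintegral /=.
have mC : measurable (corr j : set borel_Sigma2).
  rewrite (_ : corr j = [set s | s 0 = true] `&` [set s | s (- k (Some j)) = true]).
    by apply: measurableI; apply: measurable_open_Sigma2; exact: open_coord.
  by apply/seteqP; split=> s /=; move=> /andP.
rewrite (_ : (\int[_]_x _)%E = muD v (corr j)); last first.
  by rewrite integral_indic// setIT.
rewrite muDE//.
rewrite (_ : _ @^-1` _ = [set t | frac (t - (k (Some j))%:~R * alpha) < len v (Some j)]).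
  rewrite lebesgue_measure_arc//; rewrite len_gt0/=.
  exact: ltW (lt_trans (len_lt v (isT : Some j != None)) L_lt1).
by apply/seteqP; split=> t /corr_code.
Qed.

(** The affine inverse of the length as a function of the coordinate, applied to the measured
    lengths. It is continuous on all of [denjoy_space], so a left inverse on the ball is all that
    remains to be checked. *)
Definition ball_coordinates (X : denjoy_space (to_circle alpha)) : 'rV[R]_n :=
  \row_j (4 / L * (integrals (unique_measure R (set_val X)) (corr_fun j) - L / 2)).

Lemma ball_coordinates_continuous : continuous ball_coordinates.
Proof.
move=> X; apply: (@cvg_row R _ _ (nbhs X)) => j.
rewrite mxE; under eq_fun do rewrite mxE.
apply: cvgMr; apply: cvgB; last exact: cvg_cst.
have mu_cont : continuous (fun Y : denjoy_space (to_circle alpha) =>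
    unique_measure R (set_val Y)) by exact: initial_continuous.
have int_cont : continuous (@integrals R : weak_probability R -> _).
  exact: initial_continuous.
apply: (@cvg_comp _ _ _ (fun Y : denjoy_space (to_circle alpha) =>
  integrals (unique_measure R (set_val Y))) (fun w => w (corr_fun j))).
  by apply: cvg_comp; [exact: mu_cont|exact: int_cont].
exact: (@proj_continuous _ (fun=> R) (corr_fun j)).
Qed.

Lemma ball_embeddingK v : closed_unit_ball v ->
  ball_coordinates (ball_embedding v) = v.
Proof.
move=> v1; apply/rowP => j; rewrite mxE integral_corr.
(* Coordinates of a point of the unit ball lie in [-1, 1], where [clamp] is the identity. *)
rewrite /= clamp_id; first by field; rewrite gt_eqF.
rewrite -sqrtr_sqr -sqrtr1 ler_sqrt//; apply: le_trans v1.
by rewrite (bigD1 j)//= lerDl sumr_ge0// => i _; exact: sqr_ge0.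
Qed.

End Balls.

Lemma topological_balls {R : realType} (alpha : R) n : irrational alpha ->
  exists B : set (denjoy_space (to_circle alpha)), topological_ball R n B.
Proof.
move=> alpha_irr.
have [L /andP[L_gt0 L_lt1] L_sep] := separation alpha_irr (6 * n.+1).
have hK := ball_embeddingK alpha_irr L_gt0 L_lt1 L_sep.
set h := ball_embedding alpha_irr L_gt0 L_lt1 L_sep in hK.
exists (h @` @closed_unit_ball R n), h, (@ball_coordinates R alpha n L); split=> //.
- by apply: continuous_subspaceT; exact: ball_embedding_continuous.
- by apply: continuous_subspaceT; exact: ball_coordinates_continuous.
Qed.

Theorem proposition4p1 (R : realType) (alpha : R)
    (alpha_irrational : irrational alpha) :
  [/\ forall n : nat, exists B : set (denjoy_space (to_circle alpha)),
        topological_ball R n B,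
      dense (\bigcup_(D in denjoy_sets (to_circle alpha)) D),
      forall D : set Sigma2, denjoy_sets (to_circle alpha) D ->
        exists2 U : set (circle R), RO0 U & D = Lambda U (to_circle alpha) &
      [set unique_measure R D | D in denjoy_sets (to_circle alpha)]
        `<=` lambda_RO0 (to_circle alpha)].
Proof.
split.
- by move=> n; exact: topological_balls.
- exact: denjoy_sets_dense.
- by move=> D; exact: denjoy_set_coded.
- by move=> _ [D D_denjoy <-]; exact: denjoy_unique_measure.
Qed.
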